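(* Let $\zeta^{in}\ge 0$ a.e. with $\zeta^{in}\in L^1_{0,1}$, and let $\varphi\in L^1_{0,1}$. Let $\mathcal{A}:\mathbb{R}_{>0}^3\to[0,\infty)$, $(x,y,z)\mapsto\mathcal{A}(x,y;z)$, be a measurable function with $\mathcal{A}(x,y;z)=0$ whenever $z>x$. Suppose that for some constant $A\ge 0$: (1) $\mathcal{A}(x,y;z)\le A\,\varphi(z)$ if $x+y<1$, and $\mathcal{A}(x,y;z)\le A\,(x+y)\,\varphi(z)$ if $x+y>1$; (2) $\mathcal{A}\in W^{1,\infty}_{loc}(\mathbb{R}_{>0}\times\mathbb{R}_{>0}\times\mathbb{R}_{>0})$; (3) $\dfrac{\partial}{\partial x}\mathcal{A}(x,y;z)\le A(1+y)\varphi(z)$ and $\dfrac{\partial}{\partial y}\mathcal{A}(x,y;z)\le A(1+x)\varphi(z)$. Then there exists a weak solution $\zeta$ (in the sense defined in the context) to the continuous generalized exchange-driven growth equation with kernel $\mathcal{A}$ and initial condition $\zeta^{in}$, such that $$\zeta\in \mathcal{C}([0,\infty);L^1_{0,1})\cap L^\infty(0,T;L^1_{0,1})\quad\text{for each } T>0.$$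
   Context: $\mathbb{R}_{>0}=(0,\infty)$, and $L^1_{0,1}=L^1(\mathbb{R}_{>0},(1+x)\,dx)$ with its standard norm. $\mathcal{C}([0,\infty),w\text{-}L^1(\mathbb{R}_{>0}))$ is the set of functions from $[0,\infty)$ to $L^1(\mathbb{R}_{>0})$ that are continuous for the weak topology of $L^1(\mathbb{R}_{>0})$. The continuous generalized exchange-driven growth equation is, for $x>0$, $t\ge0$, $$\begin{aligned}\partial_t\zeta(t,x)=&\int_0^\infty\!\!\int_0^\infty \mathcal{A}(x+z,y;z)\zeta(t,x+z)\zeta(t,y)\,dy\,dz-\int_0^\infty\!\!\int_z^\infty \mathcal{A}(y,x;z)\zeta(t,y)\zeta(t,x)\,dy\,dz\\&+\int_0^x\!\!\int_z^\infty \mathcal{A}(y,x-z;z)\zeta(t,y)\zeta(t,x-z)\,dy\,dz-\int_0^x\!\!\int_0^\infty \mathcal{A}(x,y;z)\zeta(t,x)\zeta(t,y)\,dy\,dz,\end{aligned}$$ with $\zeta(0,x)=\zeta^{in}(x)\ge 0$ a.e. Weak solution: given $0\le\zeta^{in}\in L^1_{0,1}$, a function $\zeta$ is a weak solution if (a) $0\le\zeta\in\mathcal{C}([0,\infty),w\text{-}L^1(\mathbb{R}_{>0}))\cap L^\infty(0,T;L^1_{0,1})$ for every $T>0$; and (b) for every $t\ge0$ and every smooth $\omega\in L^\infty(\mathbb{R}_{>0})$, $$\int_0^\infty\omega(x)[\zeta(t,x)-\zeta^{in}(x)]\,dx=\int_0^t\int_0^\infty\int_0^\infty\int_0^x\tilde\omega(x,y,z)\,\mathcal{A}(x,y;z)\,\zeta(s,x)\,\zeta(s,y)\,dz\,dy\,dx\,ds,$$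 where $\tilde\omega(x,y,z)=\omega(y+z)+\omega(x-z)-\omega(x)-\omega(y)$. *)

(* Defs.v *)
From HB Require Import structures.
From mathcomp Require Import all_boot all_order all_algebra.
From mathcomp Require Import all_classical all_reals all_analysis.

Set Implicit Arguments.
Unset Strict Implicit.
Unset Printing Implicit Defensive.

Import Order.TTheory GRing.Theory Num.Theory.
Import numFieldNormedType.Exports.

Local Open Scope classical_set_scope.
Local Open Scope ring_scope.

Definition Rpos (R : realType) : set R := [set x | 0 < x].

Definition Rpos3 (R : realType) : set (R * R * R) :=
  [set p | [/\ 0 < p.1.1, 0 < p.1.2 & 0 < p.2]].

Definition lebesgue1 (R : realType) :
  {measure set (measurableTypeR R) -> \bar R} := @lebesgue_measure R.

Definition lebesgue3 (R : realType) :
  {measure set (measurableTypeR R * measurableTypeR R * measurableTypeR R)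
     -> \bar R} :=
  ((@lebesgue_measure R \x @lebesgue_measure R) \x @lebesgue_measure R)%E.

(* Elements of Lebesgue spaces are represented by functions, not by classes
   of almost everywhere equal functions. *)

Definition in_Linfty (d : measure_display) (T : measurableType d)
    (R : realType) (mu : {measure set T -> \bar R}) (D : set T)
    (f : T -> R) : Prop :=
  measurable_fun D f /\
  exists M : R, {ae mu, forall x, D x -> `|f x| <= M}.

Definition in_L1 (R : realType) (f : R -> R) : Prop :=
  (lebesgue1 R).-integrable (@Rpos R) (fun x => (f x)%:E).

Definition L1norm (R : realType) (f : R -> R) : \bar R :=
  (\int[lebesgue1 R]_(x in @Rpos R) (`|f x|)%:E)%E.

(* L^1_{0,1} = L^1((0,oo), (1+x)dx) *)
Definition in_L01 (R : realType) (f : R -> R) : Prop :=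
  in_L1 (fun x => (1 + x) * f x).

Definition L01norm (R : realType) (f : R -> R) : \bar R :=
  L1norm (fun x => (1 + x) * f x).

(* Linearity and boundedness on L^1 force [l] to take equal values on almost
   everywhere equal functions, so [l] is an element of the dual of L^1. *)
Definition L1_dual (R : realType) (l : (R -> R) -> R) : Prop :=
  (forall (a : R) (f g : R -> R), in_L1 f -> in_L1 g ->
     l (fun x => a * f x + g x) = a * l f + l g) /\
  exists C : R, forall f : R -> R, in_L1 f ->
    ((`|l f|)%:E <= C%:E * L1norm f)%E.

Definition weakly_continuous_L1 (R : realType) (u : R -> R -> R) : Prop :=
  (forall t : R, 0 <= t -> in_L1 (u t)) /\
  forall l : (R -> R) -> R, L1_dual l ->
    {within [set t : R | 0 <= t], continuous (fun t => l (u t))}.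

Definition continuous_L01 (R : realType) (u : R -> R -> R) : Prop :=
  (forall t : R, 0 <= t -> in_L01 (u t)) /\
  forall t : R, 0 <= t ->
    (fun s => L01norm (fun x => u s x - u t x))
      @ within [set s : R | 0 <= s] (nbhs t) --> 0%E.

Definition simple_L01 (R : realType) (s : R -> R -> R) : Prop :=
  exists (m : nat) (E : 'I_m -> set R) (c : 'I_m -> R -> R),
    (forall i, measurable (E i) /\ in_L01 (c i)) /\
    forall t x, s t x = \sum_(i < m) \1_(E i) t * c i x.

Definition strongly_measurable_L01 (R : realType) (D : set R)
    (u : R -> R -> R) : Prop :=
  exists s : nat -> R -> R -> R,
    (forall n, simple_L01 (s n)) /\
    {ae lebesgue1 R, forall t, D t ->
       (fun n => L01norm (fun x => s n t x - u t x)) @ \oo --> 0%E}.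

(* the Bochner space L^oo(0,T; L^1_{0,1}) *)
Definition in_Linfty_L01 (R : realType) (T : R) (u : R -> R -> R) : Prop :=
  strongly_measurable_L01 `]0, T[ u /\
  exists M : R, {ae lebesgue1 R, forall t, t \in `]0, T[ ->
    in_L01 (u t) /\ (L01norm (u t) <= M%:E)%E}.

Definition smooth_on_Rpos (R : realType) (w : R -> R) : Prop :=
  forall (n : nat) (x : R), 0 < x -> derivable (derive1n n w) x 1.

(* C^oo: all iterated directional derivatives are differentiable. *)
Definition smooth3 (R : realType) (psi : R * R * R -> R) : Prop :=
  forall (vs : seq (R * R * R)) (p : R * R * R),
    differentiable (foldr (fun v g => 'D_v g) psi vs) p.

Definition test_function (R : realType) (psi : R * R * R -> R) : Prop :=
  [/\ smooth3 psi, compact (closure [set p | psi p != 0]) &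
      closure [set p | psi p != 0] `<=` @Rpos3 R].

Definition in_Linfty_loc (R : realType) (f : R * R * R -> R) : Prop :=
  forall C : set (R * R * R), compact C -> C `<=` @Rpos3 R ->
    in_Linfty (lebesgue3 R) C f.

(* [g] is the distributional derivative of [f] in direction [v]. *)
Definition weak_derivative (R : realType) (v : R * R * R)
    (f g : R * R * R -> R) : Prop :=
  forall psi : R * R * R -> R, test_function psi ->
    (\int[lebesgue3 R]_(p in @Rpos3 R) (f p * 'D_v psi p)%:E =
     - \int[lebesgue3 R]_(p in @Rpos3 R) (g p * psi p)%:E)%E.

Definition ex_ (R : realType) : R * R * R := (1, 0, 0).
Definition ey_ (R : realType) : R * R * R := (0, 1, 0).
Definition ez_ (R : realType) : R * R * R := (0, 0, 1).

Definition in_W1infty_loc (R : realType) (f : R * R * R -> R) : Prop :=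
  in_Linfty_loc f /\
  forall v, v \in [:: ex_ R; ey_ R; ez_ R] ->
    exists g, in_Linfty_loc g /\ weak_derivative v f g.

(* [K (x, y, z)] stands for A(x,y;z). *)
Definition weak_solution (R : realType) (K : R * R * R -> R) (zin : R -> R)
    (zeta : R -> R -> R) : Prop :=
  [/\ forall t : R, 0 <= t -> {ae lebesgue1 R, forall x, 0 < x -> 0 <= zeta t x},
      weakly_continuous_L1 zeta,
      forall T : R, 0 < T -> in_Linfty_L01 T zeta &
      forall (t : R) (w : R -> R), 0 <= t ->
        smooth_on_Rpos w -> in_Linfty (lebesgue1 R) (@Rpos R) w ->
        (\int[lebesgue1 R]_(x in @Rpos R) (w x * (zeta t x - zin x))%:E =
         \int[lebesgue1 R]_(s in `[0%R, t])
         \int[lebesgue1 R]_(x in @Rpos R)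
         \int[lebesgue1 R]_(y in @Rpos R)
         \int[lebesgue1 R]_(z in `]0%R, x[)
           ((w (y + z) + w (x - z) - w x - w y) *
            K (x, y, z) * zeta s x * zeta s y)%:E)%E].

(* Main.v *)
Require Import Defs.
From HB Require Import structures.
From mathcomp Require Import all_boot all_order all_algebra.
From mathcomp Require Import all_classical all_reals all_analysis.
From mathcomp Require Import measurable_realfun ring lra.

Set Implicit Arguments.
Unset Strict Implicit.
Unset Printing Implicit Defensive.

Import Order.TTheory GRing.Theory Num.Theory.
Import numFieldNormedType.Exports.

Local Open Scope classical_set_scope.
Local Open Scope ring_scope.

(** Why a solution exists. Write K = q |phi| and let lam be the finite measure
    |phi(z)| dz. Then q has at most bilinear growth, q(x,y,z) <= A (1+x)(1+y),
    and the equation says that the measures m_t = zeta(t,x) dx satisfy, for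
    bounded measurable w,

      d/dt int w dm_t = int int beta_w(x,y) m_t(dx) m_t(dy),
      beta_w(x,y) = int [w(y+z) + w(x-z) - w(x) - w(y)] q(x,y,z) lam(dz).

    Both sides make sense for finite measures with a first moment, and in this
    form the equation is solved by an explicit Euler scheme: with the rates cut
    off to a box, a small time step removes from nu less mass than nu has
    ([exchange_step]), so the iterates are positive measures.

    Four estimates hold for the iterates, uniformly in the mesh, on bounded time
    intervals. An exchange conserves the number of particles and the total mass,
    hence the (1+x)-moment does not grow ([step_mass]). For the weight
    [wgt r x] = |x| min(1, |x|/r) an exchange gains only a multiple of itself
    and of quantities that vanish as r grows; Gronwall's lemma gives a uniform
    control of the first moment at infinity ([step_wgt], [euler_tail]). A set B
    receives mass only through a translate or a reflection of lam, and
    lam(x + B) is small uniformly in x when B has small Lebesgue measure; so the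
    iterates are uniformly absolutely continuous ([step_set],
    [euler_abs_cont]). Finally one step changes int w by O(h sup|w|)
    ([rate_le]), so the iterates are Lipschitz in time for the total variation.

    Compactness is obtained along an ultrafilter on the indices n: every bounded
    real sequence converges, so the values nu_n(B) converge for every measurable
    B, and uniform integrability makes the limit countably additive
    ([ultralimit_measure]). The same applies to nu_n x nu_n, whose limit is
    identified on rectangles ([fprod_set_cvg]); hence bounded functions of one or
    of two variables pass to the limit ([bounded_cvg]), and the unbounded
    beta_w is replaced by its restriction to a box at a cost measured by the
    tail of [wgt r] ([Rintegral_fprod_tail]). The limit satisfies a difference
    form of the equation with an error o(t-s), which integrates to the weak
    equation ([limit_weak]).

    The limit measures are absolutely continuous; their Radon-Nikodym
    derivatives form the solution. Lipschitz continuity in total variation plus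
    the uniform tails give continuity in L^1((1+x)dx) ([flow_L01_close]), from
    which weak continuity and strong measurability follow. *)

(** * Finite measures: densities, images, products *)

Section generic_measures.
Context d (T : measurableType d) (R : realType).
Local Open Scope ereal_scope.

Section bundle_finite.
Variables (m : {measure set T -> \bar R}) (mfin : fin_num_fun m).

(** The proof of finiteness is an argument, so that the finite-measure structure
    can be attached to a measure known to be finite only by hypothesis. *)
Definition finite_bundle & fin_num_fun m : set T -> \bar R := m.

Local Notation m' := (finite_bundle mfin).
HB.instance Definition _ := Measure.on m'.
HB.instance Definition _ := Measure_isFinite.Build d T R m' mfin.

End bundle_finite.

Lemma finite_measure_ex (m : {measure set T -> \bar R}) : m setT < +oo ->
  exists m' : {finite_measure set T -> \bar R}, m' = m :> (set T -> \bar R).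
Proof.
by move=> moo; exists (finite_bundle (lty_fin_num_fun moo)).
Qed.

(** The measure f mu is the positive charge induced by f. Its Radon-Nikodym
    derivative is almost everywhere f, which turns the change of variables for
    that derivative into the stated formula. *)
Lemma density_measure (mu : {sigma_finite_measure set T -> \bar R})
    (f : T -> R) :
    (forall x, (0 <= f x)%R) -> mu.-integrable setT (EFin \o f) ->
  exists m : {finite_measure set T -> \bar R},
    forall g : T -> \bar R, measurable_fun setT g -> (forall x, 0 <= g x) ->
      \int[m]_x g x = \int[mu]_x (g x * (f x)%:E).
Proof.
move=> f0 intf; pose nu := induced_charge intf.
have nu_ge0 E : 0 <= nu E by apply: integral_ge0 => x _; rewrite lee_fin.
have [|m mE] := @finite_measure_ex (measure_of_charge nu nu_ge0).
  rewrite /measure_of_charge /nu /induced_charge.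
  exact: (integrable_lty measurableT intf).
exists m => g mg g0.
have mE' A : m A = \int[mu]_(x in A) (f x)%:E by rewrite mE.
have mmu : m `<< mu.
  apply/null_content_dominatesP => A mA A0; rewrite mE'.
  apply: null_set_integral => //.
  by apply: measurable_funTS; exact: (measurable_int mu).
rewrite -(Radon_Nikodym_SigmaFinite.change_of_variables mmu)//.
have inth := Radon_Nikodym_SigmaFinite.f_integrable mmu.
have h0 := Radon_Nikodym_SigmaFinite.f_ge0 mmu.
set h := Radon_Nikodym_SigmaFinite.f m mu in inth h0 *.
have hf : ae_eq mu setT h (EFin \o f).
  apply: integral_ae_eq => //; first exact: (measurable_int mu).
  by move=> E _ mE0; rewrite -Radon_Nikodym_SigmaFinite.f_integral// mE'.
apply: ge0_ae_eq_integral => //.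
- by apply: emeasurable_funM => //; exact: (measurable_int mu).
- by apply: emeasurable_funM => //; exact: (measurable_int mu).
- by move=> x _; rewrite mule_ge0.
- by move=> x _; rewrite mule_ge0// lee_fin.
- by apply: filterS hf => x /(_ I) xE _; rewrite xE.
Qed.

(** m2 - m1 is a charge whose values on measurable sets are nonnegative; it is
    set to 0 elsewhere to be nonnegative on all sets. *)
Lemma finite_measure_sub (m1 m2 : {finite_measure set T -> \bar R}) :
    (forall A, measurable A -> m1 A <= m2 A) ->
  exists m : {finite_measure set T -> \bar R},
    forall A, measurable A -> m A + m1 A = m2 A.
Proof.
move=> m12.
pose c := cadd (charge_of_finite_measure m2)
  (copp (charge_of_finite_measure m1)).
pose r A := if pselect (measurable A) then c A else 0.
have r0 : r set0 = 0.
  by rewrite /r; case: pselect => // ?; exact: (charge0 c).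
have rE A : measurable A -> r A = m2 A - m1 A.
  by move=> mA; rewrite /r; case: pselect.
have r_ge0 A : 0 <= r A.
  rewrite /r; case: pselect => // mA.
  by rewrite /c /cadd /copp/= sube_ge0 ?m12// fin_num_measure.
have r_sigma : semi_sigma_additive r.
  move=> F mF tF mUF; rewrite [r (\bigcup_n F n)]/r; case: pselect => // ?.
  have := @charge_semi_sigma_additive _ _ _ c F mF tF mUF.
  apply: cvg_trans; apply: near_eq_cvg; near=> n.
  by apply: eq_bigr => i _; rewrite /r; case: pselect => // ?; have := mF i.
pose m0 : {measure set T -> \bar R} := HB.pack r (isMeasure.Build d T R r r0 r_ge0 r_sigma).
have [|m mE] := @finite_measure_ex m0.
  by rewrite /m0/= rE// ltey_eq fin_numB !fin_num_measure.
by exists m => A mA; rewrite mE/= rE// subeK// fin_num_measure.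
Unshelve. all: by end_near. Qed.

End generic_measures.

Section products.
Context d1 d2 (T1 : measurableType d1) (T2 : measurableType d2) (R : realType).
Local Open Scope ereal_scope.

Lemma integral_prod_mul (m1 : {sigma_finite_measure set T1 -> \bar R})
    (m2 : {sigma_finite_measure set T2 -> \bar R})
    (a : T1 -> \bar R) (b : T2 -> \bar R) :
    measurable_fun setT a -> measurable_fun setT b ->
    (forall x, 0 <= a x) -> (forall y, 0 <= b y) ->
  \int[m1 \x m2]_p (a p.1 * b p.2) = \int[m1]_x a x * \int[m2]_y b y.
Proof.
move=> ma mb a0 b0; rewrite fubini_tonelli1//=.
- rewrite -ge0_integralZr//; last exact: integral_ge0.
  by apply: eq_integral => x _; rewrite /fubini_F/= ge0_integralZl.
- apply: emeasurable_funM; first exact: (measurableT_comp ma).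
  exact: (measurableT_comp mb).
- by move=> [x y]; rewrite mule_ge0.
Qed.

Lemma transport_measure (mu : {sigma_finite_measure set T1 -> \bar R})
    (f : T1 -> R) (phi : T1 -> T2) :
    (forall x, (0 <= f x)%R) -> mu.-integrable setT (EFin \o f) ->
    measurable_fun setT phi ->
  exists m : {finite_measure set T2 -> \bar R},
    forall g : T2 -> \bar R, measurable_fun setT g -> (forall x, 0 <= g x) ->
      \int[m]_y g y = \int[mu]_x (g (phi x) * (f x)%:E).
Proof.
move=> f0 intf mphi; have [m mE] := density_measure f0 intf.
pose nu : {measure set T2 -> \bar R} := pushforward m phi.
have [|m' m'E] := @finite_measure_ex _ _ _ (nu mphi).
  by rewrite /nu/= /pushforward preimage_setT -ge0_fin_numE// fin_num_measure.
exists m' => g mg g0.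
rewrite (@eq_measure_integral _ _ _ _ (nu mphi)); last first.
  by move=> A _ _; exact: (congr1 (@^~ A) m'E).
rewrite ge0_integral_pushforward// preimage_setT mE//.
by apply: measurableT_comp.
by move=> x /=.
Qed.

End products.

Section sums_of_measures.
Context d (T : measurableType d) (R : realType).
Local Open Scope ereal_scope.

Lemma finite_measure_add (m1 m2 : {finite_measure set T -> \bar R}) :
  exists m : {finite_measure set T -> \bar R},
    forall g : T -> \bar R, measurable_fun setT g -> (forall x, 0 <= g x) ->
      \int[m]_x g x = \int[m1]_x g x + \int[m2]_x g x.
Proof.
have [|m mE] := @finite_measure_ex _ _ _ (measure_add m1 m2).
  have : m1 setT + m2 setT < +oo.
    by rewrite lte_add_pinfty// -ge0_fin_numE// fin_num_measure.
  by rewrite -measure_addE.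
exists m => g mg g0; rewrite -ge0_integral_measure_add//.
by apply: eq_measure_integral => A _ _; exact: (congr1 (@^~ A) mE).
Qed.

Lemma finite_measure_sub_integral (m1 m2 : {finite_measure set T -> \bar R}) :
    (forall A, measurable A -> m1 A <= m2 A) ->
  exists m : {finite_measure set T -> \bar R},
    forall g : T -> \bar R, measurable_fun setT g -> (forall x, 0 <= g x) ->
      \int[m]_x g x + \int[m1]_x g x = \int[m2]_x g x.
Proof.
move=> /finite_measure_sub[m mE]; exists m => g mg g0.
rewrite -ge0_integral_measure_add//.
apply: eq_measure_integral => A mA _.
by rewrite -[RHS]/(m2 A) -[RHS]mE// -measure_addE.
Qed.

Lemma integral_indicT (m : {measure set T -> \bar R}) A : measurable A ->
  \int[m]_x (\1_A x)%:E = m A.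
Proof. by move=> mA; rewrite integral_indic// setIT. Qed.

End sums_of_measures.

Section finite_product.
Context d1 d2 (T1 : measurableType d1) (T2 : measurableType d2) (R : realType).
Local Open Scope ereal_scope.
Variables (m1 : {finite_measure set T1 -> \bar R}).
Variables (m2 : {finite_measure set T2 -> \bar R}).

Lemma finite_product_fin : fin_num_fun (m1 \x m2).
Proof.
apply: lty_fin_num_fun.
have : m1 setT * m2 setT < +oo; last first.
  by rewrite -(product_measure1E m1 m2 measurableT measurableT) setXTT.
by rewrite -ge0_fin_numE ?mule_ge0// fin_numM// fin_num_measure.
Qed.

(** The product keeps its finiteness, so that products can be iterated and every
    bounded measurable function is integrable. *)
Definition fprod : {finite_measure set (T1 * T2)%type -> \bar R} :=
  finite_bundle finite_product_fin.

Lemma fprodX A B : measurable A -> measurable B ->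
  fprod (A `*` B) = m1 A * m2 B.
Proof. exact: product_measure1E. Qed.

Lemma integral_fprod_mul (a : T1 -> \bar R) (b : T2 -> \bar R) :
    measurable_fun setT a -> measurable_fun setT b ->
    (forall x, 0 <= a x) -> (forall y, 0 <= b y) ->
  \int[fprod]_p (a p.1 * b p.2) = \int[m1]_x a x * \int[m2]_y b y.
Proof. exact: integral_prod_mul. Qed.

Lemma integral_fprod12 (f : T1 * T2 -> \bar R) :
    measurable_fun setT f -> (forall p, 0 <= f p) ->
  \int[fprod]_p f p = \int[m1]_x \int[m2]_y f (x, y).
Proof. exact: fubini_tonelli1. Qed.

Lemma fubini_fprod12 (f : T1 * T2 -> \bar R) :
    fprod.-integrable setT f ->
  \int[fprod]_p f p = \int[m1]_x \int[m2]_y f (x, y).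
Proof. by move=> imf; rewrite [RHS](integral12_prod_meas1 imf). Qed.

Lemma integrable_fubini_fprod (f : T1 * T2 -> \bar R) :
  fprod.-integrable setT f -> m1.-integrable setT (fun x => \int[m2]_y f (x, y)).
Proof. exact: integrable_fubini_F. Qed.

End finite_product.

Section bounded_functions.
Context d (T : measurableType d) (R : realType).

Lemma integrable_bounded (m : {finite_measure set T -> \bar R}) (f : T -> R) M :
    measurable_fun setT f -> (forall x, `|f x| <= M) ->
  m.-integrable setT (EFin \o f).
Proof.
move=> mf fM; apply: (measurable_bounded_integrable measurableT) => //.
  exact: (fin_num_fun_lty (fin_num_measure m)).
exists M; split; first by rewrite num_real.
by move=> M' /ltW MM' x _ /=; exact: le_trans (fM x) MM'.
Qed.

Lemma finite_massE (m : {finite_measure set T -> \bar R}) :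
  m setT = (fine (m setT))%:E.
Proof. by rewrite fineK// fin_num_measure. Qed.

Lemma EFin_Rintegral (m : {measure set T -> \bar R}) (f : T -> R) :
  m.-integrable setT (EFin \o f) ->
  (\int[m]_x f x)%:E = (\int[m]_x (f x)%:E)%E.
Proof. by move=> fi; rewrite /Rintegral fineK//; exact: integrable_fin_num. Qed.

End bounded_functions.

(** * One explicit Euler step *)

Section exchange_step.
Variable R : realType.
Notation T0 := (measurableTypeR R).
Local Open Scope ereal_scope.

Variables (lam : {finite_measure set T0 -> \bar R}).

(** A point ((x, y), z) stands for a pair (x, y) of particles exchanging the
    mass z. *)
Definition triple (nu : {finite_measure set T0 -> \bar R}) := fprod (fprod nu nu) lam.

Lemma integral_triple_mul (nu : {finite_measure set T0 -> \bar R})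
    (a b c : T0 -> \bar R) :
    measurable_fun setT a -> measurable_fun setT b -> measurable_fun setT c ->
    (forall x, 0 <= a x) -> (forall x, 0 <= b x) -> (forall x, 0 <= c x) ->
  \int[triple nu]_p (a p.1.1 * b p.1.2 * c p.2) =
  \int[nu]_x a x * \int[nu]_x b x * \int[lam]_x c x.
Proof.
move=> ma mb mc a0 b0 c0.
rewrite (@integral_fprod_mul _ _ _ _ _ (fprod nu nu) lam
  (fun p : T0 * T0 => a p.1 * b p.2) c)//.
- by rewrite integral_fprod_mul.
- apply: emeasurable_funM; first exact: (measurableT_comp ma).
  exact: (measurableT_comp mb).
- by move=> p; rewrite mule_ge0.
Qed.

Lemma le_integral_triple (nu : {finite_measure set T0 -> \bar R})
    (a b c : T0 -> \bar R) (f : T0 * T0 * T0 -> \bar R) (k : R) :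
    (0 <= k)%R ->
    measurable_fun setT a -> measurable_fun setT b -> measurable_fun setT c ->
    (forall x, 0 <= a x) -> (forall x, 0 <= b x) -> (forall x, 0 <= c x) ->
    measurable_fun setT f ->
    (forall p, 0 <= f p <= k%:E * (a p.1.1 * b p.1.2 * c p.2)) ->
  \int[triple nu]_p f p <=
  k%:E * (\int[nu]_x a x * \int[nu]_x b x * \int[lam]_z c z).
Proof.
move=> k0 ma mb mc a0 b0 c0 mf fle.
rewrite -integral_triple_mul//.
have mprod : measurable_fun setT
    (fun p : T0 * T0 * T0 => a p.1.1 * b p.1.2 * c p.2).
  apply: emeasurable_funM.
    apply: emeasurable_funM.
      by apply: (measurableT_comp ma); exact: measurableT_comp.
    by apply: (measurableT_comp mb); exact: measurableT_comp.
  exact: (measurableT_comp mc).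
have prod0 (p : T0 * T0 * T0) : 0 <= a p.1.1 * b p.1.2 * c p.2.
  by rewrite !mule_ge0.
rewrite -ge0_integralZl_EFin//.
apply: ge0_le_integral => //.
- by move=> p _; have /andP[] := fle p.
- by apply: measurable_funeM.
- by move=> p _; have /andP[] := fle p.
Qed.

Section step.
Variables (nu : {finite_measure set T0 -> \bar R}) (th : T0 * T0 * T0 -> R).
Variables (c : R).
Hypotheses (mth : measurable_fun setT th) (th0 : forall p, (0 <= th p)%R).
Hypotheses (c0 : (0 <= c)%R) (thle : forall p, (th p <= c)%R).
Hypothesis small : c%:E * (nu setT * lam setT) <= (2^-1)%:E.

Lemma integrable_triple : (triple nu).-integrable setT (EFin \o th).
Proof. by apply: (@integrable_bounded _ _ _ _ _ c) => // p; rewrite ger0_norm. Qed.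

(** With total rate theta, the step removes from nu the images of
    theta (nu x nu x lam) under x and y, and adds its images under y+z and x-z.
    Each of the two removed measures is at most nu / 2 by the smallness
    assumption, so the result is a positive measure. The loss stands on the
    left, since w may be non-integrable. *)
Lemma exchange_step : exists nu' : {finite_measure set T0 -> \bar R},
  forall w : T0 -> R, measurable_fun setT w -> (forall x, (0 <= w x)%R) ->
    \int[nu']_x (w x)%:E + \int[triple nu]_p ((w p.1.1 + w p.1.2) * th p)%:E =
    \int[nu]_x (w x)%:E +
    \int[triple nu]_p ((w (p.1.2 + p.2)%R + w (p.1.1 - p.2)%R) * th p)%:E.
Proof.
have mx : measurable_fun setT (fun p : T0 * T0 * T0 => p.1.1) by exact: measurableT_comp.
have my : measurable_fun setT (fun p : T0 * T0 * T0 => p.1.2) by exact: measurableT_comp.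
have mz : measurable_fun setT (fun p : T0 * T0 * T0 => p.2) by exact: measurable_snd.
have mg1 : measurable_fun setT (fun p : T0 * T0 * T0 => (p.1.2 + p.2)%R : T0).
  exact: measurable_funD.
have mg2 : measurable_fun setT (fun p : T0 * T0 * T0 => (p.1.1 - p.2)%R : T0).
  exact: measurable_funB.
have [m1 m1E] := transport_measure th0 integrable_triple mx.
have [m2 m2E] := transport_measure th0 integrable_triple my.
have [m3 m3E] := transport_measure th0 integrable_triple mg1.
have [m4 m4E] := transport_measure th0 integrable_triple mg2.
have [L LE] := finite_measure_add m1 m2.
have [G GE] := finite_measure_add m3 m4.
have [nuG nuGE] := finite_measure_add nu G.
have L_le A : measurable A -> L A <= nuG A.
  move=> mA; rewrite -[leLHS]integral_indicT// -[leRHS]integral_indicT//.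
  have mi : measurable_fun setT (fun x : T0 => (\1_A x : R)%:E).
    by apply/measurable_EFinP; exact: measurable_indic.
  have i0 x : 0 <= (\1_A x : R)%:E by rewrite lee_fin.
  rewrite LE// nuGE//; apply: (@le_trans _ _ (\int[nu]_x (\1_A x)%:E)); last first.
    by rewrite leeDl// integral_ge0.
  have half (m : {finite_measure set T0 -> \bar R}) :
      (\int[m]_x (\1_A x)%:E <= c%:E * (nu A * nu setT * lam setT)) ->
      (\int[m]_x (\1_A x)%:E <= (2^-1)%:E * nu A).
    move=> /le_trans; apply.
    have -> : c%:E * (nu A * nu setT * lam setT) =
              c%:E * (nu setT * lam setT) * nu A.
      by rewrite !muleA [c%:E * nu A * _]muleAC [LHS]muleAC.
    exact: lee_wpmul2r.
  have -> : \int[nu]_x (\1_A x)%:E = (2^-1)%:E * nu A + (2^-1)%:E * nu A.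
    rewrite integral_indicT// -ge0_muleDl ?lee_fin//.
    by rewrite -EFinD (_ : (2^-1 + 2^-1 = 1)%R) ?mul1e//; lra.
  have mth' : measurable_fun setT (fun p => (th p)%:E) by exact/measurable_EFinP.
  have th0' p : 0 <= (th p)%:E by rewrite lee_fin.
  have one0 (x : T0) : 0 <= cst 1 x :> \bar R by rewrite lee01.
  apply: leeD; apply: half.
  - rewrite m1E//; apply: le_trans.
      apply: (@le_integral_triple _ (fun x => (\1_A x)%:E) (cst 1) (cst 1) _ c) => //.
        by apply: emeasurable_funM => //; exact: (measurableT_comp mi).
      move=> p; rewrite mule_ge0//= !mule1 muleC.
      by apply: lee_wpmul2r => //; rewrite lee_fin.
    by rewrite integral_indicT// !integral_cst// !mul1e.
  - rewrite m2E//; apply: le_trans.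
      apply: (@le_integral_triple _ (cst 1) (fun x => (\1_A x)%:E) (cst 1) _ c) => //.
        by apply: emeasurable_funM => //; exact: (measurableT_comp mi).
      move=> p; rewrite mule_ge0//= !mule1 mul1e muleC.
      by apply: lee_wpmul2r => //; rewrite lee_fin.
    by rewrite integral_indicT// !integral_cst// !mul1e [nu setT * _]muleC.
have [nu' nu'E] := finite_measure_sub_integral L_le.
exists nu' => w mw w0.
have mw' : measurable_fun setT (EFin \o w) by exact/measurable_EFinP.
have w0' x : 0 <= (EFin \o w) x by rewrite lee_fin.
have splitPi (f g : T0 * T0 * T0 -> T0) : measurable_fun setT f -> measurable_fun setT g ->
    \int[triple nu]_p ((w (f p) + w (g p)) * th p)%:E =
    \int[triple nu]_p ((w (f p))%:E * (th p)%:E) +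
    \int[triple nu]_p ((w (g p))%:E * (th p)%:E).
  move=> mf mg; rewrite -ge0_integralD//.
  - by apply: eq_integral => p _; rewrite mulrDl EFinD !EFinM.
  - by move=> p _; rewrite mule_ge0// lee_fin.
  - by apply/emeasurable_funM; apply/measurable_EFinP => //; exact: (measurableT_comp mw).
  - by move=> p _; rewrite mule_ge0// lee_fin.
  - by apply/emeasurable_funM; apply/measurable_EFinP => //; exact: (measurableT_comp mw).
rewrite !splitPi//.
have := nu'E _ mw' w0'; rewrite LE// nuGE// GE// m1E// m2E// m3E// m4E//.
Qed.

End step.
End exchange_step.

(** * A weight that sees only the mass near infinity *)

Section superlinear_weight.
Variable R : realType.
Implicit Types r x y z : R.

Definition ramp r x := Num.min 1 (`|x| / r).
(** Equal to |x| beyond r and to x^2 / r below: it controls the first moment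
    outside [-r, r], is bounded by |x|, and tends to 0 pointwise as r grows. *)
Definition wgt r x := `|x| * ramp r x.

Lemma ramp_ge0 r x : 0 < r -> 0 <= ramp r x.
Proof. by move=> r0; rewrite le_min ler01 divr_ge0// ltW. Qed.

Lemma wgt_ge0 r x : 0 < r -> 0 <= wgt r x.
Proof. by move=> r0; rewrite mulr_ge0// ramp_ge0. Qed.

Lemma wgt_le r x : 0 < r -> wgt r x <= `|x|.
Proof. by move=> r0; rewrite ler_piMr// ge_min lexx. Qed.

Lemma wgt_le_sqr r x : 0 < r -> wgt r x <= x ^+ 2 / r.
Proof.
move=> r0; rewrite -real_normK ?num_real// expr2 -mulrA ler_wpM2l//.
by rewrite ge_min lexx orbT.
Qed.

Lemma ramp_mono r x y : 0 < r -> `|x| <= `|y| -> ramp r x <= ramp r y.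
Proof.
move=> r0 xy; rewrite le_min !ge_min lexx/= ler_pM2r ?invr_gt0//.
by rewrite xy orbT.
Qed.

Lemma wgt_mono r x y : 0 < r -> `|x| <= `|y| -> wgt r x <= wgt r y.
Proof. by move=> r0 xy; rewrite ler_pM ?ramp_ge0// ramp_mono. Qed.

Lemma ramp_big r x : 1 <= `|x| / r -> ramp r x = 1.
Proof. by move=> ?; rewrite /ramp min_l. Qed.

Lemma ramp_small r x : `|x| / r < 1 -> ramp r x = `|x| / r.
Proof. by move=> /ltW ?; rewrite /ramp min_r. Qed.

Lemma ramp_le1 r x : ramp r x <= 1.
Proof. by rewrite ge_min lexx. Qed.

Lemma ramp_le r x : ramp r x <= `|x| / r.
Proof. by rewrite ge_min lexx orbT. Qed.

Lemma ramp_subadd r x y : 0 < r -> ramp r (x + y) <= ramp r x + ramp r y.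
Proof.
move=> r0; have [rx ry] : 0 <= ramp r x /\ 0 <= ramp r y by rewrite !ramp_ge0.
have le1 := ramp_le1 r (x + y).
have [/ramp_big x1|/ramp_small x1] := leP 1 (`|x| / r); first by lra.
have [/ramp_big y1|/ramp_small y1] := leP 1 (`|y| / r); first by lra.
rewrite x1 y1 -mulrDl; apply: le_trans (ramp_le _ _) _.
by rewrite ler_pM2r ?invr_gt0// ler_normD.
Qed.

(** The function y -> ramp r y / y is nonincreasing, hence
    y ramp(y+z) <= (y+z) ramp(y); the other term z ramp(y+z) is split by
    subadditivity. *)
Lemma wgt_gain r y z : 0 < r -> 0 <= y -> 0 <= z ->
  wgt r (y + z) <= wgt r y + z * (2 * ramp r y) + wgt r z.
Proof.
move=> r0 y0 z0; rewrite /wgt !ger0_norm ?addr_ge0//.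
have key : y * ramp r (y + z) <= (y + z) * ramp r y.
  have le1 := ramp_le1 r (y + z).
  have [/ramp_big ->|/ramp_small ->] := leP 1 (`|y| / r); first by nra.
  have := ramp_le r (y + z); rewrite !ger0_norm ?addr_ge0// => le2.
  by rewrite mulrCA ler_wpM2l.
have := ramp_subadd y z r0; have := ramp_ge0 z r0; have := ramp_ge0 y r0; nra.
Qed.

Lemma ramp_wgt r y : 0 < r -> (1 + `|y|) * ramp r y <= 2 * wgt r y + r^-1.
Proof.
move=> r0; suff : ramp r y <= wgt r y + r^-1 by rewrite /wgt; nra.
have ri : 0 <= r^-1 by rewrite invr_ge0 ltW.
have [y1|y1] := leP 1 `|y|.
  apply: (@le_trans _ _ (wgt r y)); last by rewrite lerDl.
  by rewrite /wgt ler_peMl// ramp_ge0.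
apply: (@le_trans _ _ r^-1); last by rewrite lerDr wgt_ge0.
apply: le_trans (ramp_le _ _) _.
by rewrite -[leRHS]mul1r ler_wpM2r// ltW.
Qed.

(** The rate contains a factor 1+|y|, and (1+|y|) ramp r y is controlled by
    the weight itself up to 1/r. This is what closes the Gronwall argument. *)
Lemma wgt_gain_rate r k x y z t : 0 < r -> 0 <= k -> 0 <= x -> 0 <= z ->
  t <= k * ((1 + x) * (1 + `|y|)) ->
  z * (2 * ramp r y) * t <= k * ((1 + x) * (4 * wgt r y + 2 / r) * z).
Proof.
move=> r0 k0 x0 z0 tle; have rho0 := ramp_ge0 y r0.
apply: (@le_trans _ _ (z * (2 * ramp r y) * (k * ((1 + x) * (1 + `|y|))))).
  by rewrite ler_wpM2l// !mulr_ge0.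
have -> : z * (2 * ramp r y) * (k * ((1 + x) * (1 + `|y|))) =
    (k * (1 + x) * z) * (2 * ((1 + `|y|) * ramp r y)) by ring.
have -> : k * ((1 + x) * (4 * wgt r y + 2 / r) * z) =
    (k * (1 + x) * z) * (2 * (2 * wgt r y + r^-1)) by ring.
by rewrite ler_wpM2l ?mulr_ge0 ?addr_ge0// ler_wpM2l// ramp_wgt.
Qed.

Lemma wgt_tail r x : 0 < r -> r <= `|x| -> wgt r x = `|x|.
Proof.
by move=> r0 rx; rewrite /wgt /ramp min_l ?mulr1// ler_pdivlMr// mul1r.
Qed.

Lemma measurable_ramp r : measurable_fun setT (ramp r : measurableTypeR R -> R).
Proof.
have mabs : measurable_fun setT (fun x : measurableTypeR R => `|x| : R).
  by apply: measurableT_comp.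
by apply: measurable_minr => //; apply: measurable_funM.
Qed.

Lemma measurable_wgt r : measurable_fun setT (wgt r : measurableTypeR R -> R).
Proof.
have mabs : measurable_fun setT (fun x : measurableTypeR R => `|x| : R).
  by apply: measurableT_comp.
exact: (measurable_funM mabs (measurable_ramp r)).
Qed.

End superlinear_weight.

(** * A priori estimates for one step *)

Section step_estimates.
Variable R : realType.
Notation T0 := (measurableTypeR R).
Variables (lam nu nu' : {finite_measure set T0 -> \bar R}).
Variables (th : T0 * T0 * T0 -> R) (k S : R).
Hypotheses (mth : measurable_fun setT th) (th0 : forall p, 0 <= th p).
Hypothesis (thle : forall p, th p <= k * ((1 + `|p.1.1|) * (1 + `|p.1.2|))).
Hypothesis thb : exists c, forall p, th p <= c.
Hypothesis th_supp : forall p, th p != 0 -> [/\ 0 < p.2, p.2 < p.1.1 & 0 < p.1.2].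
Hypotheses (k0 : 0 <= k) (S0 : 0 <= S).
Local Open Scope ereal_scope.
Hypothesis step : forall w : T0 -> R,
  measurable_fun setT w -> (forall x, (0 <= w x)%R) ->
    \int[nu']_x (w x)%:E + \int[triple lam nu]_p ((w p.1.1 + w p.1.2) * th p)%:E =
    \int[nu]_x (w x)%:E +
    \int[triple lam nu]_p ((w (p.1.2 + p.2)%R + w (p.1.1 - p.2)%R) * th p)%:E.
Hypothesis nuS : \int[nu]_x (1 + `|x|)%:E <= S%:E.

Let mx : measurable_fun setT (fun p : T0 * T0 * T0 => p.1.1).
Proof. exact: measurableT_comp. Qed.
Let my : measurable_fun setT (fun p : T0 * T0 * T0 => p.1.2).
Proof. exact: measurableT_comp. Qed.
Let mz : measurable_fun setT (fun p : T0 * T0 * T0 => p.2).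
Proof. exact: measurable_snd. Qed.
Let mgain1 : measurable_fun setT (fun p : T0 * T0 * T0 => (p.1.2 + p.2)%R : T0).
Proof. exact: measurable_funD. Qed.
Let mgain2 : measurable_fun setT (fun p : T0 * T0 * T0 => (p.1.1 - p.2)%R : T0).
Proof. exact: measurable_funB. Qed.
Let mS : measurable_fun setT (fun x : T0 => (1 + `|x|)%R : R).
Proof. by apply: measurable_funD => //; exact: measurableT_comp. Qed.

Lemma integral_loss_lty (w : T0 -> R) :
    measurable_fun setT w -> (forall x, (0 <= w x)%R) ->
    \int[nu]_x (w x)%:E < +oo ->
  \int[triple lam nu]_p ((w p.1.1 + w p.1.2) * th p)%:E < +oo.
Proof.
move=> mw w0 wfin; have [c thc] := thb.
have w1 : \int[nu]_x (1 + w x)%:E < +oo.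
  under eq_integral do rewrite EFinD.
  rewrite ge0_integralD//; last exact/measurable_EFinP.
    rewrite integral_cst// mul1e lte_add_pinfty//.
    by rewrite -ge0_fin_numE// fin_num_measure.
  by move=> x _; rewrite lee_fin.
have w10 x : 0 <= (1 + w x)%:E by rewrite lee_fin addr_ge0.
have mw1 : measurable_fun setT (fun x => (1 + w x)%:E).
  by apply/measurable_EFinP; exact: measurable_funD.
have c0 : (0 <= c)%R := le_trans (th0 (0%R, 0%R, 0%R)) (thc _).
apply: (@le_lt_trans _ _ (c%:E * (\int[nu]_x (1 + w x)%:E *
    \int[nu]_x (1 + w x)%:E * \int[lam]_z 1))); last first.
  rewrite integral_cst// mul1e lte_mul_pinfty// ?lee_fin// lte_mul_pinfty//.
  - by rewrite mule_ge0// integral_ge0.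
  - by rewrite ge0_fin_numE ?mule_ge0 ?integral_ge0// lte_mul_pinfty ?integral_ge0//
       ge0_fin_numE ?integral_ge0.
  - by rewrite -ge0_fin_numE// fin_num_measure.
apply: le_integral_triple => //.
- apply/measurable_EFinP; apply: measurable_funM => //.
  by apply: measurable_funD; exact: (measurableT_comp mw).
move=> p; rewrite mule1 lee_fin mulr_ge0 ?addr_ge0//= -!EFinM lee_fin.
rewrite mulrC ler_pM ?addr_ge0// mulrDl mul1r.
by have := w0 p.1.1; have := w0 p.1.2; nra.
Qed.

(** The loss term is finite and cancels: only the excess D of the gain over the
    loss remains. *)
Lemma step_le (w : T0 -> R) (D : T0 * T0 * T0 -> R) :
    measurable_fun setT w -> (forall x, (0 <= w x)%R) ->
    measurable_fun setT D -> (forall p, (0 <= D p)%R) ->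
    \int[nu]_x (w x)%:E < +oo ->
    (forall p, [/\ 0 < p.2, p.2 < p.1.1 & 0 < p.1.2]%R ->
      (w (p.1.2 + p.2) + w (p.1.1 - p.2) <= w p.1.1 + w p.1.2 + D p)%R) ->
  \int[nu']_x (w x)%:E <=
  \int[nu]_x (w x)%:E + \int[triple lam nu]_p (D p * th p)%:E.
Proof.
move=> mw w0 mD D0 wfin wD.
have Lfin := integral_loss_lty mw w0 wfin.
have mL : measurable_fun setT (fun p => ((w p.1.1 + w p.1.2) * th p)%R).
  apply: measurable_funM => //.
  by apply: measurable_funD; exact: (measurableT_comp mw).
rewrite -(@leeD2rE _ (\int[triple lam nu]_p ((w p.1.1 + w p.1.2) * th p)%:E)); last first.
  by rewrite ge0_fin_numE// integral_ge0// => p _; rewrite lee_fin mulr_ge0 ?addr_ge0.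
rewrite step// -[leRHS]addeA; apply: leeD2l.
rewrite -ge0_integralD//; last 4 first.
- by move=> p _; rewrite lee_fin mulr_ge0.
- by apply/measurable_EFinP; exact: measurable_funM.
- by move=> p _; rewrite lee_fin mulr_ge0 ?addr_ge0.
- exact/measurable_EFinP.
apply: ge0_le_integral => //.
- by move=> p _; rewrite lee_fin mulr_ge0 ?addr_ge0.
- apply/measurable_EFinP/measurable_funM => //.
  by apply: measurable_funD; exact: (measurableT_comp mw).
- apply/measurable_EFinP/measurable_funD => //.
  exact: measurable_funM.
- move=> p _; rewrite -EFinD lee_fin -mulrDl.
  have [->|/th_supp/wD] := eqVneq (th p) 0%R; first by rewrite !mulr0.
  by rewrite [(D p + _)%R]addrC => ?; rewrite ler_wpM2r.
Qed.

(** The test function 1+|x| is conserved: (y+z) + (x-z) = x + y whenever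
    0 < z < x and 0 < y. *)
Lemma step_mass : \int[nu']_x (1 + `|x|)%:E <= S%:E.
Proof.
apply: le_trans nuS.
have := @step_le (fun x => (1 + `|x|)%R) (cst 0%R).
under [X in _ + X]eq_integral do rewrite /= mul0r.
rewrite integral0 adde0; apply => //.
- exact: le_lt_trans nuS (ltry _).
- move=> p [z0 zx y0]; rewrite /= addr0 !ger0_norm; lra.
Qed.

(** y+z and x-z are positive wherever theta does not vanish. *)
Lemma step_nonpos : nu [set x | (x <= 0)%R] = 0 -> nu' [set x | (x <= 0)%R] = 0.
Proof.
have mneg : measurable ([set x | (x <= 0)%R] : set T0).
  by rewrite -[X in measurable X]set_itvE; exact: measurable_itv.
have mi : measurable_fun setT (\1_[set x : T0 | (x <= 0)%R] : T0 -> R).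
  exact: measurable_indic.
rewrite -!integral_indicT// => nu0; apply/eqP; rewrite eq_le integral_ge0 ?andbT//.
have := @step_le (\1_[set x : T0 | (x <= 0)%R]) (cst 0%R).
under [X in _ + X]eq_integral do rewrite /= mul0r.
rewrite integral0 adde0 nu0; apply => //.
move=> p [z0 zx y0]; rewrite /= addr0 !indicE !memNset//=; lra.
Qed.

Let lee_mul3 (K : R) (a b c : \bar R) (a' b' c' : R) : (0 <= K)%R ->
  0 <= a -> 0 <= b -> 0 <= c -> a <= a'%:E -> b <= b'%:E -> c <= c'%:E ->
  K%:E * (a * b * c) <= (K * (a' * b' * c'))%:E.
Proof.
move=> K0 a0 b0 c0 aa bb cc; rewrite !EFinM lee_wpmul2l ?lee_fin//.
by rewrite lee_pmul ?mule_ge0// lee_pmul.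
Qed.

Lemma mass_le : nu setT <= S%:E.
Proof.
apply: le_trans nuS; rewrite -[leLHS]mul1e -integral_cst//.
apply: ge0_le_integral => //.
- exact/measurable_EFinP.
- by move=> x _; rewrite lee_fin lerDl.
Qed.

(** Since x-z <= x, only y -> y+z increases the weight; its excess is split by
    [wgt_gain] into a part linear in z times ramp r y and the weight of z. *)
Lemma step_wgt (r a om Z : R) : (0 < r)%R ->
    \int[nu]_x (wgt r x)%:E <= a%:E ->
    \int[lam]_z `|z|%:E <= Z%:E -> \int[lam]_z (wgt r z)%:E <= om%:E ->
  \int[nu']_x (wgt r x)%:E <=
    (a + k * (S * (4 * a + 2 / r * S) * Z + S * S * om))%:E.
Proof.
move=> r0 nua lamZ lamom.
have mw := @measurable_wgt R r.
have mramp := @measurable_ramp R r.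
pose D1 (p : T0 * T0 * T0) := (`|p.2| * (2 * ramp r p.1.2))%R.
pose D2 (p : T0 * T0 * T0) := wgt r p.2.
have mD1 : measurable_fun setT D1.
  apply: measurable_funM; first exact: measurableT_comp.
  by apply: measurable_funM => //; exact: (measurableT_comp mramp).
have mD2 : measurable_fun setT D2 by exact: (measurableT_comp mw).
have D10 p : (0 <= D1 p)%R by rewrite !mulr_ge0// ramp_ge0.
have D20 p : (0 <= D2 p)%R by rewrite wgt_ge0.
have w40 y : (0 <= 4 * wgt r y + 2 / r)%R.
  by apply: addr_ge0; [rewrite mulr_ge0// wgt_ge0|rewrite divr_ge0// ltW].
apply: (@le_trans _ _ (\int[nu]_x (wgt r x)%:E +
    \int[triple lam nu]_p ((D1 p + D2 p) * th p)%:E)).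
  apply: step_le => //.
  - by move=> x; rewrite wgt_ge0.
  - exact: measurable_funD.
  - by move=> p; rewrite addr_ge0.
  - exact: le_lt_trans nua (ltry _).
  - move=> p [z0 zx y0].
    have := wgt_gain r0 (ltW y0) (ltW z0).
    have : (wgt r (p.1.1 - p.2) <= wgt r p.1.1)%R.
      by apply: wgt_mono => //; rewrite !ger0_norm; lra.
    by rewrite /D1 /D2 (ger0_norm (ltW z0)); lra.
rewrite EFinD leeD//.
under eq_integral do rewrite mulrDl EFinD.
rewrite ge0_integralD//; last 4 first.
- by move=> p _; rewrite lee_fin mulr_ge0.
- by apply/measurable_EFinP; exact: measurable_funM.
- by move=> p _; rewrite lee_fin mulr_ge0.
- by apply/measurable_EFinP; exact: measurable_funM.
rewrite mulrDr EFinD leeD//.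
- apply: le_trans.
    apply: (@le_integral_triple _ _ _ (fun x => (1 + `|x|)%:E)
      (fun y => (4 * wgt r y + 2 / r)%:E) (fun z => `|z|%:E) _ k) => //.
    + exact/measurable_EFinP.
    + apply/measurable_EFinP; apply: measurable_funD => //.
      exact: measurable_funM.
    + exact/measurable_EFinP.
    + by apply/measurable_EFinP; exact: measurable_funM.
    + move=> p; rewrite lee_fin mulr_ge0//= -!EFinM lee_fin.
      exact: wgt_gain_rate.
  apply: lee_mul3 => //.
  + by apply: integral_ge0 => y _; rewrite lee_fin addr_ge0.
  + by apply: integral_ge0 => y _; rewrite lee_fin w40.
  + exact: integral_ge0.
  + under eq_integral do rewrite EFinD EFinM.
    rewrite ge0_integralD//; last 3 first.
    * by move=> y _; rewrite -EFinM lee_fin mulr_ge0 ?wgt_ge0.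
    * by apply: measurable_funeM; exact/measurable_EFinP.
    * by move=> y _; rewrite lee_fin divr_ge0 ?ltW.
    rewrite integral_cst// ge0_integralZl_EFin//; last 2 first.
    * by move=> y _; rewrite lee_fin wgt_ge0.
    * exact/measurable_EFinP.
    rewrite [leRHS]EFinD; apply: leeD; first by rewrite [leRHS]EFinM lee_wpmul2l.
    rewrite [leRHS]EFinM lee_wpmul2l ?mass_le//.
    by rewrite lee_fin divr_ge0// ltW.
- apply: le_trans.
    apply: (@le_integral_triple _ _ _ (fun x => (1 + `|x|)%:E)
      (fun y => (1 + `|y|)%:E) (fun z => (wgt r z)%:E) _ k) => //.
    + exact/measurable_EFinP.
    + exact/measurable_EFinP.
    + exact/measurable_EFinP.
    + by move=> y; rewrite lee_fin wgt_ge0.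
    + by apply/measurable_EFinP; exact: measurable_funM.
    + move=> p; rewrite lee_fin mulr_ge0//= -!EFinM lee_fin.
      by rewrite [leRHS]mulrA mulrC ler_wpM2r.
  apply: lee_mul3 => //.
  + by apply: integral_ge0 => y _; rewrite lee_fin addr_ge0.
  + by apply: integral_ge0 => y _; rewrite lee_fin addr_ge0.
  + by apply: integral_ge0 => y _; rewrite lee_fin wgt_ge0.
Qed.

(** For fixed x and y the gain of B is lam {z | y+z in B or x-z in B}, small
    uniformly in x and y. *)
Lemma step_set (B : set T0) (a om : R) : measurable B ->
    nu B <= a%:E ->
    (forall x, lam [set z | B (x + z)%R] <= om%:E) ->
    (forall x, lam [set z | B (x - z)%R] <= om%:E) ->
  nu' B <= (a + k * (S * S * (2 * om)))%:E.
Proof.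
move=> mB nuB omD omB.
have mi : measurable_fun setT (\1_B : T0 -> R) by exact: measurable_indic.
rewrite -[leLHS]integral_indicT//.
have i0 x : (0 <= (\1_B x : R))%R by [].
apply: (@le_trans _ _ (\int[nu]_x (\1_B x)%:E +
    \int[triple lam nu]_p ((\1_B (p.1.2 + p.2) + \1_B (p.1.1 - p.2)) * th p)%:E)).
  rewrite -step// leeDl// integral_ge0// => p _.
  by rewrite lee_fin mulr_ge0 ?addr_ge0.
rewrite integral_indicT// EFinD leeD//.
pose g (p : T0 * T0 * T0) := ((1 + `|p.1.1|) * (1 + `|p.1.2|))%R.
have mg : measurable_fun setT g.
  by apply: measurable_funM; exact: (measurableT_comp mS).
have g0 p : (0 <= g p)%R by rewrite mulr_ge0 ?addr_ge0.
have mgain : measurable_fun setT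
    (fun p : T0 * T0 * T0 => \1_B (p.1.2 + p.2)%R + \1_B (p.1.1 - p.2)%R : R)%R.
  by apply: measurable_funD; exact: (measurableT_comp mi).
pose F (p : T0 * T0 * T0) :=
  ((k * g p)%:E * (\1_B (p.1.2 + p.2) + \1_B (p.1.1 - p.2))%:E).
have mF : measurable_fun setT F.
  by apply: emeasurable_funM; apply/measurable_EFinP => //; exact: measurable_funM.
have F0 p : 0 <= F p.
  by rewrite /F mule_ge0// lee_fin ?mulr_ge0 ?addr_ge0.
apply: (@le_trans _ _ (\int[triple lam nu]_p F p)).
  apply: ge0_le_integral => //.
  - by move=> p _; rewrite lee_fin mulr_ge0 ?addr_ge0.
  - by apply/measurable_EFinP; exact: measurable_funM.
  - by move=> p _; rewrite /F -EFinM lee_fin mulrC ler_wpM2r ?addr_ge0.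
rewrite integral_fprod12//.
have mB1 x : measurable [set z : T0 | B (x + z)%R].
  rewrite -[X in measurable X]setTI.
  have : measurable_fun setT (fun z : T0 => (x + z)%R : T0) by exact: measurable_funD.
  by apply.
have mB2 x : measurable [set z : T0 | B (x - z)%R].
  rewrite -[X in measurable X]setTI.
  have : measurable_fun setT (fun z : T0 => (x - z)%R : T0) by exact: measurable_funB.
  by apply.
have om0 : (0 <= om)%R by rewrite -lee_fin; exact: le_trans (omD 0%R).
apply: (@le_trans _ _ (\int[fprod nu nu]_p
    ((k * (2 * om))%:E * ((1 + `|p.1|)%:E * (1 + `|p.2|)%:E)))).
  apply: ge0_le_integral => //.
  - by move=> p _; exact: integral_ge0.
  - exact: (measurable_fun_fubini_tonelli_F F mF F0).
  - apply: measurable_funeM; apply: emeasurable_funM; apply/measurable_EFinP.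
      by apply: (measurableT_comp mS); exact: measurable_fst.
    by apply: (measurableT_comp mS); exact: measurable_snd.
  - move=> [x y] _ /=; rewrite /F /g /= ge0_integralZl_EFin//; last 2 first.
    + apply/measurable_EFinP; apply: measurable_funD.
        apply: (measurableT_comp mi); exact: measurable_funD.
      apply: (measurableT_comp mi); exact: measurable_funB.
    + by rewrite mulr_ge0// mulr_ge0 ?addr_ge0.
    have -> : (k * (2 * om))%:E * ((1 + `|x|)%:E * (1 + `|y|)%:E) =
        (k * ((1 + `|x|) * (1 + `|y|)))%:E * (2 * om)%:E.
      by rewrite -!EFinM mulrAC.
    rewrite lee_wpmul2l ?lee_fin ?mulr_ge0 ?addr_ge0//.
    under eq_integral do rewrite EFinD.
    rewrite ge0_integralD//; last 2 first.
    + by apply/measurable_EFinP/(measurableT_comp mi); exact: measurable_funD.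
    + by apply/measurable_EFinP/(measurableT_comp mi); exact: measurable_funB.
    rewrite mulr2n mulrDl mul1r EFinD leeD//.
    + have := omD y; rewrite -integral_indicT//.
    + have := omB x; rewrite -integral_indicT//.
rewrite ge0_integralZl_EFin//; last 2 first.
- apply: emeasurable_funM; apply/measurable_EFinP.
    by apply: (measurableT_comp mS); exact: measurable_fst.
  by apply: (measurableT_comp mS); exact: measurable_snd.
- by rewrite mulr_ge0// mulr_ge0.
have mS' : measurable_fun setT (fun x : T0 => (1 + `|x|)%:E).
  exact/measurable_EFinP.
have S0' (x : T0) : 0 <= (1 + `|x|)%:E by rewrite lee_fin addr_ge0.
rewrite (integral_fprod_mul _ _ mS' mS' S0' S0').
have -> : (k * (S * S * (2 * om)))%:E = (k * (2 * om))%:E * (S%:E * S%:E).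
  by rewrite -!EFinM; congr (_%:E); ring.
rewrite lee_wpmul2l ?lee_fin ?mulr_ge0//.
by rewrite lee_pmul// integral_ge0.
Qed.

Local Open Scope ring_scope.

Lemma step_bounded_ge0 (w : T0 -> R) (M : R) : measurable_fun setT w ->
    (forall x, 0 <= w x <= M) ->
  \int[nu']_x w x + \int[triple lam nu]_p ((w p.1.1 + w p.1.2) * th p) =
  \int[nu]_x w x +
  \int[triple lam nu]_p ((w (p.1.2 + p.2) + w (p.1.1 - p.2)) * th p).
Proof.
move=> mw wM; have [c thc] := thb.
have w0 x : 0 <= w x by case/andP: (wM x).
have wM' x : `|w x| <= M by rewrite ger0_norm//; case/andP: (wM x).
have iw (m : {finite_measure set T0 -> \bar R}) : m.-integrable setT (EFin \o w).
  exact: integrable_bounded wM'.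
have c0 : 0 <= c := le_trans (th0 (0, 0, 0)) (thc _).
have ith (f g : T0 * T0 * T0 -> T0) : measurable_fun setT f -> measurable_fun setT g ->
    (triple lam nu).-integrable setT
      (EFin \o (fun p => (w (f p) + w (g p)) * th p)).
  move=> mf mg; apply: (@integrable_bounded _ _ _ _ _ ((M + M) * c)).
    by apply: measurable_funM => //; apply: measurable_funD; exact: (measurableT_comp mw).
  move=> p; rewrite normrM ler_pM// ?(ger0_norm (th0 p))//.
  by rewrite (le_trans (ler_normD _ _))// lerD.
have iwn := iw nu; have iwn' := iw nu'.
have i1 := ith _ _ mx my; have i2 := ith _ _ mgain1 mgain2.
apply: EFin_inj; rewrite !EFinD !EFin_Rintegral//.
exact: step.
Qed.

(** The step is known for nonnegative test functions; adding the constant M to w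
    changes both sides equally. *)
Lemma step_signed (w : T0 -> R) (M : R) : measurable_fun setT w ->
    (forall x, `|w x| <= M) ->
  \int[nu']_x w x = \int[nu]_x w x +
  \int[triple lam nu]_p
    ((w (p.1.2 + p.2) + w (p.1.1 - p.2) - w p.1.1 - w p.1.2) * th p).
Proof.
move=> mw wM; have [c thc] := thb.
have c0 : 0 <= c := le_trans (th0 (0, 0, 0)) (thc _).
have M0 : 0 <= M := le_trans (normr_ge0 _) (wM 0).
have iw (m : {finite_measure set T0 -> \bar R}) : m.-integrable setT (EFin \o w).
  exact: integrable_bounded wM.
have iM (m : {finite_measure set T0 -> \bar R}) :
    m.-integrable setT (EFin \o (fun=> M)).
  by apply: (@integrable_bounded _ _ _ _ _ M) => // x; rewrite ger0_norm.
have [iwn iwn'] := (iw nu, iw nu'); have [iMn iMn'] := (iM nu, iM nu').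
have ith (f g : T0 * T0 * T0 -> T0) (v : T0 -> R) (M' : R) : measurable_fun setT v ->
    (forall x, `|v x| <= M') ->
    measurable_fun setT f -> measurable_fun setT g ->
    (triple lam nu).-integrable setT
      (EFin \o (fun p => (v (f p) + v (g p)) * th p)).
  move=> mv vM mf mg; apply: (@integrable_bounded _ _ _ _ _ ((M' + M') * c)).
    by apply: measurable_funM => //; apply: measurable_funD; exact: (measurableT_comp mv).
  move=> p; rewrite normrM ler_pM// ?(ger0_norm (th0 p))//.
  by rewrite (le_trans (ler_normD _ _))// lerD.
have stepM : \int[nu']_x M = \int[nu]_x M.
  have mM : measurable_fun setT (fun _ : T0 => M) by [].
  have := @step_bounded_ge0 (fun=> M) M mM.
  by rewrite M0 lexx => /(_ (fun=> isT)) /addIr.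
have mwM : measurable_fun setT (fun x => w x + M) by exact: measurable_funD.
have wM1 x : 0 <= w x + M <= M + M.
  by have := wM x; rewrite ler_norml => /andP[? ?]; apply/andP; split; lra.
have := step_bounded_ge0 mwM wM1.
rewrite !RintegralD// stepM => E.
have {}E : \int[nu']_x w x +
      \int[triple lam nu]_p ((w p.1.1 + M + (w p.1.2 + M)) * th p) =
   \int[nu]_x w x +
      \int[triple lam nu]_p ((w (p.1.2 + p.2) + M + (w (p.1.1 - p.2) + M)) * th p).
  by move: E; lra.
have wM1' x : `|w x + M| <= M + M by rewrite ger0_norm; case/andP: (wM1 x).
rewrite (_ : \int[triple lam nu]_p ((w (p.1.2 + p.2) + w (p.1.1 - p.2) - w p.1.1
    - w p.1.2) * th p) =
  \int[triple lam nu]_p ((w (p.1.2 + p.2) + M + (w (p.1.1 - p.2) + M)) * th p) -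
  \int[triple lam nu]_p ((w p.1.1 + M + (w p.1.2 + M)) * th p)).
  by move: E; lra.
rewrite -RintegralB//.
- by apply: eq_Rintegral => p _; ring.
- exact: (ith _ _ _ _ mwM wM1' mgain1 mgain2).
- exact: (ith _ _ _ _ mwM wM1' mx my).
Qed.

End step_estimates.

(** * The exchange operator in weak form and the Euler sequences *)

Section sections.
Context d1 d2 (T1 : measurableType d1) (T2 : measurableType d2) (R : realType).

Lemma measurable_integral_section (m : {sigma_finite_measure set T2 -> \bar R})
    (f : T1 * T2 -> \bar R) : measurable_fun setT f ->
  measurable_fun setT (fun x => \int[m]_y f (x, y))%E.
Proof.
move=> mf.
rewrite [X in measurable_fun _ X](_ : _ = (fun x => fubini_F m f^\+ x) \-
   (fun x => fubini_F m f^\- x))%E; last first.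
  apply/funext => x; rewrite [LHS]integralE.
  under eq_integral do rewrite funepos_comp/=.
  by under [X in (_ - X = _)%E]eq_integral do rewrite funeneg_comp/=.
apply: emeasurable_funB.
- by apply: measurable_fun_fubini_tonelli_F => //; exact: measurable_funepos.
- by apply: measurable_fun_fubini_tonelli_F => //; exact: measurable_funeneg.
Qed.

Lemma measurable_Rintegral_section (m : {sigma_finite_measure set T2 -> \bar R})
    (f : T1 * T2 -> R) : measurable_fun setT f ->
  measurable_fun setT (fun x => \int[m]_y f (x, y)).
Proof.
move=> mf; apply: (measurableT_comp (fine_measurable measurableT)).
by apply: (@measurable_integral_section m (EFin \o f)); exact/measurable_EFinP.
Qed.

Lemma Rintegral_fprod12 (m1 : {finite_measure set T1 -> \bar R})
    (m2 : {finite_measure set T2 -> \bar R}) (f : T1 * T2 -> R) :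
    (fprod m1 m2).-integrable setT (EFin \o f) ->
    (forall x, m2.-integrable setT (fun y => (f (x, y))%:E)) ->
  \int[fprod m1 m2]_p f p = \int[m1]_x \int[m2]_y f (x, y).
Proof.
move=> intf intf2; rewrite {1}/Rintegral fubini_fprod12//; congr fine.
by apply: eq_integral => x _; rewrite EFin_Rintegral//; exact: intf2.
Qed.

Lemma Rintegral_bound d (T : measurableType d) (m : {finite_measure set T -> \bar R})
    (f : T -> R) M : measurable_fun setT f -> (forall x, `|f x| <= M) ->
  `|\int[m]_x f x| <= M * fine (m setT).
Proof.
move=> mf fM; have intf := integrable_bounded m mf fM.
apply: le_trans (le_normr_Rintegral _ intf) _ => //.
rewrite -[leRHS]Rintegral_cst//.
apply: le_Rintegral => //; first exact: integrable_norm.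
apply: (@integrable_bounded _ _ _ _ _ `|M|) => //.
Qed.

End sections.

Section euler.
Variable R : realType.
Notation T0 := (measurableTypeR R).
Variables (lam mu0 : {finite_measure set T0 -> \bar R}).
Variables (q : T0 * T0 * T0 -> R) (A S : R).
Hypotheses (mq : measurable_fun setT q) (q0 : forall p, 0 <= q p).
Hypothesis (qle : forall p, q p <= A * ((1 + `|p.1.1|) * (1 + `|p.1.2|))).
Hypothesis q_supp : forall p, q p != 0 -> [/\ 0 < p.2, p.2 < p.1.1 & 0 < p.1.2].
Hypotheses (A0 : 0 <= A) (S0 : 0 <= S).
Hypothesis mu0S : (\int[mu0]_x (1 + `|x|)%:E <= S%:E)%E.
Hypothesis mu0_pos : mu0 [set x | x <= 0] = 0.

Let Lam := fine (lam setT).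

Definition box n : set (T0 * T0) := `[- n, n]%classic `*` `[- n, n]%classic.

Lemma measurable_box (n : R) : measurable (box n).
Proof. by apply: measurableX; exact: measurable_itv. Qed.

Lemma boxP (n : R) p : box n p <-> `|p.1| <= n /\ `|p.2| <= n.
Proof. by rewrite /box /= !in_itv/= !ler_norml. Qed.

(** Change of the sum of w over a pair when it exchanges z. *)
Definition exchange (w : T0 -> R) (p : T0 * T0 * T0) :=
  w (p.1.2 + p.2) + w (p.1.1 - p.2) - w p.1.1 - w p.1.2.

(** The exchange operator tested against w is the integral of this function
    against the square of the measure. *)
Definition beta (w : T0 -> R) (p : T0 * T0) :=
  \int[lam]_z (exchange w (p, z) * q (p, z)).

Lemma measurable_exchange (w : T0 -> R) : measurable_fun setT w ->
  measurable_fun setT (exchange w).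
Proof.
have mx : measurable_fun setT (fun p : T0 * T0 * T0 => p.1.1) by exact: measurableT_comp.
have my : measurable_fun setT (fun p : T0 * T0 * T0 => p.1.2) by exact: measurableT_comp.
have mz : measurable_fun setT (fun p : T0 * T0 * T0 => p.2) by exact: measurable_snd.
move=> mw; apply: measurable_funB; last exact: (measurableT_comp mw my).
apply: measurable_funB; last exact: (measurableT_comp mw mx).
apply: measurable_funD; first exact: (measurableT_comp mw (measurable_funD my mz)).
exact: (measurableT_comp mw (measurable_funB mx mz)).
Qed.

Lemma exchange_le (w : T0 -> R) (M : R) (p : T0 * T0 * T0) : (forall x, `|w x| <= M) -> `|exchange w p| <= 4 * M.
Proof.
move=> wM; rewrite /exchange.
have := wM (p.1.2 + p.2); have := wM (p.1.1 - p.2); have := wM p.1.1; have := wM p.1.2.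
by rewrite !ler_norml => /andP[? ?] /andP[? ?] /andP[? ?] /andP[? ?]; apply/andP; split; lra.
Qed.

Lemma measurable_beta (w : T0 -> R) : measurable_fun setT w -> measurable_fun setT (beta w).
Proof.
move=> mw; apply: (@measurable_Rintegral_section _ _ _ _ _ lam
  (fun p => exchange w p * q p)).
by apply: measurable_funM => //; exact: measurable_exchange.
Qed.

Lemma integrable_exchange (w : T0 -> R) (M : R) (p : T0 * T0) :
    measurable_fun setT w -> (forall x, `|w x| <= M) ->
  lam.-integrable setT (EFin \o (fun z => exchange w (p, z) * q (p, z))) /\
  `|beta w p| <= 4 * M * A * Lam * ((1 + `|p.1|) * (1 + `|p.2|)).
Proof.
move=> mw wM.
have mf : measurable_fun setT (fun z => exchange w (p, z) * q (p, z)).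
  have : measurable_fun setT (fun p : T0 * T0 * T0 => exchange w p * q p).
    by apply: measurable_funM => //; exact: measurable_exchange.
  move/measurableT_comp; apply; exact: pair1_measurable.
have fM z : `|exchange w (p, z) * q (p, z)| <=
    4 * M * (A * ((1 + `|p.1|) * (1 + `|p.2|))).
  by rewrite normrM ler_pM// ?exchange_le// ger0_norm//; exact: (qle (p, z)).
split; first exact: integrable_bounded fM.
have -> : 4 * M * A * Lam * ((1 + `|p.1|) * (1 + `|p.2|)) =
  4 * M * (A * ((1 + `|p.1|) * (1 + `|p.2|))) * Lam by ring.
exact: Rintegral_bound.
Qed.

(** One step of size h with rates cut off to [box n], as in [exchange_step]. *)
Definition euler_rel (h n : R) (nu nu' : {finite_measure set T0 -> \bar R}) :=
  forall w : T0 -> R, measurable_fun setT w -> (forall x, 0 <= w x) ->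
  (\int[nu']_x (w x)%:E +
    \int[triple lam nu]_p ((w p.1.1 + w p.1.2) * (h * (q p * \1_(box n) p.1)))%:E =
  \int[nu]_x (w x)%:E +
    \int[triple lam nu]_p ((w (p.1.2 + p.2) + w (p.1.1 - p.2)) *
      (h * (q p * \1_(box n) p.1)))%:E)%E.

Definition euler_inv (nu : {finite_measure set T0 -> \bar R}) :=
  (\int[nu]_x (1 + `|x|)%:E <= S%:E)%E /\ nu [set x | x <= 0] = 0.

Section cutoff.
Variables (h n : R).
Hypotheses (h0 : 0 <= h) (n0 : 0 <= n).

Let th p := h * (q p * \1_(box n) p.1).

Let th0 p : 0 <= th p. Proof. by rewrite !mulr_ge0. Qed.

Let mth : measurable_fun setT th.
Proof.
apply: measurable_funM => //; apply: measurable_funM => //.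
apply: (@measurableT_comp _ _ _ _ _ _ (\1_(box n) : T0 * T0 -> R)) => //.
by apply: measurable_indic; exact: measurable_box.
Qed.

Let thle p : th p <= h * A * ((1 + `|p.1.1|) * (1 + `|p.1.2|)).
Proof.
rewrite -mulrA ler_wpM2l//; apply: le_trans (qle p).
by rewrite ler_piMr// indicE; case: (_ \in _).
Qed.

Let thb p : th p <= h * A * ((1 + n) * (1 + n)).
Proof.
rewrite /th indicE; have [|] := boolP (p.1 \in box n).
  rewrite inE => /boxP[x1 x2]; rewrite mulr1 -mulrA ler_wpM2l//.
  apply: le_trans (qle p) _; rewrite ler_wpM2l// ler_pM ?addr_ge0//.
  - by rewrite lerD2l.
  - by rewrite lerD2l.
by move=> _; rewrite !mulr0 !mulr_ge0// addr_ge0.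
Qed.

Let th_supp p : th p != 0 -> [/\ 0 < p.2, p.2 < p.1.1 & 0 < p.1.2].
Proof. by rewrite !mulf_eq0 !negb_or => /and3P[_ /q_supp]. Qed.

Lemma euler_step_ex (nu : {finite_measure set T0 -> \bar R}) :
    h * A * ((1 + n) * (1 + n)) * (S * Lam) <= 2^-1 -> euler_inv nu ->
  exists nu', euler_rel h n nu nu'.
Proof.
move=> small [nuS _].
have [|||nu' nu'E] := @exchange_step _ lam nu th (h * A * ((1 + n) * (1 + n))) mth th0.
- by rewrite !mulr_ge0// addr_ge0.
- exact: thb.
- apply: (@le_trans _ _ (h * A * ((1 + n) * (1 + n)) * (S * Lam))%:E); last by rewrite lee_fin.
  rewrite [leRHS]EFinM lee_wpmul2l//.
    by rewrite lee_fin !mulr_ge0// addr_ge0.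
  rewrite EFinM lee_pmul//; last by rewrite /Lam -finite_massE.
  exact: mass_le nuS.
by exists nu'.
Qed.

Lemma euler_inv_step nu nu' : euler_rel h n nu nu' -> euler_inv nu -> euler_inv nu'.
Proof.
move=> st [nuS nupos].
have bd : exists c, forall p, th p <= c by eexists; exact: thb.
split; first exact: (step_mass mth th0 bd th_supp st nuS).
exact: (step_nonpos mth th0 bd th_supp st nupos).
Qed.

Let bd : exists c, forall p, th p <= c.
Proof. by eexists; exact: thb. Qed.

Lemma euler_wgt nu nu' (r a om Z : R) : euler_rel h n nu nu' -> euler_inv nu ->
    0 < r -> (\int[nu]_x (wgt r x)%:E <= a%:E)%E ->
    (\int[lam]_z `|z|%:E <= Z%:E)%E -> (\int[lam]_z (wgt r z)%:E <= om%:E)%E ->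
  (\int[nu']_x (wgt r x)%:E <=
    (a + h * A * (S * (4 * a + 2 / r * S) * Z + S * S * om))%:E)%E.
Proof.
move=> st [nuS _]; have hA : 0 <= h * A by rewrite mulr_ge0.
exact: (step_wgt mth th0 thle bd th_supp hA st nuS).
Qed.

Lemma euler_set nu nu' (B : set T0) (a om : R) : euler_rel h n nu nu' ->
    euler_inv nu -> measurable B -> (nu B <= a%:E)%E ->
    (forall x, lam [set z | B (x + z)%R] <= om%:E)%E ->
    (forall x, lam [set z | B (x - z)%R] <= om%:E)%E ->
  (nu' B <= (a + h * A * (S * S * (2 * om)))%:E)%E.
Proof.
move=> st [nuS _]; have hA : 0 <= h * A by rewrite mulr_ge0.
exact: (step_set mth th0 thle hA st nuS).
Qed.

Lemma euler_weak nu nu' (w : T0 -> R) (M : R) : euler_rel h n nu nu' ->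
    measurable_fun setT w -> (forall x, `|w x| <= M) ->
  \int[nu']_x w x =
  \int[nu]_x w x + h * \int[fprod nu nu]_p (beta w p * \1_(box n) p).
Proof.
move=> st mw wM; rewrite (step_signed mth th0 bd st mw wM); congr (_ + _).
have M0 : 0 <= M := le_trans (normr_ge0 _) (wM 0).
have me := measurable_exchange mw.
have bdd p : `|exchange w p * th p| <= 4 * M * (h * A * ((1 + n) * (1 + n))).
  by rewrite normrM ler_pM ?exchange_le// ger0_norm// thb.
have mF : measurable_fun setT (fun p => exchange w p * th p) by exact: measurable_funM.
have iF := integrable_bounded (triple lam nu) mF bdd.
rewrite [LHS]Rintegral_fprod12//; last first.
  move=> p; apply: (@integrable_bounded _ _ _ lam (fun z => exchange w (p, z) * th (p, z))) => //.
  by apply: (measurableT_comp mF); exact: pair1_measurable.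
have mbox : measurable_fun setT (\1_(box n) : T0 * T0 -> R).
  by apply: measurable_indic; exact: measurable_box.
have ibeta : (fprod nu nu).-integrable setT
    (EFin \o (fun p => beta w p * \1_(box n) p)).
  apply: (@integrable_bounded _ _ _ _ _ (4 * M * A * Lam * ((1 + n) * (1 + n)))).
    by apply: measurable_funM => //; exact: measurable_beta.
  have C0 : 0 <= 4 * M * A * Lam by rewrite !mulr_ge0// fine_ge0.
  move=> p; rewrite indicE; have [|] := boolP (p \in box n).
    rewrite inE => /boxP[x1 x2]; rewrite mulr1.
    apply: le_trans (integrable_exchange p mw wM).2 _; rewrite ler_wpM2l//.
    by rewrite ler_pM ?addr_ge0// lerD2l.
  by move=> _; rewrite mulr0 normr0 mulr_ge0// mulr_ge0 ?addr_ge0.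
rewrite -RintegralZl//; apply: eq_Rintegral => p _ /=.
rewrite /beta mulrA mulrAC -RintegralZl//; last first.
  exact: (integrable_exchange p mw wM).1.
by apply: eq_Rintegral => z _; rewrite /th /exchange/=; ring.
Qed.

End cutoff.
End euler.

Section pair_bound.
Context d (T : measurableType d) (R : realType).

(** A function dominated by a tensor product is integrable for the product
    measure, with the product of the integrals as a bound. *)
Lemma Rintegral_fprod_le (m : {finite_measure set T -> \bar R}) (f : T * T -> R)
    (a b : T -> R) (C sa sb : R) : measurable_fun setT f ->
    measurable_fun setT a -> measurable_fun setT b -> 0 <= C ->
    (forall x, 0 <= a x) -> (forall x, 0 <= b x) ->
    (\int[m]_x (a x)%:E <= sa%:E)%E -> (\int[m]_x (b x)%:E <= sb%:E)%E ->
    (forall p, `|f p| <= C * (a p.1 * b p.2)) ->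
  (fprod m m).-integrable setT (EFin \o f) /\
  `|\int[fprod m m]_p f p| <= C * (sa * sb).
Proof.
move=> mf ma mb C0 a0 b0 asa bsb fle.
have ma' : measurable_fun setT (EFin \o a) by exact/measurable_EFinP.
have mb' : measurable_fun setT (EFin \o b) by exact/measurable_EFinP.
have mab : measurable_fun setT (fun p : T * T => (a p.1)%:E * (b p.2)%:E)%E.
  apply: emeasurable_funM.
    by apply: (measurableT_comp ma'); exact: measurable_fst.
  by apply: (measurableT_comp mb'); exact: measurable_snd.
have ab : (\int[fprod m m]_p `|(f p)%:E| <= (C * (sa * sb))%:E)%E.
  apply: (@le_trans _ _ (\int[fprod m m]_p (C%:E * ((a p.1)%:E * (b p.2)%:E)))%E).
    apply: ge0_le_integral => //.
    - by apply: measurableT_comp => //; exact/measurable_EFinP.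
    - exact: measurable_funeM.
    - by move=> p _; rewrite -!EFinM lee_fin.
  rewrite ge0_integralZl_EFin//; last first.
    by move=> p _; rewrite mule_ge0 ?lee_fin.
  rewrite (integral_fprod_mul m m ma' mb'); last 2 first.
  - by move=> x; rewrite lee_fin.
  - by move=> x; rewrite lee_fin.
  rewrite EFinM lee_wpmul2l// EFinM lee_pmul//.
  - by apply: integral_ge0 => x _; rewrite lee_fin.
  - by apply: integral_ge0 => x _; rewrite lee_fin.
have intf : (fprod m m).-integrable setT (EFin \o f).
  apply/integrableP; split; first exact/measurable_EFinP.
  exact: le_lt_trans ab (ltry _).
split => //; apply: le_trans (le_normr_Rintegral _ intf) _ => //.
rewrite -lee_fin EFin_Rintegral//; exact: integrable_norm.
Qed.

End pair_bound.

Section euler_sequences.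
Variable R : realType.
Notation T0 := (measurableTypeR R).
Variables (lam mu0 : {finite_measure set T0 -> \bar R}).
Variables (q : T0 * T0 * T0 -> R) (A S : R).
Hypotheses (mq : measurable_fun setT q) (q0 : forall p, 0 <= q p).
Hypothesis (qle : forall p, q p <= A * ((1 + `|p.1.1|) * (1 + `|p.1.2|))).
Hypothesis q_supp : forall p, q p != 0 -> [/\ 0 < p.2, p.2 < p.1.1 & 0 < p.1.2].
Hypotheses (A0 : 0 <= A) (S0 : 0 <= S).
Hypothesis mu0S : (\int[mu0]_x (1 + `|x|)%:E <= S%:E)%E.
Hypothesis mu0_pos : mu0 [set x | x <= 0] = 0.

Let Lam := fine (lam setT).
Let Lam0 : 0 <= Lam. Proof. exact: fine_ge0. Qed.

Definition euler_seq (h n : R) (nu : nat -> {finite_measure set T0 -> \bar R}) :=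
  nu 0 = mu0 /\
  forall k, euler_rel lam q h n (nu k) (nu k.+1) /\ euler_inv S (nu k).

(** The step size only has to be small compared with the mass and with the
    maximum of the rates on the box; as the moment does not grow, one size works
    for all steps. *)
Lemma euler_seq_ex (n : nat) : exists (h : R) nu,
  [/\ 0 < h, h <= n.+1%:R^-1 & euler_seq h n%:R nu].
Proof.
pose X := A * ((1 + n%:R) * (1 + n%:R)) * (S * Lam).
have X0 : 0 <= X by rewrite !mulr_ge0// addr_ge0.
have n1 : 0 < n.+1%:R :> R by [].
(* ensures both h <= 1 / (n+1) and h X <= 1 / 2 *)
pose h := (2 * n.+1%:R * (1 + X))^-1.
have h0 : 0 < h by rewrite invr_gt0 !mulr_gt0// ltr_wpDr.
have hX : h * X <= 2^-1.
  rewrite /h mulrC ler_pdivrMr ?mulr_gt0 ?ltr_wpDr//.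
  rewrite -mulrA mulKf// ?pnatr_eq0//.
  have : 1 <= n.+1%:R :> R by rewrite ler1n.
  by nra.
pose P (nu : {finite_measure set T0 -> \bar R}) := euler_inv S nu.
have stepP (s : {nu | P nu}) : {s' : {nu | P nu} | euler_rel lam q h n%:R (sval s) (sval s')}.
  apply: cid; case: s => nu Pnu /=.
  have small : h * A * ((1 + n%:R) * (1 + n%:R)) * (S * Lam) <= 2^-1.
    by apply: le_trans hX; rewrite /X !mulrA.
  have [nu' st] := euler_step_ex mq q0 qle A0 (ltW h0) (ler0n _ n) small Pnu.
  have Pnu' : P nu'.
    exact: (euler_inv_step mq q0 qle q_supp A0 (ltW h0) (ler0n _ n) st Pnu).
  by exists (exist _ nu' Pnu').
have [f [f0 fS]] := dependent_choice stepP (exist P mu0 (conj mu0S mu0_pos)).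
exists h, (fun k => sval (f k)); split => //.
- rewrite lef_pV2 ?posrE ?mulr_gt0 ?ltr_wpDr//; nra.
- split; first by rewrite f0.
  by move=> k; split; [exact: fS|exact: (svalP (f k))].
Qed.

Section one_sequence.
Variables (h n : R) (nu : nat -> {finite_measure set T0 -> \bar R}).
Hypotheses (h0 : 0 < h) (n0 : 0 <= n) (nuE : euler_seq h n nu).

Let h0' : 0 <= h := ltW h0.
Let nurel k : euler_rel lam q h n (nu k) (nu k.+1).
Proof. by case: nuE => _ /(_ k)[]. Qed.
Let nuinv k : euler_inv S (nu k).
Proof. by case: nuE => _ /(_ k)[]. Qed.

(** Discrete Gronwall inequality: one step multiplies the weight by at most
    1 + 4ASZh <= exp(4ASZh) and adds a term of size h. *)
Lemma euler_seq_wgt (r a om Z : R) k :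
    0 < r -> 0 <= a -> 0 <= om -> 0 <= Z ->
    (\int[mu0]_x (wgt r x)%:E <= a%:E)%E ->
    (\int[lam]_z `|z|%:E <= Z%:E)%E -> (\int[lam]_z (wgt r z)%:E <= om%:E)%E ->
  (\int[nu k]_x (wgt r x)%:E <=
    (expR (4 * A * S * Z * (k%:R * h)) *
     (a + k%:R * h * (A * (2 / r * S * S * Z + S * S * om))))%:E)%E.
Proof.
move=> r0 a0 om0 Z0 mua lamZ lamom.
set C1 := 4 * A * S * Z; set C2 := A * _.
have r0' : 0 <= r^-1 by rewrite invr_ge0 ltW.
have C10 : 0 <= C1 by rewrite !mulr_ge0.
have C20 : 0 <= C2 by rewrite /C2 mulr_ge0// addr_ge0// ?mulr_ge0.
elim: k => [|k ih].
  by rewrite !mul0r mulr0 expR0 mul1r addr0; case: nuE => -> _.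
apply: le_trans (euler_wgt mq q0 qle q_supp A0 h0' n0 (nurel k) (nuinv k) r0 ih lamZ lamom) _.
rewrite lee_fin; set ak := expR _ * _.
have -> : ak + h * A * (S * (4 * ak + 2 / r * S) * Z + S * S * om) =
    ak * (1 + C1 * h) + h * C2 by rewrite /C1 /C2; ring.
have -> : C1 * (k.+1%:R * h) = C1 * (k%:R * h) + C1 * h by rewrite -natr1; ring.
rewrite expRD.
have e1 : 1 + C1 * h <= expR (C1 * h) by exact: expR_ge1Dx.
have e0 : 1 <= expR (C1 * (k%:R * h)) by rewrite -expR0 ler_expR !mulr_ge0.
have e2 : 1 <= expR (C1 * h) by rewrite -expR0 ler_expR !mulr_ge0.
rewrite {}/ak; move: (expR (C1 * (k%:R * h))) (expR (C1 * h)) e0 e1 e2 => e f e0 e1 f1.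
rewrite -natr1; set b := a + k%:R * h * C2.
have b0 : 0 <= b by apply: addr_ge0 => //; apply: mulr_ge0 => //; apply: mulr_ge0.
have -> : a + (k%:R + 1) * h * C2 = b + h * C2 by rewrite /b; ring.
have hC2 : 0 <= h * C2 by rewrite mulr_ge0.
rewrite [leRHS]mulrDr lerD//.
  by rewrite mulrAC ler_wpM2r// ler_wpM2l//; exact: le_trans e0.
by rewrite ler_peMl// (le_trans e0)// ler_peMr// (le_trans _ e0).
Qed.

Lemma euler_seq_set (B : set T0) (a om : R) k : measurable B ->
    (mu0 B <= a%:E)%E ->
    (forall x, lam [set z | B (x + z)%R] <= om%:E)%E ->
    (forall x, lam [set z | B (x - z)%R] <= om%:E)%E ->
  (nu k B <= (a + k%:R * h * (A * (S * S * (2 * om))))%:E)%E.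
Proof.
move=> mB muB om1 om2; elim: k => [|k ih].
  by rewrite !mul0r addr0; case: nuE => -> _.
apply: le_trans (euler_set mq q0 qle A0 h0' (nurel k) (nuinv k) mB ih om1 om2) _.
by rewrite lee_fin -natr1 le_eqVlt; apply/orP; left; apply/eqP; ring.
Qed.

Definition rate (w : T0 -> R) k :=
  \int[fprod (nu k) (nu k)]_p (beta lam q w p * \1_(box n) p).

Lemma euler_seq_weak (w : T0 -> R) M k : measurable_fun setT w ->
  (forall x, `|w x| <= M) ->
  \int[nu k.+1]_x w x - \int[nu k]_x w x = h * rate w k.
Proof.
move=> mw wM.
by rewrite (euler_weak mq q0 qle A0 h0' n0 (nurel k) mw wM) addrC addKr.
Qed.

Lemma rate_le (w : T0 -> R) M k : measurable_fun setT w ->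
  (forall x, `|w x| <= M) ->
  `|rate w k| <= 4 * M * A * Lam * (S * S).
Proof.
move=> mw wM.
have mS : measurable_fun setT (fun x : T0 => (1 + `|x|)%R : R).
  by apply: measurable_funD => //; exact: measurableT_comp.
have M0 : 0 <= M := le_trans (normr_ge0 _) (wM 0).
have [nuS _] := nuinv k.
apply: (Rintegral_fprod_le _ mS mS _ _ _ nuS nuS _).2.
- apply: measurable_funM; first exact: measurable_beta.
  by apply: measurable_indic; exact: measurable_box.
- by rewrite !mulr_ge0.
- by move=> x; rewrite addr_ge0.
- by move=> x; rewrite addr_ge0.
- move=> p; apply: le_trans (integrable_exchange lam mq q0 qle p mw wM).2.
  by rewrite normrM ler_piMr// indicE; case: (_ \in _); rewrite ?normr0 ?normr1.
Qed.

End one_sequence.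
End euler_sequences.

(** * Limits of measures along an ultrafilter *)

Section ultralimits.
Variables (R : realType) (U : set_system nat).
Context {UU : UltraFilter U}.

(** A cluster point, given by compactness, is a limit for an ultrafilter. *)
Lemma ultra_cvg_bounded (u : nat -> R) (a b : R) : (forall n, a <= u n <= b) ->
  exists l : R, u n @[n --> U] --> l.
Proof.
move=> uab.
have Uab : (u @ U) `[a, b]%classic.
  have : U (u @^-1` `[a, b]%classic) by apply: filterE => n; rewrite /= in_itv/=.
  by [].
have [l [_ clus]] := @segment_compact R a b _ _ Uab.
exists l => V Vl; have [//|VC] := in_ultra_setVsetC (u @^-1` V) UU.
by have [x [? ?]] := clus (~` V) V VC Vl.
Qed.

Context d (T : measurableType d).
Variable mu : nat -> {finite_measure set T -> \bar R}.

(** The reference measure is existentially quantified: for products it becomes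
    the product of the reference measures. *)
Definition uniformly_integrable := forall e : R, 0 < e ->
  exists (rho : {finite_measure set T -> \bar R}) (dl : R), 0 < dl /\
    forall n B, measurable B -> (rho B < dl%:E)%E -> (mu n B <= e%:E)%E.

Lemma uniformly_integrable_decr (F : (set T)^nat) : uniformly_integrable ->
    (forall k, measurable (F k)) -> {homo F : n m / (n <= m)%N >-> (m <= n)%O} ->
    \bigcap_k F k = set0 ->
  forall e : R, 0 < e -> exists k0, forall k n, (k0 <= k)%N -> (mu n (F k) <= e%:E)%E.
Proof.
move=> ui mF ndF F0 e e0; have [rho [dl [dl0 rhoE]]] := ui e e0.
have : (rho \o F) k @[k --> \oo] --> rho (\bigcap_k F k).
  apply: nonincreasing_cvg_mu => //.
  - by rewrite -ge0_fin_numE// fin_num_measure.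
  - by rewrite F0.
rewrite F0 measure0 => /(@fine_cvgP R nat \oo)[_] /cvgrPdist_lt /(_ _ dl0)[k0 _ k0P].
exists k0 => k n k0k; apply: rhoE => //.
have := k0P k k0k; rewrite /= sub0r normrN ger0_norm ?fine_ge0//.
by rewrite -lte_fin fineK// fin_num_measure.
Qed.

Variable N : R.
Hypothesis muN : forall n, (mu n setT <= N%:E)%E.

(** Setwise convergence, without uniformity in the set. *)
Definition set_cvg (m : {finite_measure set T -> \bar R}) :=
  forall B, measurable B -> fine (mu n B) @[n --> U] --> fine (m B).

Lemma fine_mass_bounds n B : measurable B -> 0 <= fine (mu n B) <= N.
Proof.
move=> mB; rewrite fine_ge0//= -lee_fin fineK ?fin_num_measure//.
by apply: le_trans (muN n); rewrite le_measure// ?inE.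
Qed.

Let lim_val_ex (B : set T) : exists l : R, measurable B -> fine (mu n B) @[n --> U] --> l.
Proof.
have [mB|nB] := pselect (measurable B); last by exists 0.
by have [l lE] := @ultra_cvg_bounded _ 0 N (fun n => fine_mass_bounds n mB); exists l.
Qed.

Let lim_val B := sval (cid (lim_val_ex B)).

Let lim_valP B : measurable B -> fine (mu n B) @[n --> U] --> lim_val B.
Proof. exact: (svalP (cid (lim_val_ex B))). Qed.

Let lim_val_unique B l : measurable B -> fine (mu n B) @[n --> U] --> l -> lim_val B = l.
Proof. by move=> mB; apply: cvg_unique => //; exact: lim_valP. Qed.

Let lim_val_bound B e : measurable B -> (forall n, (mu n B <= e%:E)%E) -> 0 <= lim_val B <= e.
Proof.
move=> mB Be; apply/andP; split.
  by apply: (cvgr_to_ge (lim_valP mB)); apply: filterE => n; exact: fine_ge0.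
apply: (cvgr_to_le (lim_valP mB)); apply: filterE => n.
by rewrite -lee_fin fineK ?fin_num_measure.
Qed.

(** Finite additivity passes to the limit of the values. Countable additivity
    amounts to a limit 0 on the decreasing tails of a disjoint sequence, and
    there [uniformly_integrable_decr] makes the values small uniformly in n. *)
Lemma ultralimit_measure : uniformly_integrable ->
  exists m : {finite_measure set T -> \bar R}, set_cvg m.
Proof.
move=> ui.
pose m B : \bar R := if pselect (measurable B) then (lim_val B)%:E else 0%E.
have mE B : measurable B -> m B = (lim_val B)%:E by rewrite /m; case: pselect.
have lim_valU A B : measurable A -> measurable B -> A `&` B = set0 ->
    lim_val (A `|` B) = lim_val A + lim_val B.
  move=> mA mB AB; apply: lim_val_unique; first exact: measurableU.
  rewrite (_ : (fun n => _) = (fun n => fine (mu n A) + fine (mu n B))).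
    by apply: cvgD; exact: lim_valP.
  by apply/funext => n; rewrite measureU// fineD// fin_num_measure.
have m0 : m set0 = 0%E.
  rewrite mE//; congr EFin; apply: lim_val_unique => //.
  by under eq_fun do rewrite measure0; exact: cvg_cst.
have m_ge0 B : (0 <= m B)%E.
  rewrite /m; case: pselect => // mB; rewrite lee_fin.
  by apply: (cvgr_to_ge (lim_valP mB)); apply: filterE => n; exact: fine_ge0.
have m_sigma : semi_sigma_additive m.
  move=> F mF tF mUF.
  (* tails of the disjoint sequence F; they decrease to the empty set *)
  pose tl k := \bigcup_(i in [set i | (k <= i)%N]) F i.
  have mtl k : measurable (tl k) by apply: bigcup_measurable.
  have tl0 : tl 0%N = \bigcup_n F n by apply: eq_bigcupl; split.
  have tlS k : tl k = F k `|` tl k.+1.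
    apply/seteqP; split=> [x [i/= ki Fix]|x [Fkx|[i/= ki Fix]]].
    - by move: ki; rewrite leq_eqVlt => /orP[/eqP ->|ki]; [left|right; exists i].
    - by exists k => /=.
    - by exists i => //=; exact: ltnW.
  have tlI k : F k `&` tl k.+1 = set0.
    apply/seteqP; split => // x [Fkx [i/= ki Fix]].
    have : k = i by apply: tF => //; exists x.
    by move=> ki'; move: ki; rewrite ki' ltnn.
  have sumE k : (\sum_(0 <= i < k) m (F i) = (lim_val (\bigcup_n F n) - lim_val (tl k))%:E)%E.
    elim: k => [|k ih]; first by rewrite big_geq// tl0 subrr.
    rewrite big_nat_recr//= ih mE// -EFinD; congr EFin.
    by rewrite (tlS k) lim_valU//; ring.
  have ndtl : {homo tl : n m / (n <= m)%N >-> (m <= n)%O}.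
    move=> i j ij; apply/subsetPset => x [l/= jl Flx]; exists l => //=.
    exact: leq_trans jl.
  have captl : \bigcap_k tl k = set0.
    apply/seteqP; split => // x tlx.
    have [i/= _ Fix] := tlx 0%N I.
    have [j/= ij Fjx] := tlx i.+1 I.
    have : i = j by apply: tF => //; exists x.
    by move=> ij'; move: ij; rewrite ij' ltnn.
  rewrite mE//; under eq_fun do rewrite sumE.
  apply: cvg_EFin; first by apply: nearW.
  rewrite /comp/= -[X in _ --> X]subr0; apply: cvgB; first exact: cvg_cst.
  apply/cvgrPdist_le => e e0.
  have [k0 k0P] := uniformly_integrable_decr ui mtl ndtl captl e0.
  exists k0 => // k /= k0k; rewrite sub0r normrN.
  have /andP[l0 le] := lim_val_bound (mtl k) (fun n => k0P k n k0k).
  by rewrite ger0_norm.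
pose m1 : {measure set T -> \bar R} := HB.pack m (isMeasure.Build d T R m m0 m_ge0 m_sigma).
have [|m' m'E] := @finite_measure_ex _ _ _ m1.
  by rewrite /m1/= mE// ltry.
exists m' => B mB.
rewrite [X in fine X](_ : _ = m B); last exact: (congr1 (@^~ B) m'E).
by rewrite mE//; exact: lim_valP.
Qed.

End ultralimits.

Section bounded_convergence.
Variables (R : realType) (U : set_system nat).
Context {UU : ProperFilter U}.
Context d (T : measurableType d).
Variables (mu : nat -> {finite_measure set T -> \bar R}).
Variables (m : {finite_measure set T -> \bar R}) (N : R).
Hypothesis muN : forall n, (mu n setT <= N%:E)%E.
Hypothesis mucvg : set_cvg U mu m.

Lemma Rintegral_indicT (n : {finite_measure set T -> \bar R}) B : measurable B ->
  \int[n]_x \1_B x = fine (n B).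
Proof. by move=> mB; rewrite /Rintegral integral_indicT. Qed.

(** The step function of mesh e below f. *)
Lemma step_approx (f : T -> R) (M e : R) : measurable_fun setT f ->
    (forall x, 0 <= f x <= M) -> 0 < e ->
  exists (k : nat) (B : nat -> set T) (c : nat -> R),
    (forall i, measurable (B i)) /\
    forall x, `|f x - \sum_(i < k) c i * \1_(B i) x| <= e.
Proof.
move=> mf fM e0.
pose B (i : nat) := f @^-1` `[i%:R * e, i.+1%:R * e[%classic.
exists (Num.truncn (M / e)).+1, B, (fun i => i%:R * e); split.
  by move=> i; rewrite -[X in measurable X]setTI; apply: mf => //; exact: measurable_itv.
move=> x; have /andP[f0 fle] := fM x.
have fe0 : 0 <= f x / e by rewrite divr_ge0// ltW.
pose j := Num.truncn (f x / e).
have jk : (j < (Num.truncn (M / e)).+1)%N.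
  by rewrite ltnS; apply: le_truncn; rewrite ler_pM2r// invr_gt0.
have /andP[j1 j2] := truncn_itv fe0.
have Bx i : B i x = (i == j) :> Prop.
  apply/propext; rewrite /B /= in_itv/= -ler_pdivlMr// -ltr_pdivrMr//; split.
    by move=> /truncn_def ij; apply/eqP.
  by move=> /eqP ->; rewrite j1 j2.
rewrite (bigD1 (Ordinal jk))//= big1 ?addr0; last first.
  move=> i ij; rewrite indicE memNset ?mulr0// Bx; apply/negP.
  by apply: contra_neqN ij => /eqP ij; apply/val_inj.
rewrite indicE mem_set ?mulr1; last by rewrite Bx.
have e1 : j%:R * e <= f x by rewrite -ler_pdivlMr.
have e2 : f x < (j%:R + 1) * e by rewrite -ltr_pdivrMr// natr1.
by rewrite ler_norml; apply/andP; split; lra.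
Qed.

Lemma Rintegral_step (n : {finite_measure set T -> \bar R}) k
    (B : nat -> set T) (c : nat -> R) : (forall i, measurable (B i)) ->
  \int[n]_x (\sum_(i < k) c i * \1_(B i) x) = \sum_(i < k) c i * fine (n (B i)).
Proof.
move=> mB.
have ii i : n.-integrable setT (EFin \o (fun x => c i * \1_(B i) x)).
  apply: (@integrable_bounded _ _ _ _ _ `|c i|).
    by apply: measurable_funM => //; exact: measurable_indic.
  by move=> x; rewrite normrM ler_piMr// indicE; case: (_ \in _); rewrite ?normr0 ?normr1.
elim: k => [|k ih].
  by under eq_Rintegral do rewrite big_ord0; rewrite big_ord0 /Rintegral integral0.
under eq_Rintegral do rewrite big_ord_recr/=.
rewrite RintegralD//.
- rewrite ih big_ord_recr/=; congr (_ + _); rewrite RintegralZl//.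
    by rewrite Rintegral_indicT.
  apply: (@integrable_bounded _ _ _ _ _ 1); first exact: measurable_indic.
  by move=> x; rewrite indicE; case: (_ \in _); rewrite ?normr0 ?normr1.
- apply: (@integrable_bounded _ _ _ _ _ (\sum_(i < k) `|c i|)).
    apply: measurable_sum => i; apply: measurable_funM => //; exact: measurable_indic.
  move=> x; apply: le_trans (ler_norm_sum _ _ _) _; apply: ler_sum => i _.
  by rewrite normrM ler_piMr// indicE; case: (_ \in _); rewrite ?normr0 ?normr1.
Qed.

Lemma set_cvg_bound : fine (m setT) <= N.
Proof.
apply: (cvgr_to_le (mucvg measurableT)); apply: filterE => n.
by rewrite -lee_fin fineK ?fin_num_measure.
Qed.

Let bounded_cvg_ge0 (f : T -> R) (M : R) : measurable_fun setT f ->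
    (forall x, 0 <= f x <= M) ->
  \int[mu n]_x f x @[n --> U] --> \int[m]_x f x.
Proof.
move=> mf fM; apply/cvgrPdist_le => e e0.
have N0 : 0 <= N by rewrite (le_trans _ set_cvg_bound)// fine_ge0.
pose e' := e / (3 * (N + 1)).
have e'0 : 0 < e' by rewrite divr_gt0// mulr_gt0// ltr_wpDl.
have [k [B [c [mB fB]]]] := step_approx mf fM e'0.
pose g x := \sum_(i < k) c i * \1_(B i) x.
have mg : measurable_fun setT g.
  by apply: measurable_sum => i; apply: measurable_funM => //; exact: measurable_indic.
have fM' x : `|f x| <= M by have /andP[? ?] := fM x; rewrite ger0_norm.
have fg (n : {finite_measure set T -> \bar R}) : fine (n setT) <= N ->
    `|\int[n]_x f x - \int[n]_x g x| <= e / 3.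
  move=> nN.
  have gM x : `|g x| <= M + e'.
    have := fB x; have := fM' x; rewrite -/(g x) !ler_norml.
    by move=> /andP[? ?] /andP[? ?]; apply/andP; split; lra.
  rewrite -RintegralB//; last 2 first.
  - exact: integrable_bounded fM'.
  - exact: integrable_bounded gM.
  have mfg : measurable_fun setT (fun x => f x - g x) by exact: measurable_funB.
  apply: le_trans (Rintegral_bound n mfg fB) _.
  apply: (@le_trans _ _ (e' * (N + 1))).
    by rewrite ler_wpM2l// ?ltW// (le_lt_trans nN)// ltrDl.
  by rewrite /e' invfM mulrA -[e / 3 * _ * _]mulrA mulVf ?mulr1// gt_eqF// ltr_wpDl.
have gcvg : \int[mu n]_x g x @[n --> U] --> \int[m]_x g x.
  rewrite /g Rintegral_step//; under eq_fun do rewrite Rintegral_step//.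
  have sumcvg l : (fun n => \sum_(i < l) c i * fine (mu n (B i))) @ U -->
      (\sum_(i < l) c i * fine (m (B i)) : R).
    elim: l => [|l ih].
      rewrite big_ord0 [X in X @ _ --> _](_ : _ = cst 0); first exact: cvg_cst.
      by apply/funext => n; rewrite big_ord0.
    rewrite big_ord_recr/= [X in X @ _ --> _](_ : _ = (fun n =>
      \sum_(i < l) c i * fine (mu n (B i)) + c l * fine (mu n (B l)))).
      by apply: cvgD ih _; apply: cvgM; [exact: cvg_cst|exact: mucvg].
    by apply/funext => n; rewrite big_ord_recr.
  exact: sumcvg.
have e3 : 0 < e / 3 by rewrite divr_gt0.
move/cvgrPdist_le : gcvg => /(_ _ e3); apply: filterS => n gn.
have h1 := fg m set_cvg_bound.
have h2 : `|\int[mu n]_x f x - \int[mu n]_x g x| <= e / 3.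
  by apply: fg; rewrite -lee_fin fineK ?fin_num_measure.
move: gn h1 h2; rewrite !ler_norml => /andP[? ?] /andP[? ?] /andP[? ?].
by apply/andP; split; lra.
Qed.

(** Bounded functions are uniform limits of step functions, and the masses are
    bounded. *)
Lemma bounded_cvg (f : T -> R) (M : R) : measurable_fun setT f ->
    (forall x, `|f x| <= M) ->
  \int[mu n]_x f x @[n --> U] --> \int[m]_x f x.
Proof.
move=> mf fM.
have mfM : measurable_fun setT (fun x => f x + M) by exact: measurable_funD.
have fM1 x : 0 <= f x + M <= M + M.
  by have := fM x; rewrite ler_norml => /andP[? ?]; apply/andP; split; lra.
have c1 := bounded_cvg_ge0 mfM fM1.
have c2 : \int[mu n]_x M @[n --> U] --> \int[m]_x M.
  rewrite Rintegral_cst//; under eq_fun do rewrite Rintegral_cst//.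
  by apply: cvgM; [exact: cvg_cst|exact: mucvg].
have sub (n : {finite_measure set T -> \bar R}) :
    \int[n]_x f x = \int[n]_x (f x + M) - \int[n]_x M.
  have i1 := integrable_bounded n mf fM.
  have i2 : n.-integrable setT (EFin \o (fun=> M)).
    by apply: (@integrable_bounded _ _ _ _ _ `|M|).
  by rewrite RintegralD// addrK.
rewrite sub; under eq_fun do rewrite sub.
exact: cvgB.
Qed.

End bounded_convergence.

Section product_convergence.
Variables (R : realType) (U : set_system nat).
Context {UU : UltraFilter U}.
Context d (T : measurableType d).
Variables (mu : nat -> {finite_measure set T -> \bar R}) (N : R).
Hypothesis muN : forall n, (mu n setT <= N%:E)%E.

Lemma fprod_mass n : (fprod (mu n) (mu n) setT <= (N * N)%:E)%E.
Proof. by rewrite -setXTT fprodX// EFinM lee_pmul. Qed.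

(** If B is small for rho x rho, then by Markov's inequality the sections of B
    are small for rho, except over a set X that is itself small for rho. *)
Lemma uniformly_integrable_fprod : uniformly_integrable mu ->
  uniformly_integrable (fun n => fprod (mu n) (mu n)).
Proof.
move=> ui e e0.
have N0 : 0 <= N by rewrite -lee_fin (le_trans _ (muN 0)).
pose e' := e / (2 * (N + 1)).
have e'0 : 0 < e' by rewrite divr_gt0// mulr_gt0// ltr_wpDl.
have [rho [dl [dl0 rhoE]]] := ui e' e'0.
exists (fprod rho rho), (dl * dl); split => [|n B mB rB]; first exact: mulr_gt0.
have mBx x : measurable (xsection B x) by exact: measurable_xsection.
have mrho : measurable_fun setT (fun x => rho (xsection B x)) by exact: measurable_fun_xsection.
have mmu : measurable_fun setT (fun x => mu n (xsection B x)) by exact: measurable_fun_xsection.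
(* the set of x whose section of B is large *)
pose X := [set x | (dl%:E <= rho (xsection B x))%E].
have mX : measurable X.
  rewrite -[X]setTI (_ : X = (fun x => rho (xsection B x)) @^-1` `[dl%:E, +oo[%classic).
    by apply: mrho => //; exact: emeasurable_itv.
  by apply/seteqP; split => x; rewrite /X/= in_itv/= andbT.
have rhoX : (rho X < dl%:E)%E.
  have : (dl%:E * rho X <= fprod rho rho B)%E.
    rewrite -integral_indicT// -ge0_integralZl_EFin//; last 2 first.
    - by apply/measurable_EFinP; exact: measurable_indic.
    - exact: ltW.
    rewrite /fprod /finite_bundle/= /product_measure1.
    apply: ge0_le_integral => //.
    - by move=> x _; rewrite mule_ge0// lee_fin ltW.
    - by apply: measurable_funeM; apply/measurable_EFinP; exact: measurable_indic.
    - move=> x _; rewrite indicE; have [|] := boolP (x \in X).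
        by rewrite inE mule1.
      by rewrite mule0.
  move=> /le_lt_trans /(_ rB); rewrite EFinM lte_pmul2l//.
apply: (@le_trans _ _ (\int[mu n]_x (e' + N * \1_X x)%:E)%E).
  rewrite /fprod /finite_bundle/= /product_measure1.
  apply: ge0_le_integral => //.
  - apply/measurable_EFinP; apply: measurable_funD => //.
    by apply: measurable_funM => //; exact: measurable_indic.
  - move=> x _ /=; rewrite indicE; have [|] := boolP (x \in X).
      move=> _; rewrite mulr1; apply: (@le_trans _ _ N%:E).
        by apply: le_trans (muN n); rewrite le_measure// ?inE.
      by rewrite lee_fin lerDr ltW.
    rewrite notin_setE /X/= => /negP; rewrite -ltNge => xX.
    by rewrite mulr0 addr0; exact: rhoE.
under eq_integral do rewrite EFinD (EFinM N).
rewrite ge0_integralD//; last 3 first.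
- by move=> x _; rewrite lee_fin ltW.
- by move=> x _; rewrite mule_ge0// lee_fin.
- by apply: measurable_funeM; apply/measurable_EFinP; exact: measurable_indic.
rewrite integral_cst// ge0_integralZl_EFin//; last first.
  by apply/measurable_EFinP; exact: measurable_indic.
rewrite integral_indicT//.
apply: (@le_trans _ _ (e' * N + N * e')%:E).
  rewrite EFinD (EFinM e' N) (EFinM N e') leeD// lee_wpmul2l// ?lee_fin ?(ltW e'0)//.
    exact: muN.
  exact: rhoE.
rewrite lee_fin mulrC -mulr2n -mulr_natr /e'.
rewrite mulrA mulrAC ler_pdivrMr ?mulr_gt0 ?ltr_wpDl//.
nra.
Qed.

(** The squares have a limit measure m2 by [ultralimit_measure]; it agrees with
    m x m on rectangles, hence everywhere. *)
Lemma fprod_set_cvg (m : {finite_measure set T -> \bar R}) :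
    uniformly_integrable mu -> set_cvg U mu m ->
  set_cvg U (fun n => fprod (mu n) (mu n)) (fprod m m).
Proof.
move=> ui mucvg.
have [m2 m2E] := ultralimit_measure fprod_mass (uniformly_integrable_fprod ui).
move=> B mB; suff -> : fprod m m B = m2 B by exact: m2E.
apply: product_measure_unique => // A C mA mC.
rewrite -[LHS]fineK ?fin_num_measure//; last exact: measurableX.
have mAC : (m A * m C = (fine (m A) * fine (m C))%:E)%E.
  by rewrite EFinM !fineK// fin_num_measure.
rewrite [RHS]mAC; congr EFin.
apply: (@cvg_unique _ (@norm_hausdorff _ _) (fine (fprod (mu n) (mu n) (A `*` C)) @[n --> U])).
  by apply: m2E; exact: measurableX.
rewrite (_ : (fun n => _) = (fun n => fine (mu n A) * fine (mu n C))).
  by apply: cvgM; exact: mucvg.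
by apply/funext => n; rewrite fprodX// fineM// fin_num_measure.
Qed.

End product_convergence.

(** * Tools for the passage to the limit *)

Section lebesgue_translation.
Variable R : realType.
Notation T0 := (measurableTypeR R).
Notation leb := (@lebesgue_measure R).

Lemma lebesgue_translate (a : R) (B : set T0) : measurable B ->
  leb [set z | B (a + z)] = leb B.
Proof.
move=> mB; have ma : measurable_fun setT (fun z : T0 => (a + z : R) : T0).
  exact: measurable_funD.
pose nu : {measure set T0 -> \bar R} := pushforward leb (fun z : T0 => (a + z : R) : T0).
rewrite [RHS](lebesgue_measure_unique (mu := nu ma))//.
move=> X [[x y] _ <-]; rewrite /nu/= /pushforward.
rewrite (_ : _ @^-1` _ = `]x - a, y - a]%classic); last first.
  by apply/seteqP; split => z; rewrite /= !in_itv/= ltrBlDl lerBrDl.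
rewrite !lebesgue_measure_itv/= !lte_fin ltrD2r.
by case: ifP => // _; rewrite -!EFinB; congr EFin; ring.
Qed.

Lemma lebesgue_reflect (a : R) (B : set T0) : measurable B ->
  leb [set z | B (a - z)] = leb B.
Proof.
move=> mB; have mB' : measurable [set z : T0 | B (a + z)].
  rewrite -[X in measurable X]setTI.
  have : measurable_fun setT (fun z : T0 => (a + z : R) : T0) by exact: measurable_funD.
  by apply.
by rewrite -[RHS](lebesgue_translate a mB) -[RHS](lebesgue_measureN mB').
Qed.

End lebesgue_translation.

Section weight_limits.
Variable R : realType.
Notation T0 := (measurableTypeR R).

(** Dominated convergence, with |x| as dominating function. *)
Lemma wgt_small (m : {finite_measure set T0 -> \bar R}) :
    (\int[m]_x `|x|%:E < +oo)%E -> forall e : R, 0 < e ->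
  exists j0, forall j, (j0 <= j)%N -> (\int[m]_x (wgt j.+1%:R x)%:E <= e%:E)%E.
Proof.
move=> fin e e0.
have mw (j : nat) : measurable_fun setT (fun x : T0 => (wgt j.+1%:R x)%:E).
  by apply/measurable_EFinP; exact: measurable_wgt.
have mabs : measurable_fun setT (fun x : T0 => `|x|%:E : \bar R).
  exact/measurable_EFinP.
have iabs : m.-integrable setT (fun x : T0 => `|x|%:E : \bar R).
  apply/integrableP; split => //.
  by under eq_integral do rewrite gee0_abs//.
have wcvg (x : R) : (wgt j.+1%:R x)%:E @[j --> \oo] --> 0%E.
  apply: cvg_EFin; first by apply: nearW.
  apply: (@squeeze_cvgr _ _ _ _ (fun=> 0) (fun j => x ^+ 2 * j.+1%:R^-1)).
  - by apply: nearW => j; rewrite wgt_ge0//= wgt_le_sqr.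
  - exact: cvg_cst.
  - rewrite -[X in _ --> X](mulr0 (x ^+ 2)); apply: cvgM; first exact: cvg_cst.
    exact: cvg_harmonic.
have f_g : \forall x \ae m, forall j : nat, setT x -> (`|(wgt j.+1%:R x)%:E| <= `|x|%:E)%E.
  by apply: aeW => x j _; rewrite /= lee_fin ger0_norm ?wgt_ge0// wgt_le.
have f_f : \forall x \ae m, setT x -> (wgt j.+1%:R x)%:E @[j --> \oo] --> cst 0%E x.
  by apply: aeW => x _; exact: wcvg.
have [_ _] := dominated_convergence measurableT mw (measurable_cst 0%E) f_f iabs f_g.
rewrite integral0 => /(@fine_cvgP R nat \oo)[[j1 _ j1P] /cvgrPdist_lt /(_ _ e0)[j0 _ j0P]].
exists (maxn j1 j0) => j; rewrite geq_max => /andP[/j1P/= fj /j0P/=].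
rewrite sub0r normrN => /ltW je; rewrite -[leLHS]fineK//= lee_fin.
by apply: le_trans je; rewrite ler_norm.
Qed.

(** Monotone convergence of the truncations. It transfers bounds on integrals of
    unbounded functions, for which only bounded test functions converge. *)
Lemma integral_le_of_trunc d (T : measurableType d) (m : {finite_measure set T -> \bar R})
    (f : T -> R) (c : R) : measurable_fun setT f -> (forall x, 0 <= f x) ->
    (forall j : nat, \int[m]_x Num.min (f x) j%:R <= c) ->
  (\int[m]_x (f x)%:E <= c%:E)%E.
Proof.
move=> mf f0 H.
have mmin (j : nat) : measurable_fun setT (fun x => Num.min (f x) j%:R).
  by apply: measurable_minr.
have cvgj (x : T) : setT x -> (Num.min (f x) j%:R)%:E @[j --> \oo] --> (f x)%:E.
  move=> _; apply: cvg_near_cst.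
  exists (Num.truncn (f x)).+1 => // j /= jf.
  rewrite min_l//; apply: (le_trans (ltW (truncnS_gt (f x)))).
  by rewrite ler_nat.
have minf_ge0 j x : setT x -> (0 <= (Num.min (f x) j%:R)%:E)%E.
  by move=> _; rewrite lee_fin le_min f0/=.
have mono x : setT x -> {homo (fun j => (Num.min (f x) j%:R)%:E) : n m / (n <= m)%N >-> (n <= m)%E}.
  move=> _ i j ij; rewrite lee_fin le_min !ge_min lexx/=.
  by rewrite (_ : i%:R <= j%:R) ?orbT// ler_nat.
have mmin' j : measurable_fun setT (fun x => (Num.min (f x) j%:R)%:E).
  exact/measurable_EFinP.
have := @cvg_monotone_convergence _ _ _ m setT measurableT _ mmin' minf_ge0 mono.
rewrite (_ : (fun x => limn _) = (fun x => (f x)%:E)); last first.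
  by apply/funext => x; apply/cvg_lim => //; exact: cvgj.
move=> /cvg_lim <- //; apply: lime_le.
  by apply: ereal_nondecreasing_is_cvgn => i j ij; apply: ge0_le_integral => // x _;
    [exact: minf_ge0|exact: mono].
apply: nearW => j; rewrite -EFin_Rintegral ?lee_fin//.
apply: (@integrable_bounded _ _ _ _ _ j%:R) => // x.
by rewrite ger0_norm ?le_min ?f0//= ge_min lexx orbT.
Qed.

End weight_limits.

Section tensor_estimates.
Context d (T : measurableType d) (R : realType).

Lemma Rintegral_fprod21 (m1 m2 : {finite_measure set T -> \bar R}) (f : T * T -> R)
    (M : R) : measurable_fun setT f -> (forall p, `|f p| <= M) ->
  \int[fprod m1 m2]_p f p = \int[m2]_y \int[m1]_x f (x, y).
Proof.
move=> mf fM; have intf := integrable_bounded (fprod m1 m2) mf fM.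
rewrite {1}/Rintegral -[X in fine X](integral21_prod_meas1 intf); congr fine.
apply: eq_integral => y _; rewrite /fubini_G EFin_Rintegral//.
apply: (@integrable_bounded _ _ _ _ (fun x => f (x, y)) M) => //.
by apply: (measurableT_comp mf); exact: pair2_measurable.
Qed.

(** The two squares are compared through the mixed product m2 x m1: integrating
    f in one variable gives a bounded function of the other. *)
Lemma Rintegral_fprod_close (m1 m2 : {finite_measure set T -> \bar R}) (f : T * T -> R)
    (M kap S : R) : measurable_fun setT f -> (forall p, `|f p| <= M) -> 0 <= M ->
    fine (m1 setT) <= S -> fine (m2 setT) <= S -> 0 <= kap ->
    (forall (w : T -> R) (c : R), measurable_fun setT w -> (forall x, `|w x| <= c) ->
      `|\int[m1]_x w x - \int[m2]_x w x| <= kap * c) ->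
  `|\int[fprod m1 m1]_p f p - \int[fprod m2 m2]_p f p| <= 2 * kap * M * S.
Proof.
move=> mf fM M0 m1S m2S kap0 close.
have mfx x : measurable_fun setT (fun y => f (x, y)).
  by apply: (measurableT_comp mf); exact: pair1_measurable.
have mfy y : measurable_fun setT (fun x => f (x, y)).
  by apply: (measurableT_comp mf); exact: pair2_measurable.
have ifx (m : {finite_measure set T -> \bar R}) x :
    m.-integrable setT (fun y => (f (x, y))%:E).
  exact: (@integrable_bounded _ _ _ m (fun y => f (x, y)) M).
pose F x := \int[m1]_y f (x, y); pose G y := \int[m2]_x f (x, y).
have mF : measurable_fun setT F by exact: measurable_Rintegral_section.
have mG : measurable_fun setT G.
  apply: (@measurable_Rintegral_section _ _ _ _ _ m2 (fun p => f (p.2, p.1))).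
  apply: (measurableT_comp mf); exact: measurable_fun_pair.
have FM x : `|F x| <= M * S.
  by apply: le_trans (Rintegral_bound m1 (mfx x) (fun y => fM (x, y))) _; rewrite ler_wpM2l.
have GM y : `|G y| <= M * S.
  by apply: le_trans (Rintegral_bound m2 (mfy y) (fun x => fM (x, y))) _; rewrite ler_wpM2l.
have E11 : \int[fprod m1 m1]_p f p = \int[m1]_x F x.
  by apply: Rintegral_fprod12 => //; exact: integrable_bounded fM.
have E21 : \int[fprod m2 m1]_p f p = \int[m2]_x F x.
  by apply: Rintegral_fprod12 => //; exact: integrable_bounded fM.
have E21' : \int[fprod m2 m1]_p f p = \int[m1]_x G x by exact: Rintegral_fprod21 fM.
have E22 : \int[fprod m2 m2]_p f p = \int[m2]_x G x by exact: Rintegral_fprod21 fM.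
have h1 := close F (M * S) mF FM; have h2 := close G (M * S) mG GM.
rewrite E11 E22; rewrite -E21 in h1; rewrite -E21' in h2.
apply: le_trans (ler_distD (\int[fprod m2 m1]_p f p) _ _) _.
apply: le_trans (lerD h1 h2) _.
by rewrite le_eqVlt; apply/orP; left; apply/eqP; ring.
Qed.

End tensor_estimates.

Section tail_estimates.
Variable R : realType.
Notation T0 := (measurableTypeR R).

(** Outside the box one of the coordinates exceeds r in absolute value, and for
    that coordinate 1+|x| <= 2 wgt r x. *)
Lemma Rintegral_fprod_tail (m : {finite_measure set T0 -> \bar R}) (g : T0 * T0 -> R)
    (C S r e : R) : measurable_fun setT g -> 0 <= C -> 1 <= r ->
    (\int[m]_x (1 + `|x|)%:E <= S%:E)%E -> (\int[m]_x (wgt r x)%:E <= e%:E)%E ->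
    (forall p, `|g p| <= C * ((1 + `|p.1|) * (1 + `|p.2|))) ->
    (forall p, box r p -> g p = 0) ->
  (fprod m m).-integrable setT (EFin \o g) /\
  `|\int[fprod m m]_p g p| <= 4 * C * e * S.
Proof.
move=> mg C0 r1 mS mw gC gbox; have r0 : 0 < r by exact: lt_le_trans r1.
have mS1 : measurable_fun setT (fun x : T0 => 1 + `|x| : R).
  by apply: measurable_funD => //; exact: measurableT_comp.
have mwgt := @measurable_wgt R r.
pose X := `[- r, r]%classic : set T0.
have mX : measurable (X `*` setT : set (T0 * T0)).
  by apply: measurableX => //; exact: measurable_itv.
pose g1 p := g p * \1_(X `*` setT) p; pose g2 p := g p * \1_(~` (X `*` setT)) p.
have mg1 : measurable_fun setT g1 by apply: measurable_funM => //; exact: measurable_indic.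
have mg2 : measurable_fun setT g2.
  by apply: measurable_funM => //; apply: measurable_indic; exact: measurableC.
have gE p : g p = g1 p + g2 p.
  by rewrite /g1 /g2 !indicE in_setC; case: (_ \in _); rewrite /= ?(mulr1, mulr0, addr0, add0r).
have S1 (x : T0) : 0 <= 1 + `|x| :> R by rewrite addr_ge0.
have big (x : R) : ~~ (`|x| <= r) -> 1 + `|x| <= 2 * wgt r x.
  by rewrite -ltNge => rx; rewrite wgt_tail// ?ltW//; lra.
have C20 : 0 <= 2 * C by rewrite mulr_ge0.
have nn1 (p : T0 * T0) : 0 <= 2 * C * ((1 + `|p.1|) * wgt r p.2).
  by apply: mulr_ge0 => //; apply: mulr_ge0 => //; exact: wgt_ge0.
have nn2 (p : T0 * T0) : 0 <= 2 * C * (wgt r p.1 * (1 + `|p.2|)).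
  by apply: mulr_ge0 => //; apply: mulr_ge0 => //; exact: wgt_ge0.
have XP (p : T0 * T0) : (p \in X `*` setT) = (`|p.1| <= r).
  apply/idP/idP; first by rewrite inE => -[]; rewrite /X/= in_itv/= ler_norml.
  by rewrite inE /= ler_norml /X/= in_itv/=.
have [i1 b1] : (fprod m m).-integrable setT (EFin \o g1) /\
    `|\int[fprod m m]_p g1 p| <= 2 * C * (S * e).
  apply: (Rintegral_fprod_le mg1 mS1 mwgt) => //.
  - by move=> x; exact: wgt_ge0.
  move=> p; rewrite /g1 indicE XP; have [p1|p1] := boolP (`|p.1| <= r); last first.
    by rewrite mulr0 normr0.
  rewrite mulr1; have [p2|p2] := boolP (`|p.2| <= r).
    by rewrite gbox ?normr0//; apply/boxP.
  apply: le_trans (gC p) _.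
  rewrite [2 * C]mulrC -mulrA ler_wpM2l// mulrCA ler_wpM2l//.
  exact: big.
have [i2 b2] : (fprod m m).-integrable setT (EFin \o g2) /\
    `|\int[fprod m m]_p g2 p| <= 2 * C * (e * S).
  apply: (Rintegral_fprod_le mg2 mwgt mS1) => //.
  - by move=> x; exact: wgt_ge0.
  move=> p; rewrite /g2 indicE in_setC XP; have [p1|p1] := boolP (`|p.1| <= r).
    by rewrite mulr0 normr0.
  rewrite mulr1; apply: le_trans (gC p) _.
  rewrite [2 * C]mulrC -mulrA ler_wpM2l// mulrA ler_wpM2r//.
  exact: big.
have gE' : g = (fun p => g1 p + g2 p) by apply/funext.
split.
  rewrite gE' [X in _.-integrable _ X](_ : _ = (EFin \o g1) \+ (EFin \o g2))%E.
    exact: integrableD.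
  by apply/funext.
rewrite gE' RintegralD//; apply: le_trans (ler_normD _ _) _.
apply: le_trans (lerD b1 b2) _.
by rewrite le_eqVlt; apply/orP; left; apply/eqP; ring.
Qed.

End tail_estimates.

(** D has derivative B from one-sided difference quotients, because B is
    uniformly continuous. Composing with the projection c onto [0, T] extends D and
    B continuously to the line, so that the end points need no special care. *)
Lemma FTC_right_difference (R : realType) (D B : R -> R) (T : R) : 0 < T ->
    (forall e, 0 < e -> exists dl, 0 < dl /\
      forall s t, 0 <= s -> s <= t -> t <= T -> t - s <= dl ->
        `|D t - D s - (t - s) * B s| <= (t - s) * e /\ `|B t - B s| <= e) ->
  (\int[lebesgue_measure]_(s in `[0%R, T]) (B s)%:E = (D T - D 0)%:E)%E.
Proof.
move=> T_0 DB; pose c x : R := Num.max 0 (Num.min x T).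
have c01 x : 0 <= c x <= T by rewrite /c le_max lexx/= ge_max ge_min lexx orbT ltW.
have cid x : 0 <= x -> x <= T -> c x = x.
  by move=> x0 xT; rewrite /c min_l// max_r.
have cP x : (x <= 0 /\ c x = 0) \/ (0 <= x <= T /\ c x = x) \/ (T <= x /\ c x = T).
  have [x0|x0] := leP x 0.
    by left; split => //; rewrite /c max_l// ge_min x0.
  right; have [xT|xT] := leP x T.
    by left; rewrite (ltW x0); split => //; rewrite cid// ltW.
  by right; split; [exact: ltW|rewrite /c min_r ?max_r ?ltW].
have close (x d : R) : 0 < d -> \forall y \near x, `|x - y| <= d.
  by move=> d0; exists d => //= y; rewrite /ball_/=; exact: ltW.
have cle x y : x <= y -> c x <= c y.
  by move=> xy; case: (cP x) => [[]|[[]|[]]]; case: (cP y) => [[]|[[]|[]]]; lra.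
have clip x y : `|c x - c y| <= `|x - y|.
  wlog xy : x y / x <= y => [H|].
    by have [/H//|/ltW/H] := leP x y; rewrite distrC [leRHS]distrC.
  rewrite distrC [leRHS]distrC !ger0_norm ?subr_ge0 ?cle//.
  by case: (cP x) => [[]|[[]|[]]]; case: (cP y) => [[]|[[]|[]]]; lra.
have two e : 0 < e -> exists dl, 0 < dl /\
    forall s t, 0 <= s <= T -> 0 <= t <= T -> `|t - s| <= dl ->
    `|D t - D s - (t - s) * B s| <= `|t - s| * (2 * e) /\ `|B t - B s| <= e.
  move=> e0; have [dl [dl0 dlP]] := DB e e0; exists dl; split => // s t.
  move=> /andP[s0 sT] /andP[t0 tT]; have [st|/ltW ts] := leP s t.
    rewrite ger0_norm ?subr_ge0// => std; have [a b] := dlP s t s0 st tT std.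
    split => //; apply: le_trans a _; rewrite ler_wpM2l ?subr_ge0//.
    by rewrite ler_peMl// ?ler1n// ltW.
  rewrite distrC ger0_norm ?subr_ge0// => tsd; have [a b] := dlP t s t0 ts sT tsd.
  split; last by rewrite distrC.
  have -> : D t - D s - (t - s) * B s =
    - (D s - D t - (s - t) * B t) + (s - t) * (B s - B t) by ring.
  apply: le_trans (ler_normD _ _) _; rewrite normrN normrM.
  rewrite (ger0_norm (_ : 0 <= s - t)) ?subr_ge0//.
  rewrite mulr_natl mulr2n mulrDr lerD// ler_wpM2l// subr_ge0//.
have cB : continuous (B \o c).
  move=> x; apply/cvgrPdist_le => e e0; have [dl [dl0 dlP]] := two e e0.
  near=> y; rewrite distrC; apply: (dlP _ _ (c01 x) (c01 y) _).2.
  apply: le_trans (clip _ _) _; rewrite distrC; near: y.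
  exact: close.
have cD : continuous (D \o c).
  move=> x; apply/cvgrPdist_le => e e0; have [dl [dl0 dlP]] := two 1 ltr01.
  have K0 : 0 < 2 + `|B (c x)| by rewrite ltr_pwDl.
  have m0 : 0 < Num.min dl (e / (2 + `|B (c x)|)) by rewrite lt_min dl0 divr_gt0.
  near=> y; rewrite distrC /=.
  have : `|c y - c x| <= Num.min dl (e / (2 + `|B (c x)|)).
    apply: le_trans (clip _ _) _; rewrite distrC; near: y.
    exact: close.
  rewrite le_min => /andP[y1]; rewrite ler_pdivlMr// => y2.
  have [a _] := dlP _ _ (c01 x) (c01 y) y1; apply: le_trans y2.
  rewrite -[D (c y) - D (c x)](subrK ((c y - c x) * B (c x))).
  apply: le_trans (ler_normD _ _) _; rewrite normrM mulrDr.
  by apply: lerD => //; apply: le_trans a _; rewrite mulr1.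
have dD x : x \in `]0, T[ -> is_derive x 1 (D \o c) (B x).
  rewrite in_itv/= => /andP[x0 xT].
  have lim : k^-1 *: ((D \o c) (k *: 1%R + x) - (D \o c) x) @[k --> 0^'] --> B x.
    apply/cvgrPdist_le => e e0.
    have [|dl [dl0 dlP]] := two (e / 2); first by rewrite divr_gt0.
    have m0 : 0 < Num.min dl (Num.min x (T - x)) by rewrite !lt_min dl0 x0 subr_gt0.
    near=> k.
    have hm : `|k| <= Num.min dl (Num.min x (T - x)).
      rewrite -[k]subr0 distrC; near: k; apply: cvg_within.
      exact: close.
    move: hm; rewrite !le_min => /and3P[h1 h2 h3].
    have hN0 : k != 0 by near: k; exact: nbhs_dnbhs_neq.
    have hx : 0 <= k + x <= T.
      by move: h2 h3; rewrite !ler_norml => /andP[? ?] /andP[? ?]; apply/andP; split; lra.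
    have xx : 0 <= x <= T by rewrite !ltW.
    have E : k + x - x = k by rewrite addrK.
    have [|a _] := dlP x (k + x) xx hx; first by rewrite E.
    have -> : k *: 1 + x = k + x by rewrite /GRing.scale/= mulr1.
    move: (andP hx) (andP xx) => [hx0 hx1] [xx0 xx1].
    rewrite /= (cid (k + x))// (cid x)// /GRing.scale/=.
    have -> : B x - k^-1 * (D (k + x) - D x) = - k^-1 * (D (k + x) - D x - k * B x).
      by field.
    rewrite normrM normrN normfV -ler_pdivlMl ?invr_gt0 ?normr_gt0// invrK.
    have e2 : 2 * (e / 2) = e by field.
    by move: a; rewrite E e2.
  by apply: DeriveDef; [apply/cvg_ex; exists (B x)|exact: cvg_lim].
have cT : c T = T by rewrite cid// ltW.
have c0 : c 0 = 0 by rewrite cid// ltW.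
have := @continuous_FTC2 R (B \o c) (D \o c) 0 T T_0.
rewrite /= cT c0 -EFinB => H.
transitivity (\int[lebesgue_measure]_(s in `[0%R, T]) (B (c s))%:E)%E.
  by apply: eq_integral => s; rewrite inE/= in_itv/= => /andP[s0 sT]; rewrite cid.
apply: H.
- exact: continuous_subspaceT.
- split.
  + by move=> x x0T; have := dD x x0T => -[].
  + exact: (cvg_at_right_filter (cD 0)).
  + exact: (cvg_at_left_filter (cD T)).
- move=> x x0T; have dx := dD x x0T; rewrite derive1E derive_val/=.
  by move: x0T; rewrite in_itv/= => /andP[x0 xT]; rewrite cid ?ltW.
Unshelve. all: by end_near. Qed.

(** * The limit curve of measures *)

Section limit_family.
Variable R : realType.
Notation T0 := (measurableTypeR R).
Notation leb := (@lebesgue_measure R).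

(** Absolute continuity in the epsilon-delta form, which propagates along the
    Euler steps uniformly in the mesh ([euler_abs_cont]). *)
Definition abs_cont (m : {measure set T0 -> \bar R}) := forall e : R, 0 < e ->
  exists dl : R, 0 < dl /\
    forall B, measurable B -> (leb B < dl%:E)%E -> (m B <= e%:E)%E.

Variables (lam mu0 : {finite_measure set T0 -> \bar R}).
Variables (q : T0 * T0 * T0 -> R) (A S Z : R).
Hypotheses (mq : measurable_fun setT q) (q0 : forall p, 0 <= q p).
Hypothesis (qle : forall p, q p <= A * ((1 + `|p.1.1|) * (1 + `|p.1.2|))).
Hypothesis q_supp : forall p, q p != 0 -> [/\ 0 < p.2, p.2 < p.1.1 & 0 < p.1.2].
Hypotheses (A0 : 0 <= A) (S0 : 0 <= S) (Z0 : 0 <= Z).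
Hypothesis mu0S : (\int[mu0]_x (1 + `|x|)%:E <= S%:E)%E.
Hypothesis lamZ : (\int[lam]_z `|z|%:E <= Z%:E)%E.
Hypotheses (ac_mu0 : abs_cont mu0) (ac_lam : abs_cont lam).
Variables (h : nat -> R) (nu : nat -> nat -> {finite_measure set T0 -> \bar R}).
Hypotheses (h0 : forall n, 0 < h n) (hn : forall n, h n <= n.+1%:R^-1).
Hypothesis nuE : forall n, euler_seq lam mu0 q S (h n) n%:R (nu n).

Let Lam := fine (lam setT).
Let Lam0 : 0 <= Lam. Proof. exact: fine_ge0. Qed.

Let Lip := 4 * A * Lam * (S * S).
Let Lip0 : 0 <= Lip. Proof. by rewrite !mulr_ge0. Qed.

Let nuS n k : (\int[nu n k]_x (1 + `|x|)%:E <= S%:E)%E.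
Proof. by have [_ /(_ k)[_ []]] := nuE n. Qed.

Let nu_mass n k : (nu n k setT <= S%:E)%E.
Proof. exact: (mass_le (nuS n k)). Qed.

Let nu_mass_fine n k : fine (nu n k setT) <= S.
Proof. by have := nu_mass n k; rewrite finite_massE lee_fin. Qed.

(** By [euler_seq_wgt] the bound is a multiple K of the largest among the weights
    of mu0 and of lam and 2/r; these are made smaller than eta = e / K by a
    large r. *)
Lemma euler_tail (T e : R) : 0 <= T -> 0 < e -> exists r, 1 <= r /\
  forall n k, k%:R * h n <= T -> (\int[nu n k]_x (wgt r x)%:E <= e%:E)%E.
Proof.
move=> T_0 e0.
have mabs : measurable_fun setT (fun x : T0 => `|x|%:E : \bar R).
  exact/measurable_EFinP.
have mS1 : measurable_fun setT (fun x : T0 => 1 + `|x| : R).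
  by apply: measurable_funD => //; exact: measurableT_comp.
have mu0abs : (\int[mu0]_x `|x|%:E < +oo)%E.
  apply: le_lt_trans (ltry S); apply: le_trans mu0S.
  apply: ge0_le_integral => //; first exact/measurable_EFinP.
  by move=> x _; rewrite lee_fin lerDr.
have lamabs : (\int[lam]_x `|x|%:E < +oo)%E by exact: le_lt_trans lamZ (ltry _).
pose E := expR (4 * A * S * Z * T).
pose K := E * (1 + T * (A * (S * S * Z + S * S))).
have K0 : 0 < K.
  by rewrite mulr_gt0 ?expR_gt0// ltr_wpDr// !(mulr_ge0, addr_ge0).
pose eta := e / K; have eta0 : 0 < eta by rewrite divr_gt0.
have [j1 j1P] := wgt_small mu0abs eta0.
have [j2 j2P] := wgt_small lamabs eta0.
pose j3 := Num.truncn (2 / eta).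
pose j := maxn j1 (maxn j2 j3); pose r : R := j.+1%:R.
have r1 : 1 <= r by rewrite ler1n.
have r0 : 0 < r by [].
have reta : 2 / r <= eta.
  rewrite ler_pdivrMr// mulrC -ler_pdivrMr//; apply/ltW.
  apply: (lt_le_trans (truncnS_gt _)).
  by rewrite ler_nat ltnS /j !leq_max leqnn !orbT.
exists r; split => // n k kT.
have a1 : (\int[mu0]_x (wgt r x)%:E <= eta%:E)%E by apply: j1P; rewrite leq_max leqnn.
have a2 : (\int[lam]_x (wgt r x)%:E <= eta%:E)%E.
  by apply: j2P; rewrite !leq_max leqnn orbT.
apply: le_trans (euler_seq_wgt mq q0 qle q_supp A0 S0 (h0 n) (ler0n _ n) (nuE n)
  k r0 (ltW eta0) (ltW eta0) Z0 a1 lamZ a2) _.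
rewrite lee_fin.
have kh0 : 0 <= k%:R * h n by rewrite mulr_ge0// ltW.
have -> : e = K * eta by rewrite /eta mulrC divfK// gt_eqF.
have -> : K * eta = E * (eta + T * (A * (eta * (S * S * Z) + S * S * eta))).
  by rewrite /K; ring.
have r20 : 0 <= 2 / r by rewrite divr_ge0.
have SSZ : 0 <= S * S * Z by rewrite !mulr_ge0.
have SSe : 0 <= S * S * eta by apply: mulr_ge0; [exact: mulr_ge0|exact: ltW].
have -> : 2 / r * S * S * Z = 2 / r * (S * S * Z) by ring.
have X0 : 0 <= A * (2 / r * (S * S * Z) + S * S * eta).
  by apply: mulr_ge0 => //; apply: addr_ge0 => //; exact: mulr_ge0.
apply: ler_pM; rewrite ?expR_ge0//.
- by apply: addr_ge0; [exact: ltW|exact: mulr_ge0].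
- by rewrite ler_expR ler_wpM2l// !mulr_ge0.
rewrite lerD2l; apply: ler_pM => //.
by rewrite ler_wpM2l// lerD2r ler_wpM2r.
Qed.

(** Translates and reflections of B have the Lebesgue measure of B. *)
Lemma euler_abs_cont (T e : R) : 0 <= T -> 0 < e -> exists dl, 0 < dl /\
  forall n k B, measurable B -> k%:R * h n <= T -> (leb B < dl%:E)%E ->
    (nu n k B <= e%:E)%E.
Proof.
move=> T_0 e0; pose K := 1 + T * (A * (S * S * 2)).
have K0 : 0 < K by rewrite ltr_wpDr// !mulr_ge0.
pose eta := e / K; have eta0 : 0 < eta by rewrite divr_gt0.
have [d1 [d10 d1P]] := ac_mu0 eta0; have [d2 [d20 d2P]] := ac_lam eta0.
(* both the initial measure and the translates of lam are below eta on B *)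
exists (Num.min d1 d2); rewrite lt_min d10 d20; split => // n k B mB kT.
rewrite EFin_min lt_min => /andP[B1 B2].
have o1 x : (lam [set z | B (x + z)%R] <= eta%:E)%E.
  apply: d2P; last by rewrite lebesgue_translate.
  rewrite -[X in measurable X]setTI.
  have : measurable_fun setT (fun z : T0 => (x + z)%R : T0) by exact: measurable_funD.
  by apply.
have o2 x : (lam [set z | B (x - z)%R] <= eta%:E)%E.
  apply: d2P; last by rewrite lebesgue_reflect.
  rewrite -[X in measurable X]setTI.
  have : measurable_fun setT (fun z : T0 => (x - z)%R : T0) by exact: measurable_funB.
  by apply.
apply: le_trans (euler_seq_set mq q0 qle A0 (h0 n) (nuE n) k mB (d1P _ mB B1) o1 o2) _.
rewrite lee_fin.
have -> : e = K * eta by rewrite /eta mulrC divfK// gt_eqF.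
have -> : K * eta = eta + T * (A * (S * S * 2)) * eta by rewrite /K; ring.
rewrite lerD2l.
have -> : k%:R * h n * (A * (S * S * (2 * eta))) =
  k%:R * h n * (A * (S * S * 2) * eta) by ring.
rewrite mulrA ler_wpM2r ?(ltW eta0)// ler_wpM2r//.
by rewrite !mulr_ge0.
Qed.

Lemma euler_lip (w : T0 -> R) (M : R) n k j : measurable_fun setT w ->
    (forall x, `|w x| <= M) ->
  `|\int[nu n (k + j)]_x w x - \int[nu n k]_x w x| <= j%:R * h n * (M * Lip).
Proof.
move=> mw wM; have M0 : 0 <= M := le_trans (normr_ge0 _) (wM 0).
elim: j => [|j ih]; first by rewrite addn0 subrr normr0 !mul0r.
apply: le_trans (ler_distD (\int[nu n (k + j)]_x w x) _ _) _.
rewrite -natr1 mulrDl mul1r mulrDl addrC lerD// addnS.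
rewrite (euler_seq_weak mq q0 qle A0 (h0 n) (ler0n _ n) (nuE n) _ mw wM).
rewrite normrM gtr0_norm// ler_wpM2l ?(ltW (h0 n))//.
apply: le_trans (rate_le mq q0 qle A0 (nuE n) _ mw wM) _.
by rewrite le_eqVlt; apply/orP; left; apply/eqP; rewrite /Lip -/Lam; ring.
Qed.

(** Number of steps of size h n performed up to time t; the approximations are
    extended to all times as step functions. *)
Definition stepno n (t : R) := Num.truncn (t / h n).

Lemma stepno_le n t : (stepno n t)%:R * h n <= `|t|.
Proof.
have [t0|t0] := leP 0 t.
  rewrite ger0_norm// -ler_pdivlMr//.
  have th0 : 0 <= t / h n by rewrite divr_ge0// ltW.
  by have /andP[] := truncn_itv th0.
rewrite /stepno (_ : Num.truncn _ = 0%N) ?mul0r//.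
apply/truncn0Pn; rewrite -ltNge; apply: (@lt_trans _ _ 0) => //.
by rewrite pmulr_llt0// invr_gt0.
Qed.

Lemma stepno_mono n s t : s <= t -> (stepno n s <= stepno n t)%N.
Proof. by move=> st; apply: le_truncn; rewrite ler_pM2r// invr_gt0. Qed.

Lemma stepno_close n s t : 0 <= s -> s <= t ->
  `|(stepno n t - stepno n s)%N%:R * h n - (t - s)| <= h n.
Proof.
move=> s0 st; rewrite natrB ?stepno_mono//.
have t0 : 0 <= t := le_trans s0 st.
have bnd (x : R) : 0 <= x ->
    (stepno n x)%:R * h n <= x /\ x < (stepno n x)%:R * h n + h n.
  move=> x0; have xh : 0 <= x / h n by rewrite divr_ge0// ltW.
  have /andP[a b] := truncn_itv xh; split; first by rewrite -ler_pdivlMr.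
  by rewrite -[X in _ + X]mul1r -mulrDl natr1 -ltr_pdivrMr.
have [a1 a2] := bnd s s0; have [b1 b2] := bnd t t0.
by rewrite mulrBl ler_norml; apply/andP; split; lra.
Qed.

Definition euler_at n t := nu n (stepno n t).

Lemma euler_at_neg n t : t <= 0 -> euler_at n t = mu0.
Proof.
move=> t0; rewrite /euler_at /stepno (_ : Num.truncn _ = 0%N); first by case: (nuE n).
apply/truncn0Pn; rewrite -ltNge; apply: (@le_lt_trans _ _ 0) => //.
by rewrite pmulr_lle0// invr_gt0.
Qed.

(** The reference measure is the Lebesgue measure restricted to [-r, r]; the
    complement is handled by the moment and Markov's inequality. *)
Lemma euler_at_uniformly_integrable t : uniformly_integrable (fun n => euler_at n t).
Proof.
move=> e e0.
pose r := 2 * (S + 1) / e.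
have r0 : 0 < r by rewrite divr_gt0// mulr_gt0// ltr_wpDl.
pose D := `[- r, r]%classic : set T0.
have mD : measurable D by exact: measurable_itv.
have Dfin : (leb D < +oo)%E.
  by rewrite lebesgue_measure_itv/=; case: ifP => // _; rewrite -EFinB ltry.
have [dl [dl0 dlP]] := @euler_abs_cont `|t| (e / 2) (normr_ge0 t) (divr_gt0 e0 (ltr0n _ 2)).
exists (mfrestr mD Dfin), dl; split => // n B mB rB.
have mBD : measurable (B `&` D) by exact: measurableI.
have h1 : (euler_at n t (B `&` D) <= (e / 2)%:E)%E.
  by apply: dlP => //; exact: stepno_le.
have h2 : (euler_at n t (~` D) <= (e / 2)%:E)%E.
  have mDc : measurable (~` D) by exact: measurableC.
  have : (r%:E * euler_at n t (~` D) <= S%:E)%E.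
    apply: le_trans (nuS n (stepno n t)).
    rewrite -integral_indicT// -ge0_integralZl_EFin//; last 2 first.
    - by apply/measurable_EFinP; exact: measurable_indic.
    - exact: ltW.
    apply: ge0_le_integral => //.
    - by move=> x _; rewrite mule_ge0// lee_fin ltW.
    - by apply: measurable_funeM; apply/measurable_EFinP; exact: measurable_indic.
    - by apply/measurable_EFinP; apply: measurable_funD => //; exact: measurableT_comp.
    - move=> x _; rewrite -EFinM lee_fin indicE in_setC.
      have [xD|xD] := boolP (x \in D); first by rewrite mulr0 addr_ge0.
      rewrite mulr1; move: xD; rewrite notin_setE /D/= in_itv/= => /negP.
      by rewrite -ler_norml -ltNge => /ltW rx; lra.
  have -> : euler_at n t (~` D) = (fine (euler_at n t (~` D)))%:E by rewrite fineK ?fin_num_measure.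
  rewrite -EFinM !lee_fin; set y := fine _ => rS.
  have : y <= S / r by rewrite ler_pdivlMr// mulrC.
  move=> /le_trans; apply; rewrite ler_pdivrMr// /r.
  have -> : e / 2 * (2 * (S + 1) / e) = S + 1.
    by field; rewrite gt_eqF.
  by rewrite lerDl.
have : (euler_at n t B <= euler_at n t (B `&` D) + euler_at n t (~` D))%E.
  have mDc : measurable (~` D) by exact: measurableC.
  rewrite [leLHS](measureDI (euler_at n t) mB mD) addeC; apply: leeD2l.
  by rewrite le_measure ?inE//; first exact: measurableD; move=> x [].
move=> /le_trans; apply.
by rewrite (splitr e) EFinD leeD.
Qed.

Lemma euler_at_close n s t (w : T0 -> R) (M : R) : 0 <= s -> s <= t ->
    measurable_fun setT w -> (forall x, `|w x| <= M) ->
  `|\int[euler_at n t]_x w x - \int[euler_at n s]_x w x| <= (t - s + h n) * (M * Lip).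
Proof.
move=> s0 st mw wM; have M0 : 0 <= M := le_trans (normr_ge0 _) (wM 0).
rewrite /euler_at -(subnKC (stepno_mono n st)).
apply: le_trans (euler_lip _ _ _ mw wM) _; rewrite ler_wpM2r ?mulr_ge0//.
have := stepno_close n s0 st; rewrite ler_norml => /andP[_]; lra.
Qed.

Variable U : set_system nat.
Context {UU : UltraFilter U}.
Hypothesis Uoo : \oo `<=` U.

Let UP : ProperFilter U := ultra_proper.

(** The ultrafilter gives a limit for all times at once, without extraction of a
    subsequence. *)
Lemma limit_ex : {m : R -> {finite_measure set T0 -> \bar R} |
  forall t, set_cvg U (fun n => euler_at n t) (m t)}.
Proof.
have H t : exists m : {finite_measure set T0 -> \bar R}, set_cvg U (fun n => euler_at n t) m.
  exact: (ultralimit_measure (fun n => nu_mass n (stepno n t)) (euler_at_uniformly_integrable t)).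
by have [m mP] := choice H; exists m.
Qed.

Definition limit_at := sval limit_ex.

Lemma limit_cvg t : set_cvg U (fun n => euler_at n t) (limit_at t).
Proof. exact: (svalP limit_ex). Qed.

Lemma limit_bounded_cvg t (w : T0 -> R) (M : R) : measurable_fun setT w ->
    (forall x, `|w x| <= M) ->
  \int[euler_at n t]_x w x @[n --> U] --> \int[limit_at t]_x w x.
Proof. exact: (bounded_cvg (fun n => nu_mass n (stepno n t)) (@limit_cvg t)). Qed.

Lemma limit_fprod_cvg t (f : T0 * T0 -> R) (M : R) : measurable_fun setT f ->
    (forall p, `|f p| <= M) ->
  \int[fprod (euler_at n t) (euler_at n t)]_p f p @[n --> U] -->
  \int[fprod (limit_at t) (limit_at t)]_p f p.
Proof.
apply: bounded_cvg; first exact: (fprod_mass (fun n => nu_mass n (stepno n t))).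
exact: fprod_set_cvg (fun n => nu_mass n (stepno n t)) _ (euler_at_uniformly_integrable t) (@limit_cvg t).
Qed.

Lemma h_cvg0 : h n @[n --> U] --> 0.
Proof.
apply: (@squeeze_cvgr _ _ _ _ (fun=> 0) (fun n => n.+1%:R^-1)).
- by apply: filterE => n; rewrite (ltW (h0 n))/=.
- exact: cvg_cst.
- by move=> V V0; apply: Uoo; exact: (@cvg_harmonic R) V V0.
Qed.

Lemma limit_integral_le (f : T0 -> R) c t : measurable_fun setT f -> (forall x, 0 <= f x) ->
    (forall n, \int[euler_at n t]_x (f x)%:E <= c%:E)%E ->
  (\int[limit_at t]_x (f x)%:E <= c%:E)%E.
Proof.
move=> mf f0 fc; apply: integral_le_of_trunc => // j.
have mmin : measurable_fun setT (fun x => Num.min (f x) j%:R) by apply: measurable_minr.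
have bmin x : `|Num.min (f x) j%:R| <= j%:R.
  by rewrite ger0_norm ?le_min ?f0//= ge_min lexx orbT.
apply: (cvgr_to_le (limit_bounded_cvg (t := t) mmin bmin)); apply: filterE => n.
rewrite -lee_fin EFin_Rintegral; last exact: integrable_bounded bmin.
apply: le_trans (fc n); apply: ge0_le_integral => //.
- by move=> x _; rewrite lee_fin le_min f0/=.
- exact/measurable_EFinP.
- exact/measurable_EFinP.
- by move=> x _; rewrite lee_fin ge_min lexx.
Qed.

Lemma limit_moment t : (\int[limit_at t]_x (1 + `|x|)%:E <= S%:E)%E.
Proof.
apply: limit_integral_le => //.
- by apply: measurable_funD => //; exact: measurableT_comp.
- by move=> n; exact: nuS.
Qed.

Lemma limit_mass t : fine (limit_at t setT) <= S.
Proof. by have := mass_le (limit_moment t); rewrite finite_massE lee_fin. Qed.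

Lemma limit_set_le t B e : measurable B -> (forall n, euler_at n t B <= e%:E)%E ->
  (limit_at t B <= e%:E)%E.
Proof.
move=> mB Be; have -> : limit_at t B = (fine (limit_at t B))%:E by rewrite fineK ?fin_num_measure.
rewrite lee_fin; have c : fine (euler_at n t B) @[n --> U] --> fine (limit_at t B) by exact: limit_cvg.
apply: (cvgr_to_le c); apply: filterE => n.
by rewrite -lee_fin fineK ?fin_num_measure.
Qed.

Lemma limit_nonpos t : limit_at t [set x | x <= 0] = 0%E.
Proof.
apply/eqP; rewrite eq_le measure_ge0 andbT; apply: limit_set_le.
  by rewrite -[X in measurable X]set_itvE; exact: measurable_itv.
by move=> n; have [_ /(_ (stepno n t))[_ [_]]] := nuE n; rewrite /euler_at => ->.
Qed.

Lemma limit_dominates t : limit_at t `<< leb.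
Proof.
apply/null_content_dominatesP => B mB B0; apply/eqP; rewrite eq_le measure_ge0 andbT.
apply/lee_addgt0Pr => e e0; rewrite add0e; apply: limit_set_le => // n.
have [dl [dl0 dlP]] := euler_abs_cont (normr_ge0 t) e0.
by apply: dlP => //; [exact: stepno_le|rewrite [ltLHS]B0 lte_fin].
Qed.

Lemma limit_at0 B : measurable B -> limit_at 0 B = mu0 B.
Proof.
move=> mB; rewrite -[LHS]fineK ?fin_num_measure// -[RHS]fineK ?fin_num_measure//.
congr EFin; apply: (@cvg_unique _ (@norm_hausdorff _ _) (fine (euler_at n 0 B) @[n --> U])).
  exact: limit_cvg.
rewrite (_ : (fun n => _) = (fun=> fine (mu0 B))); first exact: cvg_cst.
by apply/funext => n; rewrite euler_at_neg.
Qed.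

Lemma limit_tail (T e : R) : 0 <= T -> 0 < e -> exists r, 1 <= r /\
  (forall n k, k%:R * h n <= T -> (\int[nu n k]_x (wgt r x)%:E <= e%:E)%E) /\
  forall t, `|t| <= T -> (\int[limit_at t]_x (wgt r x)%:E <= e%:E)%E.
Proof.
move=> T_0 e0; have [r [r1 rP]] := euler_tail T_0 e0; exists r; split => //; split => //.
move=> t tT; apply: limit_integral_le; first exact: measurable_wgt.
- by move=> x; rewrite wgt_ge0// (lt_le_trans ltr01).
- by move=> n; apply: rP; exact: le_trans (stepno_le n t) tT.
Qed.

Lemma limit_lip s t (w : T0 -> R) (M : R) : 0 <= s -> s <= t ->
    measurable_fun setT w -> (forall x, `|w x| <= M) ->
  `|\int[limit_at t]_x w x - \int[limit_at s]_x w x| <= (t - s) * (M * Lip).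
Proof.
move=> s0 st mw wM; rewrite -subr_ge0.
have c1 : `|\int[euler_at n t]_x w x - \int[euler_at n s]_x w x| @[n --> U] -->
    `|\int[limit_at t]_x w x - \int[limit_at s]_x w x|.
  by apply: cvg_norm; apply: cvgB; exact: limit_bounded_cvg wM.
have c2 : (t - s + h n) * (M * Lip) @[n --> U] --> (t - s + 0) * (M * Lip).
  apply: cvgM; last exact: cvg_cst.
  by apply: cvgD; [exact: cvg_cst|exact: h_cvg0].
rewrite addr0 in c2; apply: (cvgr_to_ge (cvgB c2 c1)); apply: filterE => n.
by rewrite subr_ge0; exact: euler_at_close.
Qed.
Section one_test_function.
Variables (w : T0 -> R) (M : R).
Hypotheses (mw : measurable_fun setT w) (wM : forall x, `|w x| <= M).

Let M0 : 0 <= M. Proof. exact: le_trans (normr_ge0 _) (wM 0). Qed.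
Let Cb := 4 * M * A * Lam.
Let Cb0 : 0 <= Cb. Proof. by rewrite !mulr_ge0. Qed.
Let mbeta : measurable_fun setT (beta lam q w). Proof. exact: measurable_beta. Qed.
Let betaC p : `|beta lam q w p| <= Cb * ((1 + `|p.1|) * (1 + `|p.2|)).
Proof. exact: (integrable_exchange lam mq q0 qle p mw wM).2. Qed.

Let beta_box r p := beta lam q w p * \1_(box r) p.

Let mbeta_box r : measurable_fun setT (beta_box r).
Proof.
by apply: measurable_funM => //; apply: measurable_indic; exact: measurable_box.
Qed.

Let beta_box_le r p : 0 <= r -> `|beta_box r p| <= Cb * ((1 + r) * (1 + r)).
Proof.
move=> r0; rewrite /beta_box indicE; have [|] := boolP (p \in box r).
  rewrite inE => /boxP[x1 x2]; rewrite mulr1.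
  apply: le_trans (betaC p) _; rewrite ler_wpM2l//.
  by rewrite ler_pM ?addr_ge0// lerD2l.
by move=> _; rewrite mulr0 normr0 mulr_ge0// mulr_ge0 ?addr_ge0.
Qed.

(** Covers c = 1 as well as the cutoff c = 1_(box n) with r <= n; both differ from
    1_(box r) only outside of the box. *)
Lemma beta_box_diff (m : {finite_measure set T0 -> \bar R}) (c : T0 * T0 -> R)
    (r e : R) : 1 <= r -> (\int[m]_x (1 + `|x|)%:E <= S%:E)%E ->
    (\int[m]_x (wgt r x)%:E <= e%:E)%E -> measurable_fun setT c ->
    (forall p, 0 <= c p <= 1) -> (forall p, box r p -> c p = 1) ->
  `|\int[fprod m m]_p (beta lam q w p * c p) - \int[fprod m m]_p beta_box r p|
    <= 4 * Cb * e * S.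
Proof.
move=> r1 mS mr mc c01 c1; have r0 : 0 <= r := le_trans ler01 r1.
pose g p := beta lam q w p * (c p - \1_(box r) p).
have mg : measurable_fun setT g.
  apply: measurable_funM => //; apply: measurable_funB => //.
  by apply: measurable_indic; exact: measurable_box.
have gC p : `|g p| <= Cb * ((1 + `|p.1|) * (1 + `|p.2|)).
  rewrite normrM; apply: le_trans (betaC p); rewrite ler_piMr// indicE.
  have /andP[a b] := c01 p.
  have [|_] := boolP (p \in box r); first by rewrite inE => /c1 ->; rewrite subrr normr0.
  by rewrite subr0 ger0_norm.
have gb p : box r p -> g p = 0.
  by move=> bp; rewrite /g (c1 _ bp) indicE mem_set// subrr mulr0.
have [ig gle] := Rintegral_fprod_tail mg Cb0 r1 mS mr gC gb.
have ib : (fprod m m).-integrable setT (EFin \o beta_box r).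
  by apply: (integrable_bounded _ (mbeta_box r) (fun p => beta_box_le p r0)).
have -> : \int[fprod m m]_p (beta lam q w p * c p) =
    \int[fprod m m]_p (g p + beta_box r p).
  by apply: eq_Rintegral => p _; rewrite /g /beta_box -mulrDr subrK.
by rewrite RintegralD// addrK.
Qed.

Let Mb r := Cb * ((1 + r) * (1 + r)).
Let Mb0 r : 0 <= r -> 0 <= Mb r.
Proof. by move=> r0; rewrite mulr_ge0// mulr_ge0// addr_ge0. Qed.

(** Over j steps, the increment of int w is j h times the flux at the initial
    time, up to the error of the cutoff and up to the variation of the flux,
    which is at most linear in the elapsed time by [Rintegral_fprod_close]. *)
Lemma euler_flux (T e r : R) n k j : 1 <= r -> r <= n%:R ->
    (forall k, k%:R * h n <= T -> (\int[nu n k]_x (wgt r x)%:E <= e%:E)%E) ->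
    (k + j)%:R * h n <= T ->
  `|\int[nu n (k + j)]_x w x - \int[nu n k]_x w x
    - j%:R * h n * \int[fprod (nu n k) (nu n k)]_p beta_box r p| <=
  j%:R * h n * (4 * Cb * e * S + 2 * (j%:R * h n * Lip) * Mb r * S).
Proof.
move=> r1 rn tail kjT; have r0 : 0 <= r := le_trans ler01 r1.
have hn0 : 0 <= h n := ltW (h0 n).
set F := \int[_]_p beta_box r p; set X := 4 * Cb * e * S + _.
suff H i : (i <= j)%N ->
    `|\int[nu n (k + i)]_x w x - \int[nu n k]_x w x - i%:R * h n * F| <= i%:R * h n * X.
  exact: H.
elim: i => [|i ih] ij; first by rewrite addn0 subrr !mul0r subrr normr0.
have kiT : (k + i)%:R * h n <= T.
  by apply: le_trans kjT; rewrite ler_wpM2r// ler_nat leq_add2l ltnW.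
rewrite addnS.
have := euler_seq_weak mq q0 qle A0 (h0 n) (ler0n _ n) (nuE n) (k + i) mw wM.
set G := rate _ _ _ _ _ _ => /eqP; rewrite subr_eq addrC => /eqP ->.
have -> : \int[nu n (k + i)]_x w x + h n * G - \int[nu n k]_x w x - i.+1%:R * h n * F
  = (\int[nu n (k + i)]_x w x - \int[nu n k]_x w x - i%:R * h n * F) + h n * (G - F).
  by rewrite -natr1; ring.
apply: le_trans (ler_normD _ _) _.
have -> : i.+1%:R * h n * X = i%:R * h n * X + h n * X by rewrite -natr1; ring.
apply: lerD; first exact: ih (ltnW ij).
rewrite normrM (ger0_norm hn0) ler_wpM2l//.
set F' := \int[fprod (nu n (k + i)) (nu n (k + i))]_p beta_box r p.
have b1 : `|G - F'| <= 4 * Cb * e * S.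
  apply: beta_box_diff => //; first exact: tail.
  - by apply: measurable_indic; exact: measurable_box.
  - by move=> p; rewrite indicE; case: (_ \in _); rewrite /= ?lexx ?ler01.
  - move=> p /boxP[p1 p2]; rewrite indicE mem_set//.
    by apply/boxP; split; exact: le_trans rn.
have b2 : `|F' - F| <= 2 * (i%:R * h n * Lip) * Mb r * S.
  apply: (Rintegral_fprod_close (mbeta_box r) (fun p => beta_box_le p r0)) => //.
  - exact: Mb0.
  - by rewrite !mulr_ge0.
  - move=> v c mv vc; apply: le_trans (euler_lip _ _ _ mv vc) _.
    by rewrite [c * _]mulrC mulrA.
apply: le_trans (ler_distD F' _ _) _; apply: lerD => //.
apply: le_trans b2 _; rewrite !ler_wpM2r ?Mb0//.
rewrite ler_wpM2l// ler_wpM2r// ler_wpM2r// ler_nat ltnW//.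
Qed.

(** Right-hand side of the weak equation at time t. *)
Definition flux t := \int[fprod (limit_at t) (limit_at t)]_p beta lam q w p.

Lemma limit_flux_box (T e r s t : R) : 0 <= T -> 1 <= r ->
    (forall n k, k%:R * h n <= T -> (\int[nu n k]_x (wgt r x)%:E <= e%:E)%E) ->
    0 <= s -> s <= t -> t <= T ->
  `|\int[limit_at t]_x w x - \int[limit_at s]_x w x
    - (t - s) * \int[fprod (limit_at s) (limit_at s)]_p beta_box r p| <=
  (t - s) * (4 * Cb * e * S + 2 * ((t - s) * Lip) * Mb r * S).
Proof.
move=> T_0 r1 tail s0 st tT; have r0 : 0 <= r := le_trans ler01 r1.
pose j n := (stepno n t - stepno n s)%N.
have cj : (j n)%:R * h n @[n --> U] --> t - s.
  apply/cvgrPdist_le => d d0.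
  have hd : \forall n \near U, h n <= d.
    have /cvgrPdist_le/(_ _ d0) := h_cvg0.
    by apply: filterS => n; rewrite sub0r normrN gtr0_norm.
  apply: filterS hd => n hd; rewrite distrC; apply: le_trans hd.
  exact: stepno_close.
have c1 : `|\int[euler_at n t]_x w x - \int[euler_at n s]_x w x
    - (j n)%:R * h n * \int[fprod (euler_at n s) (euler_at n s)]_p beta_box r p| @[n --> U] -->
  `|\int[limit_at t]_x w x - \int[limit_at s]_x w x
    - (t - s) * \int[fprod (limit_at s) (limit_at s)]_p beta_box r p|.
  apply: cvg_norm; apply: cvgB.
    by apply: cvgB; exact: limit_bounded_cvg wM.
  apply: cvgM => //.
  exact: (limit_fprod_cvg (mbeta_box r) (fun p => beta_box_le p r0)).
have c2 : (j n)%:R * h n * (4 * Cb * e * S + 2 * ((j n)%:R * h n * Lip) * Mb r * S)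
    @[n --> U] --> (t - s) * (4 * Cb * e * S + 2 * ((t - s) * Lip) * Mb r * S).
  apply: cvgM => //; apply: cvgD; first exact: cvg_cst.
  apply: cvgM; last exact: cvg_cst.
  apply: cvgM; last exact: cvg_cst.
  apply: cvgM; first exact: cvg_cst.
  by apply: cvgM => //; exact: cvg_cst.
rewrite -subr_ge0; apply: (cvgr_to_ge (cvgB c2 c1)).
have large : \forall n \near U, r <= n%:R.
  apply: Uoo; exists (Num.truncn r).+1 => // n /= rn.
  by apply: (le_trans (ltW (truncnS_gt r))); rewrite ler_nat.
apply: filterS large => n rn; rewrite subr_ge0.
have E : euler_at n t = nu n (stepno n s + j n) by rewrite /euler_at /j subnKC// stepno_mono.
rewrite E; apply: (euler_flux r1 rn (tail n)).
rewrite /j subnKC ?stepno_mono//; apply: le_trans (stepno_le n t) _.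
by rewrite ger0_norm// (le_trans s0).
Qed.

(** The cutoff radius r is chosen for the tails first, and then the length dl of
    the time interval according to the size of beta on the box. *)
Lemma limit_flux (T e : R) : 0 <= T -> 0 < e -> exists dl : R, 0 < dl /\
  forall s t, 0 <= s -> s <= t -> t <= T -> t - s <= dl ->
    `|\int[limit_at t]_x w x - \int[limit_at s]_x w x - (t - s) * flux s| <= (t - s) * e /\
    `|flux t - flux s| <= e.
Proof.
move=> T_0 e0.
have k0 : 0 < 2 * (8 * Cb * S + 1).
  by rewrite mulr_gt0// ltr_wpDl// mulr_ge0// mulr_ge0.
pose e1 := e / (2 * (8 * Cb * S + 1)).
have e10 : 0 < e1 by rewrite divr_gt0.
have [r [r1 [tail ltail]]] := limit_tail T_0 e10.
have r0 : 0 <= r := le_trans ler01 r1.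
have d0 : 0 <= Lip * Mb r * S by rewrite mulr_ge0// mulr_ge0// Mb0.
have k'0 : 0 < 2 * (2 * (Lip * Mb r * S) + 1) by rewrite mulr_gt0// ltr_wpDl// mulr_ge0.
exists (e / (2 * (2 * (Lip * Mb r * S) + 1))); split; first by rewrite divr_gt0.
move=> s t s0 st tT; rewrite ler_pdivlMr// => tse.
have E1 : 8 * Cb * e1 * S <= e / 2.
  have : e1 * (2 * (8 * Cb * S + 1)) = e by rewrite /e1 divfK// gt_eqF.
  by move: e10; nra.
have E2 : 2 * ((t - s) * Lip) * Mb r * S <= e / 2.
  have -> : 2 * ((t - s) * Lip) * Mb r * S = (t - s) * (2 * (Lip * Mb r * S)) by ring.
  have : 0 <= t - s by rewrite subr_ge0.
  by move: tse; nra.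
pose Fr x := \int[fprod (limit_at x) (limit_at x)]_p beta_box r p.
have fl x : 0 <= x -> x <= T -> `|flux x - Fr x| <= 4 * Cb * e1 * S.
  move=> x0 xT; have -> : flux x = \int[fprod (limit_at x) (limit_at x)]_p (beta lam q w p * cst 1 p).
    by apply: eq_Rintegral => p _; rewrite /= mulr1.
  apply: beta_box_diff => //.
  - exact: limit_moment.
  - by apply: ltail; rewrite ger0_norm.
  - by move=> p; rewrite /= lexx ler01.
have fs := fl s s0 (le_trans st tT); have ft := fl t (le_trans s0 st) tT.
have Fts : `|Fr t - Fr s| <= 2 * ((t - s) * Lip) * Mb r * S.
  apply: (Rintegral_fprod_close (mbeta_box r) (fun p => beta_box_le p r0)).
  - exact: Mb0.
  - exact: limit_mass.
  - exact: limit_mass.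
  - by rewrite mulr_ge0// subr_ge0.
  - move=> v c mv vc; apply: le_trans (limit_lip s0 st mv vc) _.
    by rewrite [c * _]mulrC mulrA.
split; last first.
  move: fs ft Fts; rewrite !ler_norml => /andP[? ?] /andP[? ?] /andP[? ?].
  by apply/andP; split; lra.
have key := limit_flux_box T_0 r1 tail s0 st tT.
rewrite -/(Fr s) in key.
have -> : \int[limit_at t]_x w x - \int[limit_at s]_x w x - (t - s) * flux s =
  (\int[limit_at t]_x w x - \int[limit_at s]_x w x - (t - s) * Fr s) - (t - s) * (flux s - Fr s).
  by ring.
apply: le_trans (ler_normB _ _) _; apply: le_trans (lerD key (lexx _)) _.
have ts0 : 0 <= t - s by rewrite subr_ge0.
rewrite normrM (ger0_norm ts0) -mulrDr ler_wpM2l//.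
by apply: le_trans (lerD (lexx _) fs) _; lra.
Qed.
(** By [limit_flux] the curve t -> int w dm_t satisfies the hypothesis of
    [FTC_right_difference]. *)
Lemma limit_weak t : 0 <= t ->
  (\int[leb]_(s in `[0%R, t]) (flux s)%:E =
    (\int[limit_at t]_x w x - \int[limit_at 0]_x w x)%:E)%E.
Proof.
rewrite le_eqVlt => /predU1P[<-|t0].
  by rewrite set_itv1 integral_set1 subrr.
apply: (@FTC_right_difference R (fun t => \int[limit_at t]_x w x) flux t t0) => e e0.
exact: limit_flux (ltW t0) e0.
Qed.

End one_test_function.
End limit_family.

Section flow.
Variable R : realType.
Notation T0 := (measurableTypeR R).
Notation leb := (@lebesgue_measure R).

(** Measure-valued solution of the equation, with the estimates that make its
    densities continuous in L^1((1+x)dx). *)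
Record exchange_flow (lam mu0 : {finite_measure set T0 -> \bar R})
    (q : T0 * T0 * T0 -> R) (S : R) (m : R -> {finite_measure set T0 -> \bar R}) := {
  flow_init : forall B, measurable B -> m 0 B = mu0 B;
  flow_moment : forall t, (\int[m t]_x (1 + `|x|)%:E <= S%:E)%E;
  flow_nonpos : forall t, m t [set x | x <= 0] = 0%E;
  flow_dominates : forall t, m t `<< leb;
  flow_tail : forall T e : R, 0 <= T -> 0 < e -> exists r, 1 <= r /\
    forall t, `|t| <= T -> (\int[m t]_x (wgt r x)%:E <= e%:E)%E;
  flow_lip : exists L : R, 0 <= L /\ forall (s t : R) (w : T0 -> R) (c : R),
    0 <= s -> s <= t -> measurable_fun setT w -> (forall x, `|w x| <= c) ->
    `|\int[m t]_x w x - \int[m s]_x w x| <= (t - s) * (c * L);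
  flow_weak : forall (t : R) (w : T0 -> R) (c : R),
    0 <= t -> measurable_fun setT w -> (forall x, `|w x| <= c) ->
    (\int[leb]_(s in `[0%R, t]) (\int[fprod (m s) (m s)]_p beta lam q w p)%:E =
      (\int[m t]_x w x - \int[m 0%R]_x w x)%:E)%E }.

Theorem exchange_flow_ex (lam mu0 : {finite_measure set T0 -> \bar R})
    (q : T0 * T0 * T0 -> R) (A S Z : R) :
    measurable_fun setT q -> (forall p, 0 <= q p) ->
    (forall p, q p <= A * ((1 + `|p.1.1|) * (1 + `|p.1.2|))) ->
    (forall p, q p != 0 -> [/\ 0 < p.2, p.2 < p.1.1 & 0 < p.1.2]) ->
    0 <= A -> 0 <= S -> 0 <= Z ->
    (\int[mu0]_x (1 + `|x|)%:E <= S%:E)%E -> mu0 [set x | x <= 0] = 0%E ->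
    (\int[lam]_z `|z|%:E <= Z%:E)%E -> abs_cont mu0 -> abs_cont lam ->
  exists m, exchange_flow lam mu0 q S m.
Proof.
move=> mq q0 qle q_supp A0 S0 Z0 mu0S mu0_pos lamZ ac0 acl.
have [h hP] := choice (euler_seq_ex lam mq q0 qle q_supp A0 S0 mu0S mu0_pos).
have [nu nuP] := choice hP.
have h0 n : 0 < h n by case: (nuP n).
have hn n : h n <= n.+1%:R^-1 by case: (nuP n).
have nuE n : euler_seq lam mu0 q S (h n) n%:R (nu n) by case: (nuP n).
have [U [UU Uoo]] := ultraFilterLemma (@eventually_filter).
exists (limit_at mq q0 qle A0 S0 ac0 acl h0 nuE (U := U)); split.
- by move=> B; exact: limit_at0.
- exact: limit_moment.
- exact: limit_nonpos.
- exact: limit_dominates.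
- move=> T e T_0 e0.
  have [r [r1 [_ rP]]] := limit_tail mq q0 qle q_supp A0 S0 Z0 mu0S lamZ ac0 acl h0 nuE T_0 e0 (U := U).
  by exists r.
- exists (4 * A * fine (lam setT) * (S * S)); split; first by rewrite !mulr_ge0// fine_ge0.
  by move=> s t w c; exact: limit_lip.
- move=> t w c t0 mw wc.
  exact: (limit_weak mq q0 qle q_supp A0 S0 Z0 mu0S lamZ ac0 acl h0 hn nuE Uoo mw wc t0).
Qed.

End flow.

(** * Densities *)

Section densities.
Context d (T : measurableType d) (R : realType).
Variable mu : {sigma_finite_measure set T -> \bar R}.

Definition has_density (m : {finite_measure set T -> \bar R}) (u : T -> R) :=
  [/\ measurable_fun setT u, forall x, 0 <= u x &
    forall g : T -> \bar R, measurable_fun setT g -> (forall x, 0 <= g x)%E ->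
      (\int[m]_x g x = \int[mu]_x (g x * (u x)%:E))%E].

Lemma density_ex (m : {finite_measure set T -> \bar R}) : m `<< mu ->
  exists u, has_density m u.
Proof.
move=> mmu; pose f := Radon_Nikodym_SigmaFinite.f m mu.
have mf : measurable_fun setT f.
  exact: measurable_int (Radon_Nikodym_SigmaFinite.f_integrable mmu).
have fE x : (fine (f x))%:E = f x.
  by rewrite fineK//; exact: Radon_Nikodym_SigmaFinite.f_fin_num.
exists (fine \o f); split.
- exact: measurableT_comp.
- by move=> x; rewrite fine_ge0//; exact: Radon_Nikodym_SigmaFinite.f_ge0.
- move=> g mg g0; rewrite -(Radon_Nikodym_SigmaFinite.change_of_variables mmu g0)//.
  by apply: eq_integral => x _; rewrite /= fE.
Qed.

(** A density may be modified on a set that the measure does not charge; used to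
    have densities vanishing on the negative half-line. *)
Lemma density_cutoff (m : {finite_measure set T -> \bar R}) (u : T -> R) D :
  measurable D -> m (~` D) = 0%E -> has_density m u -> has_density m (u \_ D).
Proof.
move=> mD mDc [mu_ u0 uE]; split.
- by apply/(measurable_restrictT u mD); exact: measurable_funTS.
- by move=> x; rewrite patchE; case: ifP.
move=> g mg g0; transitivity (\int[m]_x (g x * (\1_D x)%:E))%E.
  have mg1 : measurable_fun setT (fun x => g x * (\1_D x)%:E)%E.
    by apply: emeasurable_funM => //; apply/measurable_EFinP; exact: measurable_indic.
  apply: ae_eq_integral => //.
  exists (~` D); split => //; first exact: measurableC.
  move=> x /= nP; apply: contra_not nP => xD _.
  by rewrite indicE mem_set ?mule1.
rewrite uE//; last 2 first.
- by apply: emeasurable_funM => //; apply/measurable_EFinP; exact: measurable_indic.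
- by move=> x; rewrite mule_ge0// lee_fin.
apply: eq_integral => x _; rewrite -muleA -EFinM; congr (_ * _%:E)%E.
by rewrite patchE indicE; case: (x \in D); rewrite ?mul1r ?mul0r.
Qed.

Section with_density.
Variables (m : {finite_measure set T -> \bar R}) (u : T -> R).
Hypothesis mu_u : has_density m u.

Lemma density_integrable (g : T -> R) : measurable_fun setT g ->
    m.-integrable setT (EFin \o g) ->
  mu.-integrable setT (EFin \o (fun x => g x * u x)).
Proof.
move=> mg /integrableP[_ ig]; have [mu_ u0 uE] := mu_u; apply/integrableP; split.
  by apply/measurable_EFinP; exact: measurable_funM.
apply: le_lt_trans ig; rewrite le_eqVlt; apply/orP; left; apply/eqP.
rewrite uE//=; last first.
  by apply/measurable_EFinP; exact: measurableT_comp.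
by apply: eq_integral => x _; rewrite -EFinM normrM (ger0_norm (u0 x)).
Qed.

Lemma density_integral (g : T -> R) : measurable_fun setT g ->
    m.-integrable setT (EFin \o g) ->
  (\int[m]_x (g x)%:E = \int[mu]_x (g x * u x)%:E)%E.
Proof.
move=> mg ig; have [mu_ u0 uE] := mu_u.
have mg' : measurable_fun setT (EFin \o g) by exact/measurable_EFinP.
rewrite integralE [RHS]integralE !uE//; last 2 first.
- exact: measurable_funeneg.
- exact: measurable_funepos.
congr (_ - _)%E; apply: eq_integral => x _.
- by rewrite !funeposE -!EFin_max -EFinM maxr_pMl// mul0r.
- by rewrite !funenegE -!EFinN -!EFin_max -EFinM maxr_pMl// mul0r mulNr.
Qed.

End with_density.
End densities.

Section half_line.
Variable R : realType.
Notation T0 := (measurableTypeR R).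
Notation leb := (@lebesgue_measure R).

(** Absolute continuity of the integral. *)
Lemma density_abs_cont (m : {finite_measure set T0 -> \bar R}) u :
  has_density leb m u -> abs_cont m.
Proof.
move=> mu_u e e0; have [mu_ u0 uE] := mu_u.
have i1 : m.-integrable setT (EFin \o cst 1).
  by apply: (@integrable_bounded _ _ _ m (cst 1) 1) => // x; rewrite normr1.
have iu : leb.-integrable setT (EFin \o u).
  have := density_integrable mu_u (measurable_cst _) i1.
  by rewrite (_ : (fun x => _) = u)//; apply/funext => x; rewrite /= mul1r.
have [dl [dl0 dlP]] := integral_normr_continuous iu e0.
exists dl; split => // B mB Bd; have := dlP B mB Bd.
rewrite -integral_indicT// uE; last 2 first.
- by apply/measurable_EFinP; exact: measurable_indic.
- by move=> x; rewrite lee_fin.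
move=> /ltW; rewrite -lee_fin /Rintegral fineK; last first.
  apply: integrable_fin_num => //; apply: (integrableS measurableT) => //.
  exact: (integrable_norm iu).
apply: le_trans; rewrite le_eqVlt; apply/orP; left; apply/eqP.
rewrite [RHS]integral_mkcond; apply: eq_integral => x _.
rewrite -EFinM patchE indicE; case: (x \in B); last by rewrite mul0r.
by rewrite mul1r ger0_norm.
Qed.

Lemma measurable_Rpos : measurable (@Rpos R : set T0).
Proof.
rewrite (_ : @Rpos R = `]0, +oo[%classic); first exact: measurable_itv.
by apply/seteqP; split => x; rewrite /= in_itv/= andbT.
Qed.

Lemma integral_Rpos (f : R -> \bar R) : (forall x, x <= 0 -> f x = 0%E) ->
  (\int[lebesgue1 R]_(x in @Rpos R) f x = \int[leb]_x f x)%E.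
Proof.
move=> f0; rewrite integral_mkcond; apply: eq_integral => x _.
rewrite patchE; case: ifPn => //; rewrite notin_setE /Rpos/= => /negP.
by rewrite -leNgt => /f0.
Qed.

Lemma in_L1_setT (f : R -> R) : leb.-integrable setT (EFin \o f) -> in_L1 f.
Proof. by apply: integrableS => //; exact: measurable_Rpos. Qed.

Lemma in_L1_restrict (f : R -> R) : in_L1 f ->
  leb.-integrable setT (EFin \o (fun x => if 0 < x then f x else 0)).
Proof.
move=> /(integrable_mkcond _ measurable_Rpos).1; congr (_.-integrable _ _).
apply/funext => x; rewrite patchE /=; case: ifPn.
  by rewrite inE /Rpos/= => ->.
by rewrite notin_setE /Rpos/= => /negP/negbTE ->.
Qed.

Lemma measurable_restrict_Rpos (f : R -> R) : measurable_fun (@Rpos R) f ->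
  measurable_fun setT (fun x : T0 => if 0 < x then f x else 0 : R).
Proof.
move=> /(measurable_restrictT f measurable_Rpos).1; congr measurable_fun.
apply/funext => x; rewrite patchE /=; case: ifPn.
  by rewrite inE /Rpos/= => ->.
by rewrite notin_setE /Rpos/= => /negP/negbTE ->.
Qed.

End half_line.

(** * Continuity in time of the densities *)

Section flow_densities.
Variable R : realType.
Notation T0 := (measurableTypeR R).
Notation leb := (@lebesgue_measure R).
Variables (lam mu0 : {finite_measure set T0 -> \bar R}).
Variables (q : T0 * T0 * T0 -> R) (S : R).
Variables (m : R -> {finite_measure set T0 -> \bar R}) (u : R -> R -> R).
Hypotheses (flow : exchange_flow lam mu0 q S m).
Hypothesis dens : forall t, has_density leb (m t) (u t).
Hypothesis u_nonpos : forall t x, x <= 0 -> u t x = 0.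

Let mu_ t : measurable_fun setT (u t : T0 -> R). Proof. by case: (dens t). Qed.
Let u_ge0 t x : 0 <= u t x. Proof. by case: (dens t). Qed.

Let m1 : measurable_fun setT (fun x : T0 => 1 + `|x| : R).
Proof. by apply: measurable_funD => //; exact: measurableT_comp. Qed.

Let moment t : (\int[leb]_x ((1 + `|x|) * u t x)%:E <= S%:E)%E.
Proof.
apply: le_trans (flow_moment flow t); have [_ _ ->] := dens t.
- by [].
- exact/measurable_EFinP.
- by move=> x; rewrite lee_fin addr_ge0.
Qed.

Let integrable_moment t : leb.-integrable setT (EFin \o (fun x => (1 + `|x|) * u t x)).
Proof.
apply/integrableP; split; first by apply/measurable_EFinP; exact: measurable_funM.
apply: le_lt_trans (ltry S); apply: le_trans (moment t).
rewrite le_eqVlt; apply/orP; left; apply/eqP.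
by apply: eq_integral => x _; rewrite /= ger0_norm// mulr_ge0// addr_ge0.
Qed.

Let integrable_u t : leb.-integrable setT (EFin \o u t).
Proof.
have i1 : (m t).-integrable setT (EFin \o cst 1).
  by apply: (@integrable_bounded _ _ _ (m t) (cst 1) 1) => // x; rewrite normr1.
have := density_integrable (dens t) (measurable_cst _) i1.
by rewrite (_ : (fun x => _) = u t)//; apply/funext => x; rewrite /= mul1r.
Qed.

Lemma flow_in_L1 t : in_L1 (u t).
Proof. exact: in_L1_setT. Qed.

Lemma L01normE (f : R -> R) : (forall x, x <= 0 -> f x = 0) ->
  (L01norm f = \int[leb]_x ((1 + `|x|) * `|f x|)%:E)%E.
Proof.
move=> f0; rewrite /L01norm /L1norm integral_Rpos; last first.
  by move=> x /f0 ->; rewrite mulr0 normr0.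
apply: eq_integral => x _; have [x0|x0] := leP x 0.
  by rewrite f0// !mulr0 !normr0 mulr0.
by rewrite normrM (gtr0_norm x0) gtr0_norm// addr_gt0.
Qed.

Lemma flow_in_L01 t : in_L01 (u t).
Proof.
apply: in_L1_setT; apply: eq_integrable (integrable_moment t) => // x _ /=.
have [x0|x0] := leP x 0; first by rewrite u_nonpos// !mulr0.
by rewrite gtr0_norm.
Qed.

Lemma flow_L01norm t : (L01norm (u t) <= S%:E)%E.
Proof.
rewrite L01normE; last by move=> x; exact: u_nonpos.
apply: le_trans (moment t); rewrite le_eqVlt; apply/orP; left; apply/eqP.
by apply: eq_integral => x _; rewrite (ger0_norm (u_ge0 t x)).
Qed.

(** Test with w = sign (u t - u s). *)
Lemma flow_total_variation (L s t : R) : 0 <= s -> s <= t ->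
    (forall (w : T0 -> R) (c : R), measurable_fun setT w -> (forall x, `|w x| <= c) ->
      `|\int[m t]_x w x - \int[m s]_x w x| <= (t - s) * (c * L)) ->
  (\int[leb]_x `|u t x - u s x|%:E <= ((t - s) * L)%:E)%E.
Proof.
move=> s0 st lip; pose w x := if u s x <= u t x then 1 else -1 : R.
have mw : measurable_fun setT (w : T0 -> R).
  by apply: measurable_fun_ifT => //; exact: measurable_fun_ler.
have w1 x : `|w x| <= 1 by rewrite /w; case: ifP => _; rewrite ?normrN normr1.
have iw r : (m r).-integrable setT (EFin \o w).
  exact: (@integrable_bounded _ _ _ (m r) w 1 mw w1).
have iwu r := density_integrable (dens r) mw (iw r).
have := lip w 1 mw w1; rewrite mul1r => /(le_trans (ler_norm _)).
rewrite -lee_fin; apply: le_trans.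
have E r : ((\int[m r]_x w x)%:E = \int[leb]_x (w x * u r x)%:E)%E.
  by rewrite (EFin_Rintegral (iw r)); have := density_integral (dens r) mw (iw r).
rewrite EFinB !E -integralB_EFin//.
rewrite le_eqVlt; apply/orP; left; apply/eqP; apply: eq_integral => x _.
congr EFin; rewrite /w; case: leP => h.
  by rewrite ger0_norm ?subr_ge0// !mul1r.
by rewrite distrC gtr0_norm ?subr_gt0// !mulN1r opprK addrC.
Qed.

(** On [0, r] the weight 1+x is at most 1+r and the total variation estimate
    applies; beyond r it is at most 2 wgt r x and the tails are small. *)
Lemma flow_L01_close (T e : R) : 0 <= T -> 0 < e -> exists dl : R, 0 < dl /\
  forall s t, 0 <= s <= T -> 0 <= t <= T -> `|t - s| <= dl ->
    (L01norm (fun x => u t x - u s x)%R <= e%:E)%E.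
Proof.
move=> T_0 e0; have [L [L0 lip]] := flow_lip flow.
have [|r [r1 tail]] := flow_tail flow T_0 (_ : 0 < e / 8); first by rewrite divr_gt0.
have K0 : 0 < 2 * ((1 + r) * L + 1).
  rewrite mulr_gt0// ltr_wpDl// mulr_ge0// addr_ge0//.
  exact: le_trans ler01 r1.
exists (e / (2 * ((1 + r) * L + 1))); split; first by rewrite divr_gt0.
suff H s t : 0 <= s -> s <= t -> t <= T ->
    t - s <= e / (2 * ((1 + r) * L + 1)) ->
    (L01norm (fun x => u t x - u s x)%R <= e%:E)%E.
  move=> s t /andP[s0 sT] /andP[t0 tT]; have [st|/ltW ts] := leP s t.
    by rewrite ger0_norm ?subr_ge0// => std; exact: H.
  rewrite distrC ger0_norm ?subr_ge0// => /(H _ _ t0 ts sT); apply: le_trans.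
  rewrite le_eqVlt; apply/orP; left; apply/eqP; apply: eq_integral => x _.
  by rewrite !normrM distrC.
move=> s0 st tT; rewrite ler_pdivlMr// => tse.
have t0 : 0 <= t := le_trans s0 st; have sT : s <= T := le_trans st tT.
have r0 : 0 < r := lt_le_trans ltr01 r1.
rewrite L01normE; last by move=> x x0; rewrite !u_nonpos// subrr.
have md : measurable_fun setT (fun x : T0 => `|u t x - u s x| : R).
  by apply: measurableT_comp => //; exact: measurable_funB.
have mwgt := @measurable_wgt R r.
have W v : 0 <= v -> v <= T -> (\int[leb]_x (wgt r x * u v x)%:E <= (e / 8)%:E)%E.
  move=> v0 vT; apply: le_trans (tail v _); last by rewrite ger0_norm.
  have [_ _ ->] := dens v; first exact: lexx.
  - exact/measurable_EFinP.
  - by move=> x; rewrite lee_fin wgt_ge0.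
have mW v : measurable_fun setT (fun x : T0 => (wgt r x * u v x)%:E).
  by apply/measurable_EFinP; exact: measurable_funM.
have W0 v (x : T0) : 0 <= wgt r x * u v x by apply: mulr_ge0 => //; exact: wgt_ge0.
apply: (@le_trans _ _ (\int[leb]_x ((1 + r)%:E * `|u t x - u s x|%:E +
    2%:E * ((wgt r x * u t x)%:E + (wgt r x * u s x)%:E)))%E).
  apply: ge0_le_integral => //.
  - by apply/measurable_EFinP; exact: measurable_funM.
  - apply: emeasurable_funD.
      by apply: measurable_funeM; exact/measurable_EFinP.
    by apply: measurable_funeM; exact: emeasurable_funD.
  - move=> x _; change (((1 + `|x|) * `|u t x - u s x|)%:E <=
      ((1 + r) * `|u t x - u s x| + 2 * (wgt r x * u t x + wgt r x * u s x))%:E)%E.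
    rewrite lee_fin -mulrDr.
    have [xr|/ltW rx] := leP `|x| r.
      rewrite ler_wpDr//; last by rewrite ler_wpM2r// lerD2l.
      by rewrite mulr_ge0// mulr_ge0 ?addr_ge0// wgt_ge0.
    rewrite ler_wpDl//; first by rewrite mulr_ge0// addr_ge0// ltW.
    rewrite wgt_tail// mulrA ler_pM ?addr_ge0//; first by lra.
    apply: le_trans (ler_normB _ _) _.
    by rewrite !ger0_norm.
rewrite ge0_integralD//; last 4 first.
- by move=> x _; rewrite mule_ge0// lee_fin// addr_ge0// ltW.
- by apply: measurable_funeM; exact/measurable_EFinP.
- by move=> x _; rewrite mule_ge0// adde_ge0// lee_fin.
- by apply: measurable_funeM; exact: emeasurable_funD.
rewrite !ge0_integralZl_EFin//; last 4 first.
- by move=> x _; rewrite adde_ge0// lee_fin.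
- exact: emeasurable_funD.
- exact/measurable_EFinP.
- by rewrite addr_ge0// ltW.
rewrite ge0_integralD//; last 2 first.
- by move=> x _; rewrite lee_fin.
- by move=> x _; rewrite lee_fin.
have TV := flow_total_variation s0 st (fun w c => lip s t w c s0 st).
apply: (@le_trans _ _ ((1 + r)%:E * ((t - s) * L)%:E + 2%:E * ((e / 8)%:E + (e / 8)%:E))%E).
  apply: leeD; first by rewrite lee_wpmul2l// lee_fin addr_ge0// ltW.
  by rewrite lee_wpmul2l//; apply: leeD; exact: W.
change (((1 + r) * ((t - s) * L) + 2 * (e / 8 + e / 8))%:E <= e%:E)%E.
rewrite lee_fin.
have ts0 : 0 <= t - s by rewrite subr_ge0.
by move: tse; nra.
Qed.

End flow_densities.

Section L01_curves.
Variable R : realType.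
Notation T0 := (measurableTypeR R).
Notation leb := (@lebesgue_measure R).
Variables (u : R -> R -> R) (S : R).
Hypothesis u_L1 : forall t, in_L1 (u t).
Hypothesis u_L01 : forall t, in_L01 (u t).
Hypothesis u_close : forall T e : R, 0 <= T -> 0 < e -> exists dl : R, 0 < dl /\
  forall s t, 0 <= s <= T -> 0 <= t <= T -> `|t - s| <= dl ->
    (L01norm (fun x => u t x - u s x)%R <= e%:E)%E.

Let L01norm_ge0 (f : R -> R) : (0 <= L01norm f)%E.
Proof. by apply: integral_ge0 => x _; rewrite lee_fin. Qed.

Let close_near (t e : R) : 0 <= t -> 0 < e ->
  \forall s \near within [set s : R | 0 <= s] (nbhs t),
    (L01norm (fun x => u s x - u t x)%R <= e%:E)%E.
Proof.
move=> t0 e0; have [|dl [dl0 dlP]] := u_close (_ : 0 <= t + 1) e0.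
  by rewrite addr_ge0.
have m0 : 0 < Num.min dl 1 by rewrite lt_min dl0 ltr01.
exists (Num.min dl 1) => //= s; rewrite /ball_/= lt_min distrC => /andP[sdl s1] s0.
move: s1; rewrite ltr_norml => /andP[_ s1].
by apply: dlP; rewrite ?s0 ?t0/= ?(ltW sdl)//; lra.
Qed.

Let cvge0 (I : Type) (F : set_system I) (FF : Filter F) (f : I -> \bar R) :
    (forall t, 0 <= f t)%E ->
    (forall e, 0 < e -> \forall t \near F, (f t <= e%:E)%E) ->
  f t @[t --> F] --> 0%E.
Proof.
move=> f0 fF; apply/fine_cvgP; split.
  apply: filterS (fF 1 ltr01) => t ft.
  by rewrite ge0_fin_numE// (le_lt_trans ft)// ltry.
apply/cvgrPdist_le => e e0; apply: filterS (fF e e0) => t ft.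
rewrite sub0r normrN ger0_norm ?fine_ge0//= -lee_fin fineK//.
by rewrite ge0_fin_numE// (le_lt_trans ft)// ltry.
Qed.

Lemma continuous_L01_close : continuous_L01 u.
Proof.
split; first by move=> t _; exact: u_L01.
move=> t t0; apply: cvge0 => // e e0; exact: close_near.
Qed.

Lemma L1norm_le_L01norm (f : R -> R) : in_L1 f -> in_L01 f ->
  (L1norm f <= L01norm f)%E.
Proof.
move=> /measurable_int mf /measurable_int mf1; apply: ge0_le_integral => //.
- exact: measurable_Rpos.
- exact: (measurableT_comp (@abse_measurable _ _) mf).
- exact: (measurableT_comp (@abse_measurable _ _) mf1).
- move=> x x0; rewrite lee_fin normrM ler_peMl// ger0_norm; last first.
    by rewrite addr_ge0// ltW.
  by rewrite lerDl ltW.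
Qed.

(** A bounded functional on L^1 is continuous, and the L^1 norm is below the
    norm of L^1((1+x)dx). *)
Lemma weakly_continuous_L1_close : weakly_continuous_L1 u.
Proof.
split; first by move=> t _; exact: u_L1.
move=> l [llin [C lC]]; apply/subspace_continuousP => t /= t0.
have lC' (f : R -> R) : in_L1 f -> ((`|l f|)%:E <= (`|C| + 1)%:E * L1norm f)%E.
  move=> f1; apply: le_trans (lC f f1) _; rewrite lee_wpmul2r//.
    by apply: integral_ge0 => x _; rewrite lee_fin.
  by rewrite lee_fin ler_wpDr// ler_norm.
apply/cvgrPdist_le => e e0.
have C0 : 0 < `|C| + 1 by rewrite ltr_wpDl.
have [|k] := close_near t0 (_ : 0 < e / (`|C| + 1)); first by rewrite divr_gt0.
move=> k0 H; exists k => // s ks s0; have {H} := H s ks s0.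
set f := fun x => _ => fe.
have mR : measurable (@Rpos R : set T0) := @measurable_Rpos R.
have f1 : in_L1 f by exact: (integrableB mR (u_L1 s) (u_L1 t)).
have f01 : in_L01 f.
  rewrite /in_L01 /in_L1; have -> : (fun x : R => ((1 + x) * f x)%:E) =
      (fun x => ((1 + x) * u s x)%:E - ((1 + x) * u t x)%:E)%E.
    by apply/funext => x; rewrite /f mulrBr EFinB.
  by apply: integrableB => //; exact: u_L01.
rewrite /from_subspace; have -> : l (u t) - l (u s) = - l f.
  have := llin (-1) (u t) (u s) (u_L1 t) (u_L1 s).
  have -> : (fun x => -1 * u t x + u s x) = f.
    by apply/funext => x; rewrite /f mulN1r addrC.
  by move=> ->; rewrite mulN1r opprD opprK.
rewrite normrN -lee_fin; apply: le_trans (lC' f f1) _.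
apply: (@le_trans _ _ ((`|C| + 1)%:E * (e / (`|C| + 1))%:E)%E).
  rewrite lee_wpmul2l ?lee_fin ?(ltW C0)//.
  exact: le_trans (L1norm_le_L01norm f1 f01) fe.
by rewrite -EFinM lee_fin mulrC divfK// gt_eqF.
Qed.

(** The step functions with the values u(iT/N) on [iT/N, (i+1)T/N[ converge
    uniformly. *)
Lemma strongly_measurable_L01_close (T : R) : 0 < T ->
  strongly_measurable_L01 `]0, T[ u.
Proof.
move=> T_0; pose N n : R := n.+1%:R.
have N0 n : 0 < N n by rewrite ltr0n.
pose E n (i : 'I_n.+1) := `[i%:R * T / N n, i.+1%:R * T / N n[%classic : set R.
exists (fun n t x => \sum_(i < n.+1) \1_(E n i) t * u (i%:R * T / N n) x).
split.
  move=> n; exists n.+1, (E n), (fun i => u (i%:R * T / N n)); split => // i.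
  by split; [exact: measurable_itv|exact: u_L01].
apply: aeW => t; rewrite /= in_itv/= => /andP[t0 tT].
pose k n := Num.truncn (t * N n / T); pose g n := (k n)%:R * T / N n.
have kP n : g n <= t /\ t < (k n).+1%:R * T / N n.
  have /truncn_itv/andP[a b] : 0 <= t * N n / T by rewrite divr_ge0// ?mulr_ge0// ltW.
  split; first by rewrite ler_pdivrMr// -ler_pdivlMr.
  by rewrite ltr_pdivlMr// -ltr_pdivrMr.
have kn n : (k n < n.+1)%N.
  have [a _] := kP n; rewrite -(ltr_nat R) -(ltr_pM2r T_0) -(ltr_pM2r (_ : 0 < (N n)^-1)).
    by apply: (le_lt_trans a); rewrite mulrAC mulfV ?mul1r// gt_eqF.
  by rewrite invr_gt0.
have sE n x : \sum_(i < n.+1) \1_(E n i) t * u (i%:R * T / N n) x = u (g n) x.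
  rewrite (bigD1 (Ordinal (kn n)))//= big1 ?addr0.
    rewrite indicE mem_set ?mul1r//= /E/= in_itv/=.
    by have [a b] := kP n; rewrite -/(g n) a b.
  move=> i ik; rewrite indicE memNset ?mul0r//= /E/= in_itv/= => /andP[a b].
  have : k n == i.
    have X0 : 0 <= t * N n / T by rewrite divr_ge0// ?mulr_ge0// ltW.
    rewrite (truncn_eq _ X0).
    by rewrite ler_pdivlMr// -ler_pdivrMr// a /= ltr_pdivrMr// -ltr_pdivlMr.
  by move=> /eqP kni; move/eqP: ik; apply; exact/val_inj.
apply: cvge0 => // e e0; have [dl [dl0 dlP]] := u_close (ltW T_0) e0.
exists (Num.truncn (T / dl)) => // n /= nT.
have -> : (fun x => \sum_(i < n.+1) \1_(E n i) t * u (i%:R * T / N n) x - u t x) =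
    (fun x => u (g n) x - u t x).
  by apply/funext => x; rewrite sE.
have [g1 g2] := kP n.
have TN : T / N n <= dl.
  rewrite ler_pdivrMr// mulrC -ler_pdivrMr//; apply: ltW.
  by apply: lt_le_trans (truncnS_gt _) _; rewrite ler_nat ltnS.
apply: dlP.
- by rewrite !ltW.
- rewrite (le_trans g1 (ltW tT)) andbT /g; apply: divr_ge0; last exact: ltW.
  by apply: mulr_ge0 => //; exact: ltW.
rewrite distrC ger0_norm ?subr_ge0//; apply: le_trans TN.
move: g2; rewrite -natr1 mulrDl mul1r mulrDl -/(g n) => g2.
by rewrite lerBlDl ltW.
Qed.

Lemma in_Linfty_L01_close (T : R) : 0 < T ->
    (forall t, (L01norm (u t) <= S%:E)%E) -> in_Linfty_L01 T u.
Proof.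
move=> T_0 uS; split; first exact: strongly_measurable_L01_close.
by exists S; apply: aeW => t _; split; [exact: u_L01|exact: uS].
Qed.

End L01_curves.

(** * From measures back to functions *)

Section weak_formulation.
Variable R : realType.
Notation T0 := (measurableTypeR R).
Notation leb := (@lebesgue_measure R).

(** A ball on which w exceeds M would have positive measure. *)
Lemma continuous_ae_bound (w : R -> R) (M : R) :
    (forall x, 0 < x -> {for x, continuous w}) ->
    {ae lebesgue1 R, forall x, Rpos x -> `|w x| <= M} ->
  forall x, 0 < x -> `|w x| <= M.
Proof.
move=> cw [N [mN N0 sub]] x x0; rewrite leNgt; apply/negP => Mx.
have : \forall y \near x, 0 < y /\ M < `|w y|.
  near=> y; split.
    by near: y; exact: lt_nbhsr.
  near: y; have cn : `|w y| @[y --> x] --> `|w x| by apply: cvg_norm; exact: cw.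
  exact: (cvgr_gt _ cn).
move=> [e /= e0 xe].
have /(le_measure (lebesgue1 R)) : ball x e `<=` N.
  move=> y /xe [y0 My]; apply: sub => /= H; move: (H y0).
  by rewrite leNgt My.
rewrite !inE => /(_ (measurable_ball _ _) mN).
have E : (lebesgue1 R (ball x e) = (e *+ 2)%:E)%E.
  exact: (lebesgue_measure_ball x (ltW e0)).
rewrite [X in (_ <= X)%E]N0 [X in (X <= _)%E]E lee_fin.
by apply/negP; rewrite -ltNge pmulrn_lgt0.
Unshelve. all: by end_near. Qed.

Variables (lam m : {finite_measure set T0 -> \bar R}) (q K : R * R * R -> R).
Variables (phi u : R -> R) (A S M : R) (w : R -> R).
Hypotheses (dlam : has_density leb lam phi) (dm : has_density leb m u).
Hypothesis u_nonpos : forall x, x <= 0 -> u x = 0.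
Hypothesis mS : (\int[m]_x (1 + `|x|)%:E <= S%:E)%E.
Hypotheses (mq : measurable_fun setT (q : T0 * T0 * T0 -> R)) (q0 : forall p, 0 <= q p).
Hypothesis (qle : forall p, q p <= A * ((1 + `|p.1.1|) * (1 + `|p.1.2|))).
Hypothesis q_supp : forall p, q p != 0 -> [/\ 0 < p.2, p.2 < p.1.1 & 0 < p.1.2].
Hypothesis A0 : 0 <= A.
Hypothesis KE : forall x y z, 0 < z -> z < x -> 0 < y -> x + y != 1 ->
  K (x, y, z) = q (x, y, z) * phi z.
Hypotheses (mw : measurable_fun setT (w : T0 -> R)) (wM : forall x, `|w x| <= M).

Let M0 : 0 <= M. Proof. exact: le_trans (normr_ge0 _) (wM 0). Qed.
Let b (p : T0 * T0) : R := beta lam q w p.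
Let C := 4 * M * A * fine (lam setT).
Let C0 : 0 <= C. Proof. by rewrite !mulr_ge0// fine_ge0. Qed.
Let mb : measurable_fun setT b. Proof. exact: measurable_beta. Qed.
Let bC p : `|b p| <= C * ((1 + `|p.1|) * (1 + `|p.2|)).
Proof. exact: (integrable_exchange lam mq q0 qle p mw wM).2. Qed.

Let m1 : measurable_fun setT (fun x : T0 => 1 + `|x| : R).
Proof. by apply: measurable_funD => //; exact: measurableT_comp. Qed.

Let mby x : measurable_fun setT (fun y : T0 => b (x, y)).
Proof. by apply: (measurableT_comp mb); exact: pair1_measurable. Qed.

Let ib : (fprod m m).-integrable setT (EFin \o b).
Proof.
by apply: (Rintegral_fprod_le mb m1 m1 C0 _ _ mS mS bC).1 => x; rewrite addr_ge0.
Qed.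

Let iby x : m.-integrable setT (EFin \o (fun y => b (x, y))).
Proof.
apply: (@le_integrable _ _ _ m _ measurableT _
    (EFin \o (fun y : T0 => C * (1 + `|x|) * (1 + `|y|)))).
- exact/measurable_EFinP.
- move=> y _ /=; rewrite lee_fin; apply: le_trans (bC (x, y)) _.
  by rewrite mulrA ler_norm.
rewrite (_ : EFin \o _ = fun y : T0 => ((C * (1 + `|x|))%:E * (1 + `|y|)%:E)%E)//.
apply: integrableZl => //; apply/integrableP; split; first exact/measurable_EFinP.
apply: le_lt_trans (ltry S); apply: le_trans mS.
rewrite le_eqVlt; apply/orP; left; apply/eqP.
by apply: eq_integral => y _; rewrite /= ger0_norm// addr_ge0.
Qed.

Let integral_z x y : 0 < x -> 0 < y -> x + y != 1 ->
  (\int[lebesgue1 R]_(z in `]0%R, x[)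
    ((w (y + z) + w (x - z) - w x - w y) * K (x, y, z) * u x * u y)%:E =
  (b (x, y) * u x * u y)%:E)%E.
Proof.
move=> x0 y0 xy; have [iz _] := integrable_exchange lam mq q0 qle (x, y) mw wM.
pose f (z : T0) := exchange w (x, y, z) * q (x, y, z).
have mf : measurable_fun setT f.
  have : measurable_fun setT (fun p : T0 * T0 * T0 => exchange w p * q p).
    by apply: measurable_funM => //; exact: measurable_exchange.
  by move/measurableT_comp; apply; exact: pair1_measurable.
rewrite integral_mkcond /=.
transitivity (\int[leb]_z ((f z * phi z)%:E * (u x * u y)%:E))%E.
  apply: eq_integral => z _; rewrite patchE; case: ifPn.
    rewrite inE /= in_itv/= => /andP[z0 zx]; rewrite KE// -EFinM; congr EFin.
    by rewrite /f /exchange/=; ring.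
  rewrite notin_setE /= in_itv/= => zx; rewrite /f.
  have -> : q (x, y, z) = 0.
    by apply/eqP; apply: contra_notT zx => /q_supp[/= -> -> _].
  by rewrite mulr0 mul0r mul0e.
rewrite integralZr//; last exact: (density_integrable dlam mf iz).
rewrite -(density_integral dlam mf iz) -(EFin_Rintegral iz) -EFinM.
by rewrite mulrA.
Qed.

(** The factorization of K fails at y = 1 - x at most, where no bound on the
    kernel is available; this is one point of the line. *)
Let integral_y x : 0 < x ->
  (\int[lebesgue1 R]_(y in @Rpos R) \int[lebesgue1 R]_(z in `]0%R, x[)
    ((w (y + z) + w (x - z) - w x - w y) * K (x, y, z) * u x * u y)%:E =
  ((\int[m]_y b (x, y)) * u x)%:E)%E.
Proof.
move=> x0; have [mu_ u0 _] := dm.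
pose F (y : R) := (\int[lebesgue1 R]_(z in `]0%R, x[)
  ((w (y + z) + w (x - z) - w x - w y) * K (x, y, z) * u x * u y)%:E)%E.
change (\int[lebesgue1 R]_(y in @Rpos R) F y = ((\int[m]_y b (x, y)) * u x)%:E)%E.
pose G y := ((b (x, y) * u y)%:E * (u x)%:E)%E.
have mG : measurable_fun setT (G : T0 -> \bar R).
  apply: emeasurable_funM => //; apply/measurable_EFinP.
  exact: measurable_funM.
have FG y : 0 < y -> y != 1 - x -> F y = G y.
  move=> y0 yx; rewrite /F integral_z//; first by rewrite /G -EFinM; congr EFin; ring.
  by apply: contra yx => /eqP <-; rewrite addrC addKr.
have FE y : Rpos y -> F y = if y == 1 - x then F (1 - x) else G y.
  by move=> y0; case: eqP => [->//|/eqP yx]; exact: FG.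
transitivity (\int[lebesgue1 R]_(y in @Rpos R) G y)%E.
  transitivity (\int[lebesgue1 R]_(y in @Rpos R)
      (if y == (1 - x)%R then F (1 - x)%R else G y))%E.
    by apply: eq_integral => y; rewrite inE => /FE.
  apply: ae_eq_integral => //.
  - exact: measurable_Rpos.
  - apply: measurable_funTS; apply: measurable_fun_ifT => //.
    exact: measurable_fun_eqr.
  - exact: measurable_funTS.
  - exists [set 1 - x]; split => //; first exact: lebesgue_measure_set1.
    by move=> y /= H; apply: contra_notP H => yx y0; rewrite ifN//; exact/eqP.
rewrite integral_Rpos; last by move=> y y0; rewrite /G u_nonpos// mulr0 mul0e.
rewrite /G integralZr//; last exact: (density_integrable dm (mby x) (iby x)).
by rewrite -(density_integral dm (mby x) (iby x)) -(EFin_Rintegral (iby x)) -EFinM.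
Qed.

(** Fubini, and replacement of dm by u dx and of dlam by phi dz in each
    variable. *)
Lemma weak_form_flux :
  (\int[lebesgue1 R]_(x in @Rpos R) \int[lebesgue1 R]_(y in @Rpos R)
   \int[lebesgue1 R]_(z in `]0%R, x[)
    ((w (y + z) + w (x - z) - w x - w y) * K (x, y, z) * u x * u y)%:E =
  (\int[fprod m m]_p b p)%:E)%E.
Proof.
pose B x := \int[m]_y b (x, y).
have mB : measurable_fun setT (B : T0 -> R) by exact: measurable_Rintegral_section.
have iB : m.-integrable setT (EFin \o B).
  apply: eq_integrable (integrable_fubini_fprod ib) => // x _ /=.
  by rewrite (EFin_Rintegral (iby x)).
transitivity (\int[lebesgue1 R]_(x in @Rpos R) (B x * u x)%:E)%E.
  by apply: eq_integral => x; rewrite inE => x0; rewrite integral_y.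
rewrite integral_Rpos; last by move=> x x0; rewrite u_nonpos// mulr0.
rewrite -(density_integral dm mB iB) -(EFin_Rintegral iB).
by rewrite (Rintegral_fprod12 ib iby).
Qed.

End weak_formulation.

(** * The kernel, the initial datum, and the conclusion *)

Section kernel_and_data.
Variable R : realType.
Notation T0 := (measurableTypeR R).
Notation leb := (@lebesgue_measure R).

(** A nonnegative function on the whole line equal to |f| on the positive
    half-line: phi may be negative where the kernel vanishes, and the initial
    datum is nonnegative only almost everywhere. *)
Definition half_abs (f : R -> R) (x : R) : R := if 0 < x then `|f x| else 0.

Lemma half_abs_ge0 f x : 0 <= half_abs f x.
Proof. by rewrite /half_abs; case: ifP. Qed.

Lemma measurable_powRT d (T : measurableType d) (f : T -> R) (p : R) :
  measurable_fun setT f -> measurable_fun setT (fun x => powR (f x) p).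
Proof.
apply: (@measurableT_comp _ _ _ _ _ _ (fun y : T0 => powR y p : R)).
exact: measurable_powR.
Qed.

Lemma measurable_L01 (f : R -> R) : in_L01 f -> measurable_fun (@Rpos R : set T0) f.
Proof.
move=> /measurable_int/measurable_EFinP mf.
have mp : measurable_fun setT (fun x : T0 => powR (1 + x) (-1) : R).
  by apply: measurable_powRT; exact: measurable_funD.
apply: (eq_measurable_fun (fun x : T0 => (1 + x) * f x * powR (1 + x) (-1) : R)).
  move=> x; rewrite inE => x0; have x1 : 0 < 1 + x by rewrite addr_gt0.
  by rewrite powR_inv1 ?ltW// mulrAC mulfV ?mul1r// gt_eqF.
by apply: measurable_funM => //; exact: measurable_funTS.
Qed.

Lemma measurable_half_abs (f : R -> R) : in_L01 f ->
  measurable_fun setT (half_abs f : T0 -> R).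
Proof.
move=> /measurable_L01 mf; apply: (@measurable_restrict_Rpos R (fun x => `|f x|)).
exact: measurableT_comp.
Qed.

Lemma L01_measure_ex (f : R -> R) : in_L01 f ->
  exists (mu : {finite_measure set T0 -> \bar R}) (S : R),
    [/\ 0 <= S, has_density leb mu (half_abs f),
        (\int[mu]_x (1 + `|x|)%:E <= S%:E)%E & mu [set x | x <= 0] = 0%E].
Proof.
move=> f01; have mg := measurable_half_abs f01.
have m1 : measurable_fun setT (fun x : T0 => 1 + `|x| : R).
  by apply: measurable_funD => //; exact: measurableT_comp.
have g0 := half_abs_ge0 f.
have h0 x : 0 <= (1 + `|x|) * half_abs f x by rewrite mulr_ge0// addr_ge0.
have ih : leb.-integrable setT (EFin \o (fun x => (1 + `|x|) * half_abs f x)).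
  apply: le_integrable (in_L1_restrict f01) => //.
    by apply/measurable_EFinP; exact: measurable_funM.
  move=> x _ /=; rewrite lee_fin ger0_norm// /half_abs.
  case: ifPn => [x0|_]; last by rewrite mulr0.
  by rewrite normrM (gtr0_norm x0) (gtr0_norm (_ : 0 < 1 + x))// addr_gt0.
have ig : leb.-integrable setT (EFin \o half_abs f).
  apply: le_integrable ih => //; first exact/measurable_EFinP.
  move=> x _ /=; rewrite lee_fin (ger0_norm (h0 x)) (ger0_norm (g0 x)).
  by rewrite ler_peMl// lerDl.
have [mu muE] := @density_measure _ T0 R leb (half_abs f) g0 ig.
have dmu : has_density leb mu (half_abs f) by split.
exists mu, (fine (\int[leb]_x ((1 + `|x|) * half_abs f x)%:E)); split => //.
- by apply: fine_ge0; apply: integral_ge0 => x _; rewrite lee_fin.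
- rewrite muE; last 2 first.
  + exact/measurable_EFinP.
  + by move=> x; rewrite lee_fin addr_ge0.
  rewrite fineK; last exact: (integrable_fin_num _ ih).
  by [].
have mN : measurable ([set x | x <= 0] : set T0).
  by rewrite -[X in measurable X]set_itvE; exact: measurable_itv.
rewrite -integral_indicT// muE; last 2 first.
- by apply/measurable_EFinP; exact: measurable_indic.
- by move=> x; rewrite lee_fin.
rewrite integral0_eq// => x _; rewrite -EFinM indicE /half_abs.
have [xN|xN] := boolP (x \in [set x | x <= 0]); last by rewrite mul0r.
by move: xN; rewrite inE/= => x0; rewrite ltNge x0 mulr0.
Qed.

(** q = K / |phi| on the set D of admissible exchanges, zero elsewhere; where phi
    vanishes so does K on D, and the convention 1/0 = 0 is harmless. On D the sum
    x+y is either below or above 1, and (1+x)(1+y) dominates both 1 and x+y. *)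
Lemma kernel_factor_ex (K : R * R * R -> R) (phi : R -> R) (A : R) :
    in_L01 phi -> measurable_fun (@Rpos3 R : set (T0 * T0 * T0)) K ->
    (forall x y z : R, 0 < x -> 0 < y -> 0 < z -> 0 <= K (x, y, z)) -> 0 <= A ->
    (forall x y z : R, 0 < x -> 0 < y -> 0 < z ->
      x + y < 1 -> K (x, y, z) <= A * phi z) ->
    (forall x y z : R, 0 < x -> 0 < y -> 0 < z ->
      1 < x + y -> K (x, y, z) <= A * (x + y) * phi z) ->
  exists q : T0 * T0 * T0 -> R,
    [/\ measurable_fun setT q, forall p, 0 <= q p,
        forall p, q p <= A * ((1 + `|p.1.1|) * (1 + `|p.1.2|)),
        forall p, q p != 0 -> [/\ 0 < p.2, p.2 < p.1.1 & 0 < p.1.2] &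
        forall x y z, 0 < z -> z < x -> 0 < y -> x + y != 1 ->
          K (x, y, z) = q (x, y, z) * half_abs phi z].
Proof.
move=> phi01 mK K0 A0 Ksmall Klarge.
pose D : set (T0 * T0 * T0) := [set p | [/\ 0 < p.2, p.2 < p.1.1, 0 < p.1.2 &
  p.1.1 + p.1.2 != 1]].
have mx : measurable_fun setT (fun p : T0 * T0 * T0 => p.1.1 : R) by exact: measurableT_comp.
have my : measurable_fun setT (fun p : T0 * T0 * T0 => p.1.2 : R) by exact: measurableT_comp.
have mz : measurable_fun setT (fun p : T0 * T0 * T0 => p.2 : R) by exact: measurable_snd.
have mbool (f : T0 * T0 * T0 -> bool) : measurable_fun setT f -> measurable [set p | f p].
  by move=> mf; rewrite -[X in measurable X]setTI; exact: (mf measurableT [set true]).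
have m3 : measurable (@Rpos3 R : set (T0 * T0 * T0)).
  rewrite (_ : @Rpos3 R = [set p | [&& 0 < p.1.1, 0 < p.1.2 & 0 < p.2]]).
    apply: mbool; apply: measurable_and; first exact: measurable_fun_ltr.
    by apply: measurable_and; exact: measurable_fun_ltr.
  by apply/seteqP; split => p /=; [move=> [-> -> ->]|move=> /and3P[]].
have mD : measurable D.
  rewrite (_ : D = [set p | [&& 0 < p.2, p.2 < p.1.1, 0 < p.1.2 & p.1.1 + p.1.2 != 1]]).
    apply: mbool; apply: measurable_and; first exact: measurable_fun_ltr.
    apply: measurable_and; first exact: measurable_fun_ltr.
    apply: measurable_and; first exact: measurable_fun_ltr.
    apply: measurable_neg; apply: measurable_fun_eqr => //; exact: measurable_funD.
  by apply/seteqP; split => p /=; [move=> [-> -> -> ->]|move=> /and4P[]].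
have D3 : D `<=` @Rpos3 R.
  by move=> [[x y] z] [/= z0 zx y0 _]; split => //=; exact: lt_trans zx.
have mK' : measurable_fun setT (K \_ D).
  by apply/(measurable_restrictT K mD); exact: (measurable_funS m3 D3 mK).
have mphi : measurable_fun setT (fun p : T0 * T0 * T0 => powR (half_abs phi p.2) (-1)).
  apply: measurable_powRT; exact: (measurableT_comp (measurable_half_abs phi01) mz).
(* this power is the inverse on nonnegative reals, 0 included *)
have invE z : powR (half_abs phi z) (-1) = (half_abs phi z)^-1.
  by rewrite powR_inv1// half_abs_ge0.
pose q p := (K \_ D) p * powR (half_abs phi p.2) (-1).
have Kle x y z : D (x, y, z) ->
    K (x, y, z) <= A * ((1 + `|x|) * (1 + `|y|)) * half_abs phi z.
  move=> Dp; have [/= x0 y0 z0] := D3 _ Dp; have [_ _ _ /= xy] := Dp.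
  have phiz : phi z <= half_abs phi z by rewrite /half_abs z0 ler_norm.
  have h0 := half_abs_ge0 phi z.
  rewrite !gtr0_norm// -mulrA; move: xy; rewrite neq_lt => /orP[xy|xy].
    apply: le_trans (Ksmall _ _ _ x0 y0 z0 xy) _; rewrite ler_wpM2l//.
    by apply: (le_trans phiz); rewrite ler_peMl//; nra.
  apply: le_trans (Klarge _ _ _ x0 y0 z0 xy) _; rewrite -mulrA ler_wpM2l//.
  apply: (@le_trans _ _ ((x + y) * half_abs phi z)).
    by rewrite ler_wpM2l// addr_ge0// ltW.
  by rewrite ler_wpM2r//; nra.
have q_ge0 p : 0 <= q p.
  apply: mulr_ge0; last exact: powR_ge0.
  rewrite patchE; case: ifPn => //; rewrite inE; case: p => [[x y] z] Dp.
  by have [/= x0 y0 z0] := D3 _ Dp; exact: K0.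
exists q; split => //.
- exact: measurable_funM.
- move=> [[x y] z] /=; have ub : 0 <= A * ((1 + `|x|) * (1 + `|y|)).
    by rewrite mulr_ge0// mulr_ge0// addr_ge0.
  rewrite /q patchE invE /=; case: ifPn; last by rewrite mul0r.
  rewrite inE => Dp; have [h0|h0] := eqVneq (half_abs phi z) 0.
    by rewrite h0 invr0 mulr0.
  rewrite ler_pdivrMr; first exact: Kle.
  by rewrite lt_neqAle eq_sym h0 half_abs_ge0.
- move=> p; rewrite /q patchE; case: ifPn; last by rewrite mul0r eqxx.
  by rewrite inE => -[].
- move=> x y z z0 zx y0 xy; have Dp : D (x, y, z) by split.
  rewrite /q patchE mem_set// invE; have [h0|h0] := eqVneq (half_abs phi z) 0.
    rewrite h0 mulr0; apply/eqP; rewrite eq_le; apply/andP; split.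
      by have := Kle _ _ _ Dp; rewrite h0 mulr0.
    by apply: K0 => //; exact: lt_trans zx.
  by rewrite divfK.
Qed.

End kernel_and_data.

Section final_assembly.
Variable R : realType.
Notation T0 := (measurableTypeR R).
Notation leb := (@lebesgue_measure R).

Lemma smooth_on_Rpos_continuous (w : R -> R) : smooth_on_Rpos w ->
  forall x, 0 < x -> {for x, continuous w}.
Proof.
move=> sw x x0; apply: differentiable_continuous; apply/derivable1_diffP.
exact: (sw 0%N x x0).
Qed.

Lemma flow_density_ex (lam mu0 : {finite_measure set T0 -> \bar R})
    (q : T0 * T0 * T0 -> R) (S : R) (m : R -> {finite_measure set T0 -> \bar R}) :
    exchange_flow lam mu0 q S m ->
  exists u : R -> R -> R, (forall t, has_density leb (m t) (u t)) /\
    forall t x, x <= 0 -> u t x = 0.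
Proof.
move=> flow; have H t : exists v : R -> R, has_density leb (m t) v /\
    forall x, x <= 0 -> v x = 0.
  have [v dv] := density_ex (@flow_dominates _ _ _ _ _ _ flow t).
  exists (v \_ (@Rpos R)); split.
    apply: density_cutoff dv; first exact: measurable_Rpos.
    rewrite (_ : ~` _ = [set x | x <= 0]); first exact: (flow_nonpos flow t).
    by apply/seteqP; split => x /=; rewrite /Rpos/= leNgt => /negP.
  by move=> x x0; rewrite patchE memNset// /Rpos/= ltNge x0.
have [u uP] := choice H; exists u; split => t; first by case: (uP t).
by case: (uP t).
Qed.

(** A smooth test function that is bounded almost everywhere is bounded
    everywhere; extended by 0 to the negative half-line it can be used in
    [flow_weak]. *)
Lemma flow_weak_formulation (lam mu0 : {finite_measure set T0 -> \bar R})
    (q : T0 * T0 * T0 -> R) (A S : R) (m : R -> {finite_measure set T0 -> \bar R})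
    (u : R -> R -> R) (K : R * R * R -> R) (phi zin : R -> R) :
    exchange_flow lam mu0 q S m -> measurable_fun setT q -> (forall p, 0 <= q p) ->
    (forall p, q p <= A * ((1 + `|p.1.1|) * (1 + `|p.1.2|))) ->
    (forall p, q p != 0 -> [/\ 0 < p.2, p.2 < p.1.1 & 0 < p.1.2]) -> 0 <= A ->
    has_density leb lam phi -> has_density leb mu0 (half_abs zin) ->
    (forall x y z, 0 < z -> z < x -> 0 < y -> x + y != 1 ->
      K (x, y, z) = q (x, y, z) * phi z) ->
    (forall t, has_density leb (m t) (u t)) -> (forall t x, x <= 0 -> u t x = 0) ->
    in_L01 zin -> {ae lebesgue1 R, forall x, 0 < x -> 0 <= zin x} ->
  forall (t : R) (w : R -> R), 0 <= t ->
    smooth_on_Rpos w -> in_Linfty (lebesgue1 R) (@Rpos R) w ->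
    (\int[lebesgue1 R]_(x in @Rpos R) (w x * (u t x - zin x))%:E =
     \int[lebesgue1 R]_(s in `[0%R, t]) \int[lebesgue1 R]_(x in @Rpos R)
     \int[lebesgue1 R]_(y in @Rpos R) \int[lebesgue1 R]_(z in `]0%R, x[)
       ((w (y + z) + w (x - z) - w x - w y) * K (x, y, z) * u s x * u s y)%:E)%E.
Proof.
move=> flow mq q0 qle q_supp A0 dlam d0 KE dens u0 zin01 zin_ge0 t w t0 sw [mw [M wM]].
have {}wM := continuous_ae_bound (smooth_on_Rpos_continuous sw) wM.
pose w' x := if 0 < x then w x else 0.
have mw' : measurable_fun setT (w' : T0 -> R) by exact: measurable_restrict_Rpos.
have w'M x : `|w' x| <= `|M|.
  rewrite /w'; case: ifP => [x0|_]; last by rewrite normr0.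
  exact: le_trans (wM x x0) (ler_norm _).
have ww' x : 0 < x -> w x = w' x by rewrite /w' => ->.
have iw (mu : {finite_measure set T0 -> \bar R}) : mu.-integrable setT (EFin \o w').
  exact: (@integrable_bounded _ _ _ mu w' `|M| mw' w'M).
have mu_ : measurable_fun setT (u t : T0 -> R) by case: (dens t).
have mz := measurable_half_abs zin01.
have mR := @measurable_Rpos R.
transitivity (\int[leb]_x (w' x * u t x - w' x * half_abs zin x)%:E)%E.
  transitivity (\int[lebesgue1 R]_(x in @Rpos R)
      (w' x * u t x - w' x * half_abs zin x)%:E)%E; last first.
    by apply: integral_Rpos => x x0; rewrite /w' ltNge x0 !mul0r subrr.
  apply: ae_eq_integral => //.
  - apply/measurable_EFinP; apply: measurable_funM => //; apply: measurable_funB.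
      exact: measurable_funTS.
    exact: measurable_L01.
  - apply: measurable_funTS; apply/measurable_EFinP.
    by apply: measurable_funB; exact: measurable_funM.
  - case: zin_ge0 => N [mN N0 sub]; exists N; split => // x /= H; apply: sub => /= z0.
    apply: H => x0; congr EFin.
    by rewrite /half_abs x0 ww'// ger0_norm ?z0// mulrBr.
transitivity (\int[m t]_x w' x - \int[m 0]_x w' x)%:E.
  rewrite integralB_EFin//; last 2 first.
  - exact: (density_integrable (dens t) mw' (iw (m t))).
  - exact: (density_integrable d0 mw' (iw mu0)).
  rewrite EFinB (EFin_Rintegral (iw (m t))) (EFin_Rintegral (iw (m 0))).
  congr (_ - _)%E; first by rewrite (density_integral (dens t) mw' (iw (m t))).
  rewrite [RHS](eq_measure_integral mu0); last by move=> B mB _; exact: (flow_init flow mB).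
  by rewrite (density_integral d0 mw' (iw mu0)).
rewrite -(flow_weak flow t0 mw' w'M); apply: eq_integral => s _.
rewrite -(weak_form_flux dlam (dens s) (u0 s) (flow_moment flow s) mq q0 qle q_supp A0 KE mw' w'M).
apply: eq_integral => x; rewrite inE => x0; apply: eq_integral => y; rewrite inE => y0.
apply: eq_integral => z; rewrite inE /= in_itv/= => /andP[z0 zx].
by rewrite (ww' x)// (ww' y)// (ww' (y + z)) ?addr_gt0// (ww' (x - z)) ?subr_gt0.
Qed.

End final_assembly.

Theorem theorem2p3 (R : realType) (zin phi : R -> R) (K : R * R * R -> R) (A : R)
  (zin_ge0 : {ae lebesgue1 R, forall x, 0 < x -> 0 <= zin x})
  (zin_L01 : in_L01 zin)
  (phi_L01 : in_L01 phi)
  (K_meas : measurable_fun (@Rpos3 R) K)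
  (K_ge0 : forall x y z : R, 0 < x -> 0 < y -> 0 < z -> 0 <= K (x, y, z))
  (K_supp : forall x y z : R, 0 < x -> 0 < y -> 0 < z -> x < z -> K (x, y, z) = 0)
  (A_ge0 : 0 <= A)
  (K_small : forall x y z : R, 0 < x -> 0 < y -> 0 < z ->
     x + y < 1 -> K (x, y, z) <= A * phi z)
  (K_large : forall x y z : R, 0 < x -> 0 < y -> 0 < z ->
     1 < x + y -> K (x, y, z) <= A * (x + y) * phi z)
  (K_W1infty : in_W1infty_loc K)
  (K_dx : forall dK : R * R * R -> R,
     in_Linfty_loc dK -> weak_derivative (ex_ R) K dK ->
     {ae lebesgue3 R, forall p, Rpos3 p -> dK p <= A * (1 + p.1.2) * phi p.2})
  (K_dy : forall dK : R * R * R -> R,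
     in_Linfty_loc dK -> weak_derivative (ey_ R) K dK ->
     {ae lebesgue3 R, forall p, Rpos3 p -> dK p <= A * (1 + p.1.1) * phi p.2}) :
  exists zeta : R -> R -> R,
    [/\ weak_solution K zin zeta,
        continuous_L01 zeta &
        forall T : R, 0 < T -> in_Linfty_L01 T zeta].
Proof.
have [lam [Z [Z0 dlam lamZ _]]] := L01_measure_ex phi_L01.
have [mu0 [S [S0 d0 mu0S mu0_pos]]] := L01_measure_ex zin_L01.
have [q [mq q0 qle q_supp KE]] :=
  kernel_factor_ex phi_L01 K_meas K_ge0 A_ge0 K_small K_large.
have {}lamZ : (\int[lam]_z `|z|%:E <= Z%:E)%E.
  apply: le_trans lamZ; apply: ge0_le_integral => //.
  - exact/measurable_EFinP.
  - by apply/measurable_EFinP; apply: measurable_funD => //; exact: measurableT_comp.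
  - by move=> z _; rewrite lee_fin lerDr.
have [m flow] := exchange_flow_ex mq q0 qle q_supp A_ge0 S0 Z0 mu0S mu0_pos lamZ
  (density_abs_cont d0) (density_abs_cont dlam).
have [u [dens u_nonpos]] := flow_density_ex flow.
have u_L1 t : in_L1 (u t) := flow_in_L1 dens t.
have u_L01 t : in_L01 (u t) := flow_in_L01 flow dens u_nonpos t.
have close := flow_L01_close flow dens u_nonpos.
have Linfty T : 0 < T -> in_Linfty_L01 T u.
  move=> T0; apply: (in_Linfty_L01_close u_L01 close T0) => t.
  exact: (flow_L01norm flow dens u_nonpos t).
exists u; split => //; last exact: continuous_L01_close.
split => //.
- by move=> t _; apply: aeW => x _; case: (dens t).
- exact: weakly_continuous_L1_close.
- exact: (flow_weak_formulation flow mq q0 qle q_supp A_ge0 dlam d0 KE dens u_nonpos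
    zin_L01 zin_ge0).
Qed.
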